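(* Let $m\geq 0$ and $d\geq 1$ be integers, and consider the uniform matroid $U_{m,d}$ with its natural action of $S_{m+d}$. Then its equivariant inverse Kazhdan–Lusztig polynomial is $$Q_{U_{m,d}}^{S_{m+d}}(t)=\sum_{j=0}^{\lfloor (d-1)/2 \rfloor}V_{(m+1,2^{j},1^{d-2j-1})}\,t^j,$$ where $V_{(m+1,2^{j},1^{d-2j-1})}$ is interpreted as $0$ if $(m+1,2^{j},1^{d-2j-1})$ is not a valid partition.
   Context: An equivariant matroid $W\curvearrowright M$ is a matroid $M$ on a finite ground set $\mathcal{I}$ together with a finite group $W$ acting on $\mathcal{I}$ and preserving $M$. $\mathrm{VRep}(W)$ is the ring of virtual (complex) representations of $W$, and $\mathrm{VRep}(W)[t]$ the polynomial ring over it. Let $L(M)$ be the lattice of flats of $M$; for a flat $F$, $M_F$ (localization) is the matroid on $F$ whose lattice of flats is $\{G\in L(M): G\le F\}$, $M^F$ (contraction) is the matroid on $\mathcal{I}\setminus F$ whose lattice of flats is $\{G\in L(M):G\geq F\}$, and $W_F\subseteq W$ is the stabilizer of $F$, which acts on $M_F$ and $M^F$. The equivariant characteristic polynomial is $H_M^W(t)=\sum_{i=0}^{\mathrm{rk} M}(-1)^i t^{\mathrm{rk} M-i}OS^W_{M,i}$, where $OS^W_{M,i}$ is the degree-$i$ part of the Orlik–Solomon algebra of $M$ with its induced $W$-action. The equivariant inverse Kazhdan–Lusztig polynomial $Q_M^W(t)\in\mathrm{VRep}(W)[t]$ is the unique assignment such that: (a) if $\mathrm{rk} M=0$, $Q_M^W(t)$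 is the trivial representation in degree $0$; (b) if $\mathrm{rk} M>0$, $\deg Q_M^W(t)<\frac12\mathrm{rk} M$; (c) for every $W\curvearrowright M$, $$(-t)^{\mathrm{rk} M}Q_M^W(t^{-1})=\sum_{[F]\in L(M)/W}\mathrm{Ind}_{W_F}^{W}\Big((-1)^{\mathrm{rk} M_F}Q_{M_F}^{W_F}(t)\otimes t^{\mathrm{rk} M^F}H_{M^F}^{W_F}(t^{-1})\Big),$$ the sum over $W$-orbits of flats. The uniform matroid $U_{m,d}$ is the matroid of rank $d$ on $m+d$ elements in which every subset of size at most $d$ is independent; $S_{m+d}$ acts by permuting the ground set. $V_\lambda$ denotes the irreducible representation (Specht module) of $S_{m+d}$ indexed by the partition $\lambda$; $a^k$ denotes $k$ parts equal to $a$. *)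

(* Defs.v *)
(* Representations are over algC; VRep(W) is the ring of virtual characters
   'Z[irr W] inside 'CF(W), where the tensor product is the pointwise product. *)
From HB Require Import structures.
From mathcomp Require Import all_boot all_order all_algebra.
From mathcomp Require Import all_fingroup all_solvable all_field all_character.

Set Implicit Arguments.
Unset Strict Implicit.
Unset Printing Implicit Defensive.

Import GroupScope Order.TTheory GRing.Theory Num.Theory.
Local Open Scope ring_scope.

(* Ground sets are subsets of an ambient finite type T, so that a matroid and
   its minors have the same type. *)
Definition matroid_axioms (T : finType) (E : {set T}) (I : {set {set T}}) :=
  [&& set0 \in I,
      [forall A in I, A \subset E],
      [forall A in I, [forall B : {set T}, (B \subset A) ==> (B \in I)]] &
      [forall A in I, [forall B in I, (#|A| < #|B|)%N ==>
        [exists x in B :\: A, x |: A \in I]]]].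

Record matroid (T : finType) := Matroid {
  ground : {set T};
  indep : {set {set T}};
  matroidP : matroid_axioms ground indep }.

Section MatroidTheory.
Variables (T : finType) (M : matroid T).
Implicit Types A B F I : {set T}.

Definition mrank A : nat := \max_(I in indep M | I \subset A) #|I|.

Definition rk : nat := mrank (ground M).

Definition flats : {set {set T}} :=
  [set F : {set T} | (F \subset ground M) &&
     [forall x in ground M :\: F, (mrank F < mrank (x |: F))%N]].

Lemma indep0 : set0 \in indep M.
Proof. by case/and4P: (matroidP M). Qed.

Lemma indep_ground I : I \in indep M -> I \subset ground M.
Proof. by case/and4P: (matroidP M) => _ /forall_inP h _ _; apply: h. Qed.

Lemma indepS A B : A \in indep M -> B \subset A -> B \in indep M.
Proof.
case/and4P: (matroidP M) => _ _ /forall_inP h _ iA sBA.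
by have /forallP/(_ B)/implyP := h A iA; apply.
Qed.

Lemma indep_exchange A B : A \in indep M -> B \in indep M -> (#|A| < #|B|)%N ->
  exists2 x, x \in B :\: A & x |: A \in indep M.
Proof.
case/and4P: (matroidP M) => _ _ _ /forall_inP h iA iB ltAB.
have /forall_inP/(_ B iB)/implyP/(_ ltAB)/exists_inP := h A iA.
by case=> x Bx ix; exists x.
Qed.

Lemma mrank_max A I : I \in indep M -> I \subset A -> (#|I| <= mrank A)%N.
Proof.
move=> iI sIA.
rewrite /mrank (bigD1 I) ?iI //=; exact: leq_maxl.
Qed.

Lemma mrank_basis A :
  exists I, [/\ I \in indep M, I \subset A & #|I| = mrank A].
Proof.
have [|I /andP[iI sIA] eqI] :=
  @eq_bigmax_cond _ [pred I | (I \in indep M) && (I \subset A)]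
    (fun I : {set T} => #|I|).
  by apply/card_gt0P; exists set0; rewrite inE /= indep0 sub0set.
by exists I; split.
Qed.

Lemma mrankS A B : A \subset B -> (mrank A <= mrank B)%N.
Proof.
move=> sAB; have [I [iI sIA <-]] := mrank_basis A.
exact: mrank_max (subset_trans sIA sAB).
Qed.

Lemma mrankU1 x A : (mrank (x |: A) <= (mrank A).+1)%N.
Proof.
have [I [iI sIA <-]] := mrank_basis (x |: A).
rewrite (cardsD1 x) -[(mrank A).+1]add1n leq_add ?leq_b1 //.
apply: mrank_max; last by rewrite subDset.
by apply: indepS iI _; rewrite subD1set.
Qed.

Lemma mrankU A B : (mrank (A :|: B) <= #|A| + mrank B)%N.
Proof.
have [n] := ubnP #|A|; elim: n A => // n IHn A.
have [-> _|[x Ax]] := set_0Vmem A; first by rewrite set0U leq_addl.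
rewrite (cardsD1 x) Ax ltnS => leAn; rewrite -{1}(setD1K Ax) -setUA.
by apply: leq_trans (mrankU1 _ _) _; rewrite addSn ltnS IHn.
Qed.

Definition loc_ground F := ground M :&: F.
Definition loc_indep F := [set A in indep M | A \subset F].

Lemma localization_axioms F : matroid_axioms (loc_ground F) (loc_indep F).
Proof.
apply/and4P; split.
- by rewrite inE indep0 sub0set.
- by apply/forall_inP=> A; rewrite inE subsetI => /andP[/indep_ground-> ->].
- apply/forall_inP=> A /[!inE]/andP[iA sAF]; apply/forallP=> B.
  by apply/implyP=> sBA; rewrite inE (indepS iA) ?(subset_trans sBA).
apply/forall_inP=> A /[!inE]/andP[iA sAF]; apply/forall_inP=> B.
rewrite inE => /andP[iB sBF]; apply/implyP=> /(indep_exchange iA iB)[x Bx ix].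
apply/exists_inP; exists x => //; rewrite inE ix subUset sAF sub1set andbT.
by case/setDP: Bx => /(subsetP sBF).
Qed.

Definition localization F := Matroid (localization_axioms F).

Definition con_ground F := ground M :\: F.
Definition con_indep F := [set A : {set T} | (A \subset con_ground F) &&
  (mrank (A :|: F) == #|A| + mrank F)%N].

Lemma contraction_axioms F : matroid_axioms (con_ground F) (con_indep F).
Proof.
apply/and4P; split.
- by rewrite inE sub0set set0U cards0 add0n eqxx.
- by apply/forall_inP=> A; rewrite inE => /andP[].
- apply/forall_inP=> A /[!inE]/andP[sAE /eqP rA]; apply/forallP=> B.
  apply/implyP=> sBA; rewrite inE (subset_trans sBA) //= eqn_leq mrankU /=.
  have:= mrankU (A :\: B) (B :|: F).
  rewrite setUA [_ :|: B]setUC setDE setUIr setUCr setIT (setUidPr sBA) rA.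
  by rewrite -setDE cardsDS // -{1}(subnK (subset_leq_card sBA)) -addnA leq_add2l.
apply/forall_inP=> A /[!inE]/andP[sAE /eqP rA]; apply/forall_inP=> B.
rewrite inE => /andP[sBE /eqP rB]; apply/implyP=> ltAB.
have [J [iJ sJ cJ]] := mrank_basis (A :|: F).
have [K [iK sK cK]] := mrank_basis (B :|: F).
have [|x /setDP[Kx J'x] ix] := indep_exchange iJ iK.
  by rewrite cJ cK rA rB ltn_add2r.
have AF'x : x \notin A :|: F.
  apply/negP=> AFx; have : (#|x |: J| <= mrank (A :|: F))%N.
    by rewrite mrank_max // subUset sub1set AFx.
  by rewrite cardsU1 J'x cJ add1n ltnn.
have [F'x A'x]: x \notin F /\ x \notin A.
  by move: AF'x; rewrite inE negb_or => /andP[].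
have Bx : x \in B by have:= subsetP sK x Kx; rewrite inE (negPf F'x) orbF.
apply/exists_inP; exists x; first by rewrite inE A'x.
rewrite inE subUset sub1set sAE (subsetP sBE) //= cardsU1 A'x add1n addSn -rA.
rewrite eqn_leq -setUA mrankU1 /= -cJ -[(#|J|).+1]/(1 + #|J|)%N.
have -> : (1 + #|J| = #|x |: J|)%N by rewrite cardsU1 J'x.
by rewrite mrank_max // setUS.
Qed.

Definition contraction F := Matroid (contraction_axioms F).

End MatroidTheory.

(* W acts on the ambient type T, stabilizing the ground set and the family of
   independent sets. *)
Record eqmatroid (gT : finGroupType) (T : finType) (to : {action gT &-> T})
    (W : {group gT}) := EqMatroid {
  eqm_matroid :> matroid T;
  eqmP : [acts W, on ground eqm_matroid | to]
           && [acts W, on indep eqm_matroid | to^*] }.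

Section Equivariant.
Variables (gT : finGroupType) (T : finType) (to : {action gT &-> T}).
Variables (W : {group gT}) (M : eqmatroid to W).
Implicit Types A F : {set T}.

Lemma mem_ground_act w x : w \in W -> (to x w \in ground M) = (x \in ground M).
Proof. by move=> Ww; case/andP: (eqmP M) => h _; rewrite (acts_act h). Qed.

Lemma indep_act w A : w \in W -> (to^*%act A w \in indep M) = (A \in indep M).
Proof. by move=> Ww; case/andP: (eqmP M) => _ h; rewrite (acts_act h). Qed.

Lemma mrank_act w A : w \in W -> mrank M (to^*%act A w) = mrank M A.
Proof.
have le v B : v \in W -> (mrank M B <= mrank M (to^*%act B v))%N.
  move=> Wv; have [I [iI sIB <-]] := mrank_basis M B.
  rewrite -(card_setact to I v); apply: mrank_max; first by rewrite indep_act.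
  exact: imsetS.
move=> Ww; apply/eqP; rewrite eqn_leq le // andbT.
by rewrite -{2}(actK to^*%act w A) le ?groupV.
Qed.

Lemma stab_act w F x : w \in 'N_W(F | to) -> (to x w \in F) = (x \in F).
Proof. by case/setIP=> _ Nw; apply: astabs_act. Qed.

Lemma stab_setact w F : w \in 'N_W(F | to) -> to^*%act F w = F.
Proof. by case/setIP=> _ /astabs_setact. Qed.

Lemma acts_intro (rT : finType) (ta : {action gT &-> rT}) (G : {group gT})
    (S : {set rT}) :
  (forall w x, w \in G -> x \in S -> ta x w \in S) -> [acts G, on S | ta].
Proof.
move=> h; apply/subsetP=> w Gw; rewrite !inE; apply/subsetP=> x Sx.
by rewrite inE h.
Qed.

Lemma localization_acts F :
  [acts 'N_W(F | to), on ground (localization M F) | to]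
    && [acts 'N_W(F | to), on indep (localization M F) | to^*].
Proof.
apply/andP; split; apply: acts_intro => w x Nw; have Ww := subsetP (subsetIl _ _) w Nw.
  by rewrite !inE mem_ground_act // (stab_act x Nw).
rewrite !inE indep_act // => /andP[-> sxF] /=.
by rewrite -(stab_setact Nw) imsetS.
Qed.

Definition eq_localization F : eqmatroid to ('N_W(F | to)%G) :=
  EqMatroid (localization_acts F).

Lemma contraction_acts F :
  [acts 'N_W(F | to), on ground (contraction M F) | to]
    && [acts 'N_W(F | to), on indep (contraction M F) | to^*].
Proof.
have gr w x : w \in 'N_W(F | to) -> x \in con_ground M F -> to x w \in con_ground M F.
  move=> Nw; have Ww := subsetP (subsetIl _ _) w Nw.
  by rewrite !inE mem_ground_act // (stab_act x Nw).
apply/andP; split; apply: acts_intro => w x Nw; first exact: gr.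
have Ww := subsetP (subsetIl _ _) w Nw.
rewrite !inE card_setact => /andP[sxE /eqP <-]; apply/andP; split.
  by apply/subsetP=> _ /imsetP[y xy ->]; apply/gr/(subsetP sxE).
by rewrite -{1}(stab_setact Nw) -imsetU (mrank_act (x :|: F) Ww).
Qed.

Definition eq_contraction F : eqmatroid to ('N_W(F | to)%G) :=
  EqMatroid (contraction_acts F).

(* The space of words of length k in T is the degree k part of the tensor
   algebra on T; [word_vec k s] is the basis vector of s (0 if size s != k). *)
Definition word_vec k (s : seq T) : 'rV[algC]_#|{: k.-tuple T}| :=
  \row_j (tval (enum_val j) == s)%:R.

Definition word_mx k (w : gT) : 'M[algC]_#|{: k.-tuple T}| :=
  \matrix_i word_vec k [seq to x w | x <- tval (enum_val i)].

Lemma word_vecE k s w :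
  word_vec k s *m word_mx k w = word_vec k [seq to x w | x <- s].
Proof.
have [sz|sz] := eqVneq (size s) k; last first.
  have word0 r : size r != k -> word_vec k r = 0.
    move=> szr; apply/rowP=> j; rewrite !mxE; case: eqP => // def_r.
    by rewrite -def_r size_tuple eqxx in szr.
  by rewrite !word0 ?size_map // mul0mx.
pose t : k.-tuple T := tcast sz (in_tuple s).
have def_t : tval t = s by rewrite val_tcast.
have ->: word_vec k s = delta_mx 0 (enum_rank t).
  apply/rowP=> j; rewrite !mxE eqxx /= -def_t (inj_eq val_inj).
  by rewrite (can2_eq enum_valK enum_rankK).
by rewrite -rowE rowK enum_rankK def_t.
Qed.

Lemma word_mx_repr k : mx_repr W (word_mx k).
Proof.
have wE i : word_vec k (tval (enum_val i)) = delta_mx 0 i.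
  by apply/rowP=> j; rewrite !mxE eqxx (inj_eq val_inj) (inj_eq enum_val_inj).
split=> [|w v _ _]; apply/row_matrixP=> i.
  by rewrite rowK row1 (eq_map (act1 to)) map_id wE.
rewrite row_mul !rowK word_vecE -map_comp; congr (word_vec k _).
by apply: eq_map => x; rewrite /= actM.
Qed.

Canonical word_repr k := MxRepresentation (word_mx_repr k).

(* Degree k part of the kernel of the map from the tensor algebra on T to the
   Orlik-Solomon algebra: letters outside the ground set are sent to 0; words
   are alternating (the two positions may carry the same letter, giving
   2 *: word = 0); and the ideal of the exterior algebra generated by the
   boundaries of the dependent sets, spanned by the products of such a boundary
   with a word on its right (one side suffices, homogeneous elements of the
   exterior algebra commuting up to sign).  In the last family the dependent
   set is listed by the first l letters of t, and the i-th letter is omitted. *)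
Definition OS_letters k : 'M[algC]_#|{: k.-tuple T}| :=
  (\sum_(t : k.-tuple T | ~~ all (mem (ground M)) t) <<word_vec k t>>)%MS.

Definition OS_alternation k : 'M[algC]_#|{: k.-tuple T}| :=
  (\sum_(t : k.-tuple T) \sum_(i < k) \sum_(j < k | i != j)
     <<(word_vec k t + word_vec k [tuple tnth t (tperm i j l) | l < k])%R>>)%MS.

Definition dependent_word (s : seq T) : bool :=
  [&& uniq s, all (mem (ground M)) s & [set x in s] \notin indep M].

Definition OS_boundary k : 'M[algC]_#|{: k.-tuple T}| :=
  (\sum_(t : k.+1.-tuple T) \sum_(l < k.+2 | dependent_word (take l t))
     <<(\sum_(i < l) (-1) ^+ i *: word_vec k (take i t ++ drop i.+1 t))%R>>)%MS.

Definition OS_relations k : 'M[algC]_#|{: k.-tuple T}| :=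
  (OS_letters k + OS_alternation k + OS_boundary k)%MS.

Lemma dependent_word_act w s : w \in W ->
  dependent_word [seq to x w | x <- s] = dependent_word s.
Proof.
move=> Ww; rewrite /dependent_word map_inj_uniq; last exact: act_inj.
rewrite all_map (eq_all (fun x => mem_ground_act x Ww)).
have -> : [set x in [seq to x w | x <- s]] = to^*%act [set x in s] w.
  apply/setP=> x; rewrite inE; apply/mapP/imsetP => [] [y sy ->];
    by exists y; rewrite ?inE in sy *.
by rewrite indep_act.
Qed.

Lemma OS_relations_module k : mxmodule (word_repr k) (OS_relations k).
Proof.
apply/mxmoduleP=> w Ww; rewrite {1}/OS_relations !(addsmxMr, addsmx_sub).
apply/andP; split; first (apply/andP; split).
- rewrite sumsmxMr; apply/sumsmx_subP=> t Et.
  rewrite (eqmxMr _ (genmxE _)) /= word_vecE.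
  apply: submx_trans (submx_trans (addsmxSl _ _) (addsmxSl _ _)).
  rewrite /OS_letters; apply: (sumsmx_sup (map_tuple (to^~ w) t)); rewrite ?genmxE //=.
  by rewrite all_map (eq_all (fun x => mem_ground_act x Ww)).
- rewrite sumsmxMr; apply/sumsmx_subP=> t _.
  rewrite sumsmxMr; apply/sumsmx_subP=> i _.
  rewrite sumsmxMr; apply/sumsmx_subP=> j ij.
  rewrite (eqmxMr _ (genmxE _)) /= mulmxDl !word_vecE.
  apply: submx_trans (submx_trans (addsmxSr _ _) (addsmxSl _ _)).
  rewrite /OS_alternation; apply: (sumsmx_sup (map_tuple (to^~ w) t)) => //.
  apply: (sumsmx_sup i) => //; apply: (sumsmx_sup j) => //; rewrite genmxE.
  suff -> : [seq to x w | x <- [tuple tnth t (tperm i j l) | l < k]] =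
      [tuple tnth (map_tuple (to^~ w) t) (tperm i j l) | l < k] by [].
  by rewrite /= -map_comp; apply: eq_map => l; rewrite /= tnth_map.
rewrite sumsmxMr; apply/sumsmx_subP=> t _.
rewrite sumsmxMr; apply/sumsmx_subP=> l dep.
rewrite (eqmxMr _ (genmxE _)) /= mulmx_suml.
apply: submx_trans (addsmxSr _ _).
rewrite /OS_boundary; apply: (sumsmx_sup (map_tuple (to^~ w) t)) => //.
apply: (sumsmx_sup l); first by rewrite -map_take dependent_word_act.
rewrite genmxE; set v1 := \sum_i _; set v2 := \sum_i _.
suff -> : v1 = v2 by [].
by apply: eq_bigr => i _; rewrite -scalemxAl word_vecE /= map_cat map_take map_drop.
Qed.

Definition OS k : 'CF(W) := cfRepr (factmod_repr (OS_relations_module k)).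

Definition eq_char_poly : {poly 'CF(W)} :=
  \sum_(i < (rk M).+1) ((-1) ^+ i * OS i) *: 'X^(rk M - i).

End Equivariant.

(* t^r p(t^-1), for p of degree at most r *)
Definition recip (R : nzRingType) (r : nat) (p : {poly R}) : {poly R} :=
  \poly_(i < r.+1) p`_(r - i).

Definition eqmatroid_polynomial :=
  forall (gT : finGroupType) (T : finType) (to : {action gT &-> T})
         (W : {group gT}), eqmatroid to W -> {poly 'CF(W)}.

Definition inverse_KL (Q : eqmatroid_polynomial) : Prop :=
  forall (gT : finGroupType) (T : finType) (to : {action gT &-> T})
         (W : {group gT}) (M : eqmatroid to W),
  [/\ Q _ _ _ _ M \is a polyOver 'Z[irr W],
      rk M = 0%N -> Q _ _ _ _ M = 1,
      (0 < rk M)%N -> ((size (Q _ _ _ _ M)).-1.*2 < rk M)%N &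
      (-1) ^+ rk M * recip (rk M) (Q _ _ _ _ M) =
        \sum_(F in orbit_transversal to^*%act W (flats M))
          map_poly 'Ind[W, 'N_W(F | to)]
            ((-1) ^+ rk (localization M F) * Q _ _ _ _ (eq_localization M F) *
             recip (rk (contraction M F)) (eq_char_poly (eq_contraction M F)))].

Section Uniform.
Variables (m d : nat).

Definition uniform_indep := [set A : {set 'I_(m + d)} | (#|A| <= d)%N].

Lemma uniform_axioms : matroid_axioms [set: 'I_(m + d)] uniform_indep.
Proof.
apply/and4P; split.
- by rewrite inE cards0.
- by apply/forall_inP=> A _; apply: subsetT.
- apply/forall_inP=> A /[!inE] cA; apply/forallP=> B; apply/implyP=> sBA.
  by rewrite inE (leq_trans (subset_leq_card sBA)).
apply/forall_inP=> A _; apply/forall_inP=> B /[!inE] cB; apply/implyP=> ltAB.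
have /subsetPn[x Bx A'x] : ~~ (B \subset A).
  by apply: contraL ltAB => /subset_leq_card; rewrite -leqNgt.
apply/exists_inP; exists x; first by rewrite inE A'x.
by rewrite inE cardsU1 A'x (leq_trans ltAB).
Qed.

Definition uniform := Matroid uniform_axioms.

Lemma uniform_acts : [acts [set: 'S_(m + d)], on ground uniform | 'P]
  && [acts [set: 'S_(m + d)], on indep uniform | 'P^*].
Proof.
by apply/andP; split; apply/subsetP=> w _; rewrite !inE; apply/subsetP=> x;
  rewrite !inE ?card_setact.
Qed.

Definition eq_uniform : eqmatroid 'P [set: 'S_(m + d)]%G :=
  EqMatroid uniform_acts.

End Uniform.

Definition is_partition (n : nat) (la : seq nat) : bool :=
  [&& sorted geq la, all (leq 1) la & sumn la == n].

Section Specht.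
Variables (n : nat) (la : seq nat).

(* Row and column groups of the tableau of shape la filled with 0, ..., n - 1
   row by row: i lies in row [reshape_index la i], column
   [reshape_offset la i]. *)
Definition row_group : {set 'S_n} :=
  [set s : 'S_n | [forall i, reshape_index la (s i) == reshape_index la i]].
Definition col_group : {set 'S_n} :=
  [set s : 'S_n | [forall i, reshape_offset la (s i) == reshape_offset la i]].

(* The Specht module is the left ideal of the group algebra generated by the
   Young symmetrizer a * b, where a is the row symmetrizer and b the column
   antisymmetrizer.  MathComp representations act on the right and the product
   of permutations is composed from left to right, so this is the right module
   generated by b *m a. *)
Local Notation aG := (regular_repr algC [set: 'S_n]%G).

Definition young_symmetrizer : 'rV[algC]_#|[set: 'S_n]| :=
  gring_row ((\sum_(s in col_group) (-1) ^+ s *: aG s) *m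
             (\sum_(s in row_group) aG s)).

Definition specht : 'CF([set: 'S_n]) :=
  cfRepr (submod_repr (cyclic_mx_module aG young_symmetrizer)).

Definition V : 'CF([set: 'S_n]) := if is_partition n la then specht else 0.

End Specht.

(* Main.v *)
From HB Require Import structures.
From mathcomp Require Import all_boot all_order all_algebra.
From mathcomp Require Import all_fingroup all_solvable all_field all_character.
From mathcomp Require Import zify ring.
Require Import Defs.

Set Implicit Arguments.
Unset Strict Implicit.
Unset Printing Implicit Defensive.

Import GroupScope Order.TTheory GRing.Theory Num.Theory.
Local Open Scope ring_scope.

(* For a uniform matroid OS_i is the i-th exterior power below the top degree,
   and in the top degree contractibility of the Koszul complex makes it an
   alternating sum of exterior powers.  For 2j < d the coefficient of t^j in the
   defining recursion has no contribution of Q_M on the left, and the proper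
   flats have boolean localizations, so the recursion expresses Q_j through signs
   of permutations restricted to pairs of stable sets.  The outcome is the class
   function theta with Frobenius characteristic
     e_j s_(m+1,1^(d-j-1)) - e_(d-j) s_(m+1,1^(j-1)).
   Its pairings with itself, with the trivial character of the row group and with
   the sign character of the column group are signed counts of orbits of pairs of
   sets under Young subgroups, that is, coefficients of explicit polynomials in
   two variables; they are 1, 1 and 1.  A virtual character of norm 1 with such
   pairings is the Specht character, by von Neumann's lemma on Young tableaux. *)

(** * Signs of restricted permutations *)

(** The recursion passes to stabilizers of flats acting on minors, so the induction cannot stay
    inside symmetric groups: it runs over every group acting on a uniform matroid, and the value of
    a character at [w] is expressed through [actperm to w] alone. The left side carries, up to sign,
    coefficient d - j of Q_M, which vanishes by the degree bound; the flat E contributes Q_j itself,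
    so the recursion can be solved for it.

    When the shape is a partition, the Pieri rule says that the subtracted product in theta removes
    all constituents but one. This rule is replaced by generating functions: the alternating sum
    that defines a hook becomes division by 1 + y, and every pairing becomes a coefficient of such a
    quotient. Norm 1 leaves a sign and an irreducible character undetermined; positivity of the row
    pairing fixes the sign, and the two pairings together single out the Specht character. *)

Section RestrictedSign.
Variable T : finType.
Implicit Types (A B E : {set T}) (s u : {perm T}).

Definition stable s A := s \in 'N(A | 'P).

Lemma stableP s A : reflect (forall x, (s x \in A) = (x \in A)) (stable s A).
Proof. by rewrite /stable; exact: (iffP (@astabsP _ _ 'P%act A s)). Qed.

(** Equal to 1 when [s] does not stabilize [A], since [restr_perm] is then trivial; this default
    lets [sgn_onJ] hold without a stability hypothesis. *)
Definition sgn_on A s : algC := (-1) ^+ restr_perm A s.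

Lemma restr_perm_if A s x : stable s A -> restr_perm A s x = if x \in A then s x else x.
Proof.
move=> As; case: ifP => Ax; first by rewrite restr_permE.
by rewrite (out_perm (restr_perm_on _ _)) ?Ax.
Qed.

Lemma restr_perm_char A s (r : {perm T}) :
  {in A, r =1 s} -> {in ~: A, r =1 id} -> stable s A -> restr_perm A s = r.
Proof.
move=> rA rA' As; apply/permP=> x; rewrite restr_perm_if //.
by case: ifP => Ax; [rewrite rA | rewrite rA' ?inE ?Ax].
Qed.

Lemma stableU s A B : stable s A -> stable s B -> stable s (A :|: B).
Proof. by move=> /stableP sA /stableP sB; apply/stableP=> x; rewrite !inE sA sB. Qed.

Lemma stableI s A B : stable s A -> stable s B -> stable s (A :&: B).
Proof. by move=> /stableP sA /stableP sB; apply/stableP=> x; rewrite !inE sA sB. Qed.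

Lemma stableD s A B : stable s A -> stable s B -> stable s (A :\: B).
Proof. by move=> /stableP sA /stableP sB; apply/stableP=> x; rewrite !inE sA sB. Qed.

Lemma stable0 s : stable s set0.
Proof. by apply/stableP=> x; rewrite !inE. Qed.

Lemma stableT s : stable s setT.
Proof. by apply/stableP=> x; rewrite !inE. Qed.

Lemma sgn_onM A s u : stable s A -> stable u A ->
  sgn_on A (s * u) = sgn_on A s * sgn_on A u.
Proof. by move=> sA uA; rewrite /sgn_on morphM // odd_permM signr_addb. Qed.

Lemma sgn_on_id A s : stable s A -> {in A, s =1 id} -> sgn_on A s = 1.
Proof.
move=> sA s1; rewrite /sgn_on (@restr_perm_char _ _ 1) ?odd_perm1 //.
  by move=> x Ax; rewrite perm1 s1.
by move=> x _; rewrite perm1.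
Qed.

Lemma sgn_on0 s : sgn_on set0 s = 1.
Proof. by rewrite sgn_on_id ?stable0 // => x; rewrite inE. Qed.

Lemma sgn_onT s : sgn_on setT s = (-1) ^+ s.
Proof.
by rewrite /sgn_on (@restr_perm_char _ _ s) ?stableT // => x; rewrite !inE.
Qed.

Lemma sgn_on_sqr A s : sgn_on A s * sgn_on A s = 1.
Proof. by rewrite /sgn_on -expr2 sqrr_sign. Qed.

Lemma sgn_onU A B s : [disjoint A & B] -> stable s A -> stable s B ->
  sgn_on (A :|: B) s = sgn_on A s * sgn_on B s.
Proof.
move=> dAB sA sB; rewrite /sgn_on -signr_addb -odd_permM; congr ((-1) ^+ (odd_perm _)).
apply: restr_perm_char; last exact: stableU.
  move=> x; rewrite inE permM !restr_perm_if //; case: (boolP (x \in A)) => /= Ax.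
    by rewrite (stableP _ _ sB) (disjointFr dAB).
  by move=> ->.
by move=> x; rewrite permM !restr_perm_if // !inE => /norP[/negPf-> /negPf->].
Qed.

(** An [s] preserving [f] stabilizes every fibre, and signs multiply over disjoint stable pieces.
    With [f] a colouring, this splits a sign along the blocks of a Young subgroup. *)
Lemma sgn_on_bigcup (I : finType) (f : T -> I) A s :
    stable s A -> (forall x, f (s x) = f x) ->
  sgn_on A s = \prod_i sgn_on (A :&: f @^-1: [set i]) s.
Proof.
move=> sA fs.
have st (J : pred I) : stable s (A :&: [set x | J (f x)]).
  by apply/stableI => //; apply/stableP=> x; rewrite !inE fs.
suff H (r : seq I) : uniq r ->
    sgn_on (A :&: [set x | f x \in r]) s = \prod_(i <- r) sgn_on (A :&: f @^-1: [set i]) s.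
  rewrite -H ?index_enum_uniq //; congr (sgn_on _ _).
  by apply/setP=> x; rewrite !inE mem_index_enum andbT.
elim: r => [|i r IHr] /=.
  by rewrite big_nil (_ : _ :&: _ = set0) ?sgn_on0 //; apply/setP=> x; rewrite !inE andbF.
move=> /andP[i'r ur]; rewrite big_cons -IHr // -sgn_onU.
- by congr (sgn_on _ _); apply/setP=> x; rewrite !inE -andb_orr.
- rewrite disjoint_subset; apply/subsetP=> x; rewrite !inE => /andP[_ /eqP->].
  by rewrite (negPf i'r) andbF.
- have := st (pred1 i); congr (stable _ _).
  by apply/setP=> x; rewrite !inE.
exact: st (mem r).
Qed.

Lemma stable_tperm A x y : (x \in A) = (y \in A) -> stable (tperm x y) A.
Proof. by move=> Axy; apply/stableP=> z; case: tpermP => [->|->|]. Qed.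

Lemma sgn_on_tperm A x y : x != y -> x \in A -> y \in A -> sgn_on A (tperm x y) = -1.
Proof.
move=> xy Ax Ay; rewrite /sgn_on (@restr_perm_char _ _ (tperm x y)) //.
- by rewrite odd_tperm xy.
- by move=> z; rewrite inE => Az; rewrite tpermD //; apply: contraNneq Az => <-.
by rewrite stable_tperm ?Ax.
Qed.

Lemma sgn_on_tperm_out A x y : x \notin A -> y \notin A -> sgn_on A (tperm x y) = 1.
Proof.
move=> Ax Ay; apply: sgn_on_id; first by rewrite stable_tperm ?(negPf Ax) ?(negPf Ay).
by move=> z Az; rewrite tpermD //; [move: Ax | move: Ay]; apply: contraNneq => ->.
Qed.

Lemma sgn_on_card1 A s : (#|A| <= 1)%N -> sgn_on A s = 1.
Proof. by move=> A1; rewrite /sgn_on (perm_on_id (restr_perm_on _ _) A1) odd_perm1. Qed.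

Lemma stableJ A s u : stable (s ^ u) (u @: A) = stable s A.
Proof.
apply/stableP/stableP=> h x.
  by have := h (u x); rewrite permJ !(mem_imset _ _ perm_inj).
by rewrite -[x](permKV u) permJ !(mem_imset _ _ perm_inj).
Qed.

Lemma sgn_onJ A s u : sgn_on (u @: A) (s ^ u) = sgn_on A s.
Proof.
have [sA|sA] := boolP (stable s A); last first.
  by rewrite /sgn_on !triv_restr_perm // -/(stable _ _) ?stableJ.
rewrite /sgn_on (@restr_perm_char _ _ (restr_perm A s ^ u)) ?stableJ ?odd_permJ //.
  by move=> _ /imsetP[x Ax ->]; rewrite !permJ restr_perm_if // Ax.
move=> x; rewrite inE -{1 2}[x](permKV u) (mem_imset _ _ perm_inj) => A'x.
by rewrite permJ restr_perm_if // (negPf A'x) permKV.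
Qed.

(* The character of the k-th exterior power of the permutation module on E. *)
Definition lam E k s : algC :=
  \sum_(A : {set T} | [&& A \subset E, #|A| == k & stable s A]) sgn_on A s.

Definition lam2 E a b s : algC :=
  \sum_(A : {set T} | [&& A \subset E, #|A| == a & stable s A])
    sgn_on A s * lam (E :\: A) b s.

Lemma imset_perm_bij u : bijective (fun A : {set T} => u @: A).
Proof.
exists (fun A : {set T} => u^-1%g @: A) => A; rewrite -imset_comp.
  by rewrite (eq_imset _ (permK u)) imset_id.
by rewrite (eq_imset _ (permKV u)) imset_id.
Qed.

Lemma imset_permD u A B : u @: (A :\: B) = u @: A :\: u @: B.
Proof.
by apply/setP=> x; rewrite -[x](permKV u) !(inE, mem_imset _ _ perm_inj).
Qed.

Lemma imset_permS u A B : (u @: A \subset u @: B) = (A \subset B).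
Proof.
apply/idP/idP=> [sAB|]; last exact: imsetS.
by apply/subsetP=> x Ax; rewrite -(mem_imset B x (@perm_inj _ u)) (subsetP sAB) ?imset_f.
Qed.

Lemma lamJ E k s u : lam (u @: E) k (s ^ u) = lam E k s.
Proof.
rewrite /lam (reindex _ (onW_bij _ (imset_perm_bij u))) /=.
apply: eq_big => A; last by rewrite sgn_onJ.
by rewrite stableJ imset_permS card_imset //; apply: perm_inj.
Qed.

Lemma lam0 E s : lam E 0 s = 1.
Proof.
rewrite /lam (big_pred1 set0) ?sgn_on0 // => A.
by rewrite cards_eq0 /=; case: eqP => [->|]; rewrite ?sub0set ?stable0 ?andbF.
Qed.

Lemma lam_card E s : stable s E -> lam E #|E| s = sgn_on E s.
Proof.
move=> sE; rewrite /lam (big_pred1 E) // => A /=.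
apply/and3P/eqP=> [[sAE /eqP cA _]|->]; last by split=> //; rewrite subxx.
by apply/eqP; rewrite eqEcard sAE cA leqnn.
Qed.

Lemma lam2_sym E a b s : stable s E -> lam2 E a b s = lam2 E b a s.
Proof.
move=> sE; rewrite /lam2.
under eq_bigr do rewrite big_distrr /=.
under [RHS]eq_bigr do rewrite big_distrr /=.
rewrite (exchange_big_dep [pred B : {set T} | [&& B \subset E, #|B| == b & stable s B]]) /=.
  apply: eq_bigr => B /and3P[sBE /eqP cB stB]; apply: eq_big => A; last by rewrite mulrC.
  rewrite !subsetD cB stB eqxx sBE disjoint_sym /= andbT.
  by case: (A \subset E); case: [disjoint _ & _]; rewrite ?andbF ?andbT.
by move=> A B _ /and3P[]; rewrite subsetD => /andP[-> _] -> ->.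
Qed.

End RestrictedSign.

(** [I] and [T] are different types, so parity is carried over by factoring [r] into transpositions,
    each of which [t] takes to a transposition of [T]. This compares permutations of the positions
    of a word with permutations of its letters. *)
Lemma sgn_on_codom (I T : finType) (t : I -> T) (r : {perm I}) (s : {perm T}) :
    injective t -> (forall i, s (t i) = t (r i)) ->
  sgn_on [set t i | i in I] s = (-1) ^+ r.
Proof.
move=> inj_t st.
have [u [ut uo odd_u]] : exists u : {perm T}, [/\ forall i, u (t i) = t (r i),
    {in ~: [set t i | i in I], u =1 id} & odd_perm u = odd_perm r].
  case: (prod_tpermP r) => l -> /allP dl {st}.
  elim: l dl => [|[x y] l IHl] dl.
    rewrite big_nil; exists (1%g : {perm T}); split=> [i|x _|]; rewrite ?perm1 //.
    by rewrite !odd_perm1.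
  case: IHl => [p lp|u [ut uo odd_u]]; first by rewrite dl // inE lp orbT.
  exists (tperm (t x) (t y) * u)%g; split=> [i|z|].
  - by rewrite big_cons !permM /= -inj_tperm // ut.
  - rewrite inE => t'z; rewrite permM tpermD ?uo ?inE //;
      by apply: contraNneq t'z => <-; apply: imset_f.
  by rewrite big_cons !odd_mul_tperm odd_u (inj_eq inj_t).
rewrite -odd_u /sgn_on (@restr_perm_char _ _ _ u) //.
  by move=> _ /imsetP[i _ ->]; rewrite ut st.
apply/stableP=> x; apply/imsetP/imsetP=> [[i _ sx]|[i _ ->]]; last by exists (r i).
exists (r^-1%g i) => //; apply: (@perm_inj _ s).
by rewrite st permKV.
Qed.

(** * The Koszul homotopy on words *)

(** The two conditions on [P] make it a projection with kernel [U], so its image models the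
    quotient. No equivariance of [P] is involved: a component of the action inside [U] is killed by
    [P]. *)
Lemma mxtrace_factmod (gT : finGroupType) (G : {group gT}) n
    (rG : mx_representation algC G n) (U : 'M_n) (modU : mxmodule rG U)
    (P : 'M_n) x :
    U *m P = 0 -> (1%:M - P <= U)%MS -> x \in G ->
  \tr (factmod_repr modU x) = \tr (rG x *m P).
Proof.
move=> UP PU Gx.
have PI : in_factmod U P = in_factmod U 1%:M.
  by apply/eqP; rewrite eq_sym -subr_eq0 -linearB in_factmod_eq0.
have VP : in_factmod U 1%:M *m (val_factmod 1%:M *m P) = P.
  rewrite mulmxA -val_factmodE -[RHS]mul1mx -[in RHS](@add_sub_fact_mod _ _ U _ 1%:M).
  rewrite mulmxDl (_ : val_submod _ *m P = 0) ?add0r //.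
  by have /submxP[w ->] := val_submodP (in_submod U 1%:M); rewrite -mulmxA UP mulmx0.
have VI : val_factmod 1%:M *m in_factmod U 1%:M = 1%:M.
  by rewrite -in_factmodE val_factmodK.
have gI : rG x *m in_factmod U 1%:M = in_factmod U 1%:M *m factmod_repr modU x.
  by rewrite -in_factmodE -[rG x in LHS]mul1mx in_factmodJ.
rewrite in_factmodE in PI.
move: gI VI VP PI; move: (factmod_repr modU x) (rG x) (in_factmod U 1%:M) (val_factmod 1%:M).
move=> f g I V gI VI VP PI.
by rewrite -[in RHS]VP (mulmxA g) gI -(mulmxA I) [RHS]mxtrace_mulC -!mulmxA PI VI mulmx1.
Qed.

Section Words.
Variable T : finType.
Local Notation N k := #|{: k.-tuple T}|.
Local Notation wv k s := (@word_vec T k s).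
Implicit Types (k l : nat) (s : seq T).

Definition row_op k n (f : k.-tuple T -> 'rV[algC]_n) : 'M_(N k, n) :=
  \matrix_i f (enum_val i).

Lemma word_vecP k (t u : k.-tuple T) : wv k t 0 (enum_rank u) = (u == t)%:R.
Proof. by rewrite mxE enum_rankK. Qed.

Lemma word_vec_delta k (t : k.-tuple T) : wv k t = delta_mx 0 (enum_rank t).
Proof.
apply/rowP=> j; rewrite !mxE eqxx /= (inj_eq val_inj).
by rewrite (can2_eq enum_valK enum_rankK).
Qed.

Lemma row_opE k n (f : k.-tuple T -> 'rV[algC]_n) (t : k.-tuple T) : wv k t *m row_op f = f t.
Proof. by rewrite word_vec_delta -rowE rowK enum_rankK. Qed.

Lemma word_mxP k n (A B : 'M[algC]_(N k, n)) :
  (forall t : k.-tuple T, wv k t *m A = wv k t *m B) -> A = B.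
Proof.
move=> AB; apply/row_matrixP=> i; have := AB (enum_val i).
by rewrite word_vec_delta enum_valK -!rowE.
Qed.

Lemma word_mxtrace k (A : 'M_(N k)) :
  \tr A = \sum_(t : k.-tuple T) (wv k t *m A) 0 (enum_rank t).
Proof.
rewrite /mxtrace (reindex _ (onW_bij _ (@enum_rank_bij _))) /=; apply: eq_bigr => t _.
by rewrite word_vec_delta -rowE mxE.
Qed.

(* Locked, to keep simplification from unfolding the words. *)
Fact word_key : unit. Proof. by []. Qed.
Definition permute k (s : 'S_k) (t : k.-tuple T) :=
  locked_with word_key [tuple tnth t (s l) | l < k].
Definition omit k (i : 'I_k.+1) (t : k.+1.-tuple T) :=
  locked_with word_key [tuple tnth t (lift i b) | b < k].

Lemma tnth_permute k (s : 'S_k) (t : k.-tuple T) i : tnth (permute s t) i = tnth t (s i).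
Proof. by rewrite /permute unlock tnth_mktuple. Qed.

Lemma tnth_omit k (i : 'I_k.+1) (t : k.+1.-tuple T) j : tnth (omit i t) j = tnth t (lift i j).
Proof. by rewrite /omit unlock tnth_mktuple. Qed.

Let word_tnth := (tnth_permute, tnth_omit).

Lemma omitE k (i : 'I_k.+1) (t : k.+1.-tuple T) :
  take i t ++ drop i.+1 t = omit i t :> seq T.
Proof.
have ik : (i <= k)%N by rewrite -ltnS.
have sz : (i <= size t)%N by rewrite size_tuple ltnW.
apply: (@eq_from_nth _ (tnth t i)).
  by rewrite size_tuple size_cat size_takel // size_drop size_tuple subSS subnKC // -ltnS.
move=> b; rewrite size_cat size_takel // size_drop size_tuple subSS subnKC // => bk.
have -> : nth (tnth t i) (omit i t) b = nth (tnth t i) t (bump i b).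
  by rewrite -(tnth_nth _ (omit i t) (Ordinal bk)) word_tnth (tnth_nth (tnth t i)).
rewrite nth_cat size_takel // /bump (leqNgt i b); case: (ltnP b i) => bi; first by rewrite nth_take.
by rewrite nth_drop addSn subnKC.
Qed.

Variable E : {set T}.

Definition on_ground s := all (mem E) s.

Lemma on_groundP k (t : k.-tuple T) : reflect (forall i, tnth t i \in E) (on_ground t).
Proof. exact: all_tnthP. Qed.

Lemma on_ground_permute k (s : 'S_k) (t : k.-tuple T) :
  on_ground (permute s t) = on_ground t.
Proof.
apply/on_groundP/on_groundP=> h i; last by rewrite word_tnth.
by have := h (s^-1%g i); rewrite word_tnth permKV.
Qed.

Lemma on_ground_omit k (i : 'I_k.+1) (t : k.+1.-tuple T) :
  on_ground t -> on_ground (omit i t).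
Proof. by move=> /on_groundP h; apply/on_groundP=> b; rewrite word_tnth. Qed.

(** Words with a letter outside [E] go to 0, so that one projection accounts for both the letter
    relations and the alternation relations of the Orlik-Solomon algebra. *)
Definition antisym k : 'M_(N k) := row_op (fun t : k.-tuple T =>
  if on_ground t then (k`!%:R)^-1 *: \sum_(s : 'S_k) (-1) ^+ s *: wv k (permute s t) else 0).

Definition boundary k : 'M_(N k.+1, N k) := row_op (fun t : k.+1.-tuple T =>
  if on_ground t then \sum_(i < k.+1) (-1) ^+ i *: wv k (omit i t) else 0).

(** Prefixing one fixed letter would contract the complex as well; the average over [E] commutes
    with every permutation that stabilizes [E]. *)
Definition cone k : 'M_(N k, N k.+1) := row_op (fun t : k.-tuple T =>
  if on_ground t then (#|E|%:R)^-1 *: \sum_(x in E) wv k.+1 [tuple of x :: t] else 0).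

(** For words on [E], this is k! times the matrix entry of [antisym]; signs of rearranged words
    become identities between determinants. *)
Definition delta_det k (u t : k.-tuple T) : algC :=
  \det (\matrix_(a, b) (tnth u a == tnth t b)%:R).

Lemma antisymE k (t u : k.-tuple T) :
  (wv k t *m antisym k) 0 (enum_rank u) = (on_ground t)%:R * (k`!%:R)^-1 * delta_det u t.
Proof.
rewrite row_opE; case: ifP => _; last by rewrite mxE !mul0r.
rewrite mul1r mxE summxE; congr (_ * _); apply: eq_bigr => s _.
rewrite mxE word_vecP; congr (_ * _).
have [->|/eqP ut] := eqVneq u (permute s t).
  by rewrite big1 // => a _; rewrite mxE word_tnth eqxx.
case: (pickP (fun a => tnth u a != tnth t (s a))) => [a /negPf ua | ua].
  by rewrite (bigD1 a) //= mxE ua mul0r.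
by case: ut; apply/eq_from_tnth => a; rewrite word_tnth; apply/eqP/negPn; rewrite ua.
Qed.

Lemma delta_det_permute k (u t : k.-tuple T) (s : 'S_k) :
  delta_det u (permute s t) = (-1) ^+ s * delta_det u t.
Proof.
rewrite /delta_det (_ : \matrix_(a, b) _ = col_perm s (\matrix_(a, b) (tnth u a == tnth t b)%:R)).
  by rewrite col_permE det_mulmx det_perm odd_permV mulrC.
by apply/matrixP=> a b; rewrite !mxE word_tnth.
Qed.

Lemma antisym_absorb k n (A : 'M_(N k, n)) :
    (forall (t : k.-tuple T) (s : 'S_k), on_ground t -> wv k (permute s t) *m A = (-1) ^+ s *: (wv k t *m A)) ->
    (forall t : k.-tuple T, ~~ on_ground t -> wv k t *m A = 0) ->
  antisym k *m A = A.
Proof.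
move=> hs h0; apply: word_mxP => t; rewrite mulmxA row_opE.
case: ifP => [Et|/negbT Et]; last by rewrite mul0mx h0.
rewrite -scalemxAl mulmx_suml.
under eq_bigr => s _ do rewrite -scalemxAl hs // scalerA -expr2 sqrr_sign scale1r.
rewrite sumr_const -scaler_nat scalerA card_Sn mulVf ?scale1r //.
by rewrite pnatr_eq0 -lt0n fact_gt0.
Qed.

Lemma antisym_antisym k : antisym k *m antisym k = antisym k.
Proof.
apply: antisym_absorb => [t s Et|t Et].
  apply/rowP=> j; rewrite -[j]enum_valK [RHS]mxE !antisymE on_ground_permute delta_det_permute.
  by rewrite mulrCA.
by rewrite row_opE (negPf Et).
Qed.

(* The determinant whose first row is constant and whose other rows are those
   of [delta_det]: Laplace expansion along the first row turns the boundary of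
   a word into this determinant. *)
Definition bmx k (u : k.-tuple T) (t : k.+1.-tuple T) : 'M[algC]_k.+1 :=
  \matrix_(a, b) (if unlift ord0 a is Some a' then (tnth u a' == tnth t b)%:R else 1).
Definition bdet k u t := \det (@bmx k u t).

Lemma bdetE k (u : k.-tuple T) t :
  bdet u t = \sum_(i < k.+1) (-1) ^+ i * delta_det u (omit i t).
Proof.
rewrite /bdet (expand_det_row _ ord0); apply: eq_bigr => i _.
rewrite mxE unlift_none mul1r /cofactor add0n; congr (_ * \det _).
by apply/matrixP=> a b; rewrite !mxE liftK word_tnth.
Qed.

Lemma bdet_permute k (u : k.-tuple T) t (s : 'S_k.+1) : bdet u (permute s t) = (-1) ^+ s * bdet u t.
Proof.
rewrite /bdet (_ : bmx u (permute s t) = col_perm s (bmx u t)).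
  by rewrite col_permE det_mulmx det_perm odd_permV mulrC.
by apply/matrixP=> a b; rewrite !mxE word_tnth.
Qed.

(** The sum is the Laplace expansion of a determinant with two constant rows. This is what makes
    consecutive boundaries compose to 0. *)
Lemma bdet_omit k (u : k.-tuple T) t : \sum_(i < k.+2) (-1) ^+ i * bdet u (omit i t) = 0.
Proof.
pose A : 'M[algC]_k.+2 := \matrix_(a, b)
  (if unlift ord0 a is Some a' then
     if unlift ord0 a' is Some a'' then (tnth u a'' == tnth t b)%:R else 1 else 1).
have A0 : \det A = 0.
  apply: (@determinant_alternate _ _ _ ord0 (lift ord0 ord0)) => // b.
  by rewrite !mxE unlift_none liftK unlift_none.
rewrite -[RHS]A0 (expand_det_row A ord0); apply: eq_bigr => i _.
rewrite mxE unlift_none mul1r /cofactor add0n; congr (_ * \det _).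
by apply/matrixP=> a b; rewrite !mxE liftK word_tnth.
Qed.

Lemma boundary_antisymE k (t : k.+1.-tuple T) (u : k.-tuple T) :
  (wv k.+1 t *m (boundary k *m antisym k)) 0 (enum_rank u)
    = (on_ground t)%:R * (k`!%:R)^-1 * bdet u t.
Proof.
rewrite mulmxA row_opE; case: ifP => Et; last by rewrite mul0mx mxE !mul0r.
rewrite mul1r mulmx_suml summxE bdetE big_distrr; apply: eq_bigr => i _.
by rewrite -scalemxAl mxE antisymE on_ground_omit // mul1r mulrCA.
Qed.

Lemma boundary_antisym k :
  antisym k.+1 *m (boundary k *m antisym k) = boundary k *m antisym k.
Proof.
apply: antisym_absorb => [t s Et|t Et].
  apply/rowP=> j; rewrite -[j]enum_valK [RHS]mxE !boundary_antisymE on_ground_permute.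
  by rewrite bdet_permute mulrCA.
by rewrite mulmxA row_opE (negPf Et) mul0mx.
Qed.

Lemma boundary_boundary k : boundary k.+1 *m (boundary k *m antisym k) = 0.
Proof.
apply: word_mxP => t; rewrite mulmx0 mulmxA row_opE.
case: ifP => Et; last by rewrite mul0mx.
apply/rowP=> j; rewrite -[j]enum_valK mulmx_suml summxE [RHS]mxE.
under eq_bigr => i _ do rewrite -scalemxAl mxE boundary_antisymE on_ground_omit // mul1r mulrCA.
by rewrite -mulr_sumr bdet_omit mulr0.
Qed.

Lemma cons_permute k (x : T) (s : 'S_k) (t : k.-tuple T) :
  [tuple of x :: permute s t] = permute (lift_perm ord0 ord0 s) [tuple of x :: t].
Proof.
apply/eq_from_tnth => i; rewrite word_tnth.
case: (unliftP ord0 i) => [j|] ->; last by rewrite lift_perm_id !tnth0.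
by rewrite lift_perm_lift !tnthS word_tnth.
Qed.

Lemma cone_antisym k : antisym k *m (cone k *m antisym k.+1) = cone k *m antisym k.+1.
Proof.
apply: antisym_absorb => [t s Et|t Et]; last by rewrite mulmxA row_opE (negPf Et) mul0mx.
rewrite !mulmxA !row_opE on_ground_permute Et -!scalemxAl scalerA mulrC -scalerA.
congr (_ *: _); rewrite !mulmx_suml scaler_sumr; apply: eq_bigr => x Ex.
apply/rowP=> j; rewrite -[j]enum_valK [RHS]mxE !antisymE cons_permute on_ground_permute.
by rewrite delta_det_permute odd_lift_perm mulrCA.
Qed.

Lemma omit_cons0 k (x : T) (t : k.-tuple T) : omit ord0 [tuple of x :: t] = t.
Proof. by apply/eq_from_tnth => i; rewrite word_tnth tnthS. Qed.

Lemma omit_consS k (x : T) (t : k.+1.-tuple T) i :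
  omit (lift ord0 i) [tuple of x :: t] = [tuple of x :: omit i t].
Proof. by apply/val_inj; rewrite /= -!omitE. Qed.

Hypothesis E_gt0 : (0 < #|E|)%N.

(** Matrices act on row vectors, so the first product is [cone] followed by [boundary]. Omitting the
    prefixed letter gives the word back, and every other term cancels between the two composites. *)
Lemma homotopy k : cone k.+1 *m boundary k.+1 + boundary k *m cone k =
  row_op (fun t : k.+1.-tuple T => if on_ground t then wv k.+1 t else 0).
Proof.
apply: word_mxP => t; rewrite mulmxDr !mulmxA !row_opE.
case: ifP => Et; last by rewrite !mul0mx addr0.
have nE : #|E|%:R != 0 :> algC by rewrite pnatr_eq0 -lt0n.
have -> : wv k.+1 t = (#|E|%:R)^-1 *: \sum_(x in E) wv k.+1 t.
  by rewrite sumr_const -scaler_nat scalerA mulVf // scale1r.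
have -> : (\sum_(i < k.+1) (-1) ^+ i *: wv k (omit i t)) *m cone k =
    (#|E|%:R)^-1 *: \sum_(x in E) \sum_(i < k.+1) (-1) ^+ i *: wv k.+1 [tuple of x :: omit i t].
  rewrite mulmx_suml exchange_big scaler_sumr; apply: eq_bigr => i _.
  by rewrite -scalemxAl row_opE on_ground_omit // scalerA mulrC -scalerA -scaler_sumr.
rewrite -scalemxAl -scalerDr mulmx_suml -big_split /=; congr (_ *: _); apply: eq_bigr => x Ex.
rewrite row_opE (_ : on_ground _ = true); last by rewrite /on_ground /= Ex.
rewrite big_ord_recl omit_cons0 expr0 scale1r -addrA -[RHS]addr0; congr (_ + _).
rewrite -big_split big1 // => i _ /=.
by rewrite omit_consS /bump /= exprS mulN1r scaleNr addNr.
Qed.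

Definition word_act k (g : {perm T}) : 'M_(N k) :=
  row_op (fun t : k.-tuple T => wv k (map_tuple g t)).

Section Trace.
Variable g : {perm T}.
Hypothesis gE : stable g E.

Lemma on_ground_map k (t : k.-tuple T) : on_ground (map_tuple g t) = on_ground t.
Proof. by rewrite /on_ground all_map; apply: eq_all => x /=; rewrite (stableP _ _ gE). Qed.

Lemma map_permute k (t : k.-tuple T) (s : 'S_k) :
  map_tuple g (permute s t) = permute s (map_tuple g t).
Proof. by apply/eq_from_tnth => i; rewrite !(tnth_map, word_tnth). Qed.

Lemma word_act_antisym k : word_act k g *m antisym k = antisym k *m word_act k g.
Proof.
apply: word_mxP => t; rewrite !mulmxA !row_opE on_ground_map.
case: ifP => Et; last by rewrite mul0mx.
rewrite -scalemxAl mulmx_suml; congr (_ *: _); apply: eq_bigr => s _.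
by rewrite -scalemxAl row_opE map_permute.
Qed.

Lemma word_act_cone k : word_act k g *m cone k = cone k *m word_act k.+1 g.
Proof.
apply: word_mxP => t; rewrite !mulmxA !row_opE on_ground_map.
case: ifP => Et; last by rewrite mul0mx.
rewrite -scalemxAl mulmx_suml; congr (_ *: _).
rewrite (reindex_inj (@perm_inj _ g)) /=; apply: eq_big => x; first by rewrite (stableP _ _ gE).
by rewrite row_opE => _; congr (wv _ _).
Qed.

(* The trace of g on the exterior power of degree k + 1 modulo boundaries: with
   P = antisym, the matrix P * boundary * cone * P is a projection along them. *)
Definition boundary_trace k : algC :=
  \tr (word_act k.+1 g *m (antisym k.+1 *m (boundary k *m (cone k *m antisym k.+1)))).

Lemma boundary_trace_antisym k :
  boundary_trace k = \tr (word_act k.+1 g *m (antisym k.+1 *m (boundary k *m cone k))).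
Proof.
rewrite /boundary_trace; move: (word_act_antisym k.+1) (antisym_antisym k.+1).
move: (word_act _ _) (antisym _) (boundary k) (cone k) => G P B C GP PP.
by rewrite !mulmxA mxtrace_mulC !mulmxA -GP -(mulmxA G P P) PP.
Qed.

(** Cyclicity of the trace moves the computation one degree down, turning boundary-then-cone into
    cone-then-boundary. These are the two complementary terms of [homotopy], whence the recursion in
    [boundary_traceS]. *)
Lemma boundary_trace_cycle k :
  boundary_trace k = \tr (word_act k g *m (antisym k *m (cone k *m boundary k))).
Proof.
rewrite /boundary_trace.
move: (word_act_antisym k.+1) (antisym_antisym k.+1) (word_act_antisym k) (antisym_antisym k).
move: (boundary_antisym k) (cone_antisym k) (word_act_cone k).
move: (word_act _ _) (word_act _ _) (antisym k.+1) (antisym k) (boundary k) (cone k).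
move=> G G' P' P B C hB hC GC GP' PP' GP PP.
have trP Y : \tr (G' *m (P *m Y)) = \tr (G' *m (P *m (Y *m P))).
  by rewrite !mulmxA [RHS]mxtrace_mulC !mulmxA -GP -(mulmxA G' P P) PP.
transitivity (\tr (G' *m (P *m (C *m P' *m B)))).
  rewrite (mulmxA G) mxtrace_mulC -!mulmxA (mulmxA P' G) -GP' -(mulmxA G P') PP'.
  by rewrite (mulmxA C G) -GC -(mulmxA G' C) -hC mxtrace_mulC !mulmxA.
by rewrite trP -!mulmxA hB [RHS]trP -!mulmxA.
Qed.

Definition antisym_trace k : algC := \tr (word_act k g *m antisym k).

Lemma antisym_on_ground k : antisym k *m
  row_op (fun t : k.-tuple T => if on_ground t then wv k t else 0) = antisym k.
Proof.
apply: word_mxP => t; rewrite mulmxA row_opE; case: ifP => Et; last by rewrite mul0mx.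
rewrite -scalemxAl mulmx_suml; congr (_ *: _); apply: eq_bigr => s _.
by rewrite -scalemxAl row_opE on_ground_permute Et.
Qed.

Lemma boundary_trace0 : boundary_trace 0 = antisym_trace 0.
Proof.
rewrite boundary_trace_cycle /antisym_trace (_ : cone 0 *m boundary 0 = 1%:M) ?mulmx1 //.
apply: word_mxP => t; rewrite mulmx1 mulmxA row_opE [t]tuple0 /=.
have nE : #|E|%:R != 0 :> algC by rewrite pnatr_eq0 -lt0n.
have -> : wv 0 [::] = (#|E|%:R)^-1 *: \sum_(x in E) wv 0 [::].
  by rewrite sumr_const -scaler_nat scalerA mulVf // scale1r.
rewrite -scalemxAl mulmx_suml; congr (_ *: _); apply: eq_bigr => x Ex.
by rewrite row_opE /on_ground /= Ex big_ord1 expr0 scale1r omit_cons0.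
Qed.

Lemma boundary_traceS k : boundary_trace k.+1 = antisym_trace k.+1 - boundary_trace k.
Proof.
rewrite boundary_trace_cycle boundary_trace_antisym /antisym_trace.
apply: (canRL (addrK _)); rewrite -mxtraceD -!mulmxDr homotopy.
by rewrite antisym_on_ground.
Qed.

Lemma boundary_traceE k :
  boundary_trace k = \sum_(i < k.+1) (-1) ^+ (k - i) * antisym_trace i.
Proof.
elim: k => [|k IHk]; first by rewrite big_ord1 expr0 mul1r boundary_trace0.
rewrite boundary_traceS big_ord_recr /= subnn expr0 mul1r addrC; congr (_ + _).
rewrite IHk -sumrN; apply: eq_bigr => i _.
by rewrite subSn -1?ltnS // exprS mulN1r mulNr.
Qed.

End Trace.
End Words.

(** * Traces on exterior powers *)

Section ExteriorTrace.
Variables (T : finType) (E : {set T}).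

Lemma delta_det_nuniq k (t u : k.-tuple T) : ~~ uniq u -> delta_det t u = 0.
Proof.
move=> nu; rewrite /delta_det -det_tr.
have /injectivePn[i [j ij uij]] : ~~ injectiveb (tnth u).
  by apply: contra nu => /injectiveP/tuple_uniqP.
apply: (@determinant_alternate _ _ _ i j) => // a.
by rewrite !mxE uij.
Qed.

Lemma antisym_eq0 k : (#|E| < k)%N -> antisym E k = 0.
Proof.
move=> ltEk; apply: word_mxP => t; rewrite mulmx0.
apply/rowP=> j; rewrite -[j]enum_valK antisymE [RHS]mxE.
have [Et|_] := boolP (on_ground E t); last by rewrite !mul0r.
rewrite delta_det_nuniq ?mulr0 //; apply: contraL ltEk => /card_uniqP ct.
rewrite -leqNgt -[k](size_tuple t) -ct subset_leq_card //.
by apply/subsetP=> x /(allP Et).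
Qed.

Lemma card_orderings k (A : {set T}) : #|A| = k ->
  #|[pred t : k.-tuple T | uniq t && ([set x in t] == A)]| = k`!.
Proof.
move=> cA; rewrite -ffactnn -[in RHS]cA -card_uniq_tuples -cardsE cA.
apply: eq_card => t; rewrite !inE andbC; case ut: (uniq t); rewrite ?andbF //= !andbT.
rewrite eqEcard cA cardsE (card_uniqP ut) size_tuple leqnn andbT.
by apply/subsetP/allP=> h x; have := h x; rewrite inE.
Qed.

(** If the letter set is stable, the matrix is that of the induced permutation of positions;
    otherwise some letter leaves the word and its column vanishes. *)
Lemma delta_det_map (g : {perm T}) k (t : k.-tuple T) : uniq t ->
  delta_det t (map_tuple g t) =
    if stable g [set x in t] then sgn_on [set x in t] g else 0.
Proof.
move=> ut; have inj_t : injective (tnth t) by apply/tuple_uniqP.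
case: ifP => [st|/negP st].
  have h b : exists a, tnth t a == g (tnth t b).
    have : g (tnth t b) \in [set x in t] by rewrite (stableP _ _ st) inE mem_tnth.
    by rewrite inE => /tnthP[a ga]; exists a; rewrite ga.
  pose s b := xchoose (h b).
  have sE b : tnth t (s b) = g (tnth t b) by apply/eqP/(xchooseP (h b)).
  have inj_s : injective s.
    by move=> a b sab; apply/inj_t/(@perm_inj _ g); rewrite -!sE sab.
  have -> : [set x in t] = [set tnth t i | i in 'I_k].
    by apply/setP=> x; rewrite inE; apply/tnthP/imsetP=> [[i ->]|[i _ ->]]; exists i.
  rewrite (@sgn_on_codom _ _ _ (perm inj_s)) => [||i]; rewrite ?permE //.
  rewrite /delta_det -det_perm -det_tr; congr (\det _); apply/matrixP=> a b.
  by rewrite !mxE tnth_map -sE (inj_eq inj_t) permE eq_sym.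
have [b tb] : exists b, g (tnth t b) \notin t.
  apply/existsP; apply: contra_notT st; rewrite negb_exists => /forallP h.
  have sub : g @: [set x in t] \subset [set x in t].
    apply/subsetP=> _ /imsetP[x tx ->]; move: tx; rewrite !inE => /tnthP[i ->].
    by have := h i; rewrite negbK.
  have /eqP gt : g @: [set x in t] == [set x in t].
    by rewrite eqEcard sub card_imset ?leqnn //; apply: perm_inj.
  by apply/stableP=> x; rewrite -[in LHS]gt mem_imset //; apply: perm_inj.
rewrite /delta_det (expand_det_col _ b) big1 // => a _; rewrite mxE tnth_map.
by case: eqP => [def_g|]; rewrite ?mul0r // -def_g mem_tnth in tb *.
Qed.

(** Group the words by their letter sets: each k-subset of [E] has k! orderings, which cancels the
    normalization of [antisym], while words with a repeated letter have zero diagonal entry. *)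
Lemma antisym_traceE g k : stable g E -> antisym_trace E g k = lam E k g.
Proof.
move=> gE; rewrite /antisym_trace word_mxtrace.
under eq_bigr => t _ do rewrite mulmxA row_opE antisymE on_ground_map //.
rewrite (bigID (fun t : k.-tuple T => on_ground E t && uniq t)) /= addrC big1 ?add0r.
  rewrite (partition_big (fun t : k.-tuple T => [set x in t])
    (fun A : {set T} => (A \subset E) && (#|A| == k))) /=.
    rewrite /lam [RHS]big_mkcond [LHS]big_mkcond; apply: eq_bigr => A _.
    rewrite andbA; have [/andP[sAE /eqP cA]|//] := ifP; last first.
    under eq_bigr => t /andP[/andP[Et ut] /eqP tA].
      rewrite Et mul1r delta_det_map // tA; over.
    rewrite sumr_const (eq_card (B := [pred t : k.-tuple T | uniq t && ([set x in t] == A)])).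
      rewrite card_orderings // -mulrnAl -mulr_natr mulVf ?mul1r //.
      by rewrite pnatr_eq0 -lt0n fact_gt0.
    move=> t; rewrite !inE unfold_in /=; case: eqP => [tA|]; rewrite ?andbF ?andbT //.
    rewrite (_ : on_ground E t = true) //; apply/allP=> x tx.
    by apply: (subsetP sAE); rewrite -tA inE.
  move=> t /andP[Et ut]; apply/andP; split.
    by apply/subsetP=> x; rewrite inE => /(allP Et).
  by rewrite cardsE (card_uniqP ut) size_tuple.
move=> t; rewrite negb_and => /orP[/negPf->|nu]; first by rewrite !mul0r.
by rewrite delta_det_nuniq ?mulr0 // map_inj_uniq //; apply: perm_inj.
Qed.

(* The Euler characteristic of the Koszul complex of E, which is contractible. *)
Lemma alternating_lam g : stable g E -> (0 < #|E|)%N ->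
  \sum_(i < #|E|.+1) (-1) ^+ (#|E| - i) * lam E i g = 0.
Proof.
move=> gE E0; under eq_bigr do rewrite -antisym_traceE //.
(* The alternating sum is a trace in degree [#|E|.+1], where [antisym] is zero for lack of distinct
   letters. *)
by rewrite -boundary_traceE // /boundary_trace antisym_eq0 // mul0mx mulmx0 mxtrace0.
Qed.

Lemma lam_top g : stable g E -> (0 < #|E|)%N ->
  lam E #|E| g = \sum_(i < #|E|) (-1) ^+ (#|E| - i).-1 * lam E i g.
Proof.
move=> gE E0; have := alternating_lam gE E0.
rewrite big_ord_recr /= subnn expr0 mul1r addrC => /eqP; rewrite addr_eq0 => /eqP ->.
rewrite -sumrN; apply: eq_bigr => i _; have : (0 < #|E| - i)%N by rewrite subn_gt0.
by case: (#|E| - i)%N => // n _; rewrite exprS mulN1r mulNr opprK.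
Qed.

End ExteriorTrace.

(** * Orlik-Solomon algebras of uniform matroids *)

Section OrlikSolomon.
Variables (gT : finGroupType) (T : finType) (to : {action gT &-> T}).
Variables (W : {group gT}) (M : eqmatroid to W).
Local Notation E := (ground M).
Local Notation wv k s := (@word_vec T k s).

Lemma stable_ground w : w \in W -> stable (actperm to w) E.
Proof. by move=> Ww; apply/stableP=> x; rewrite actpermE mem_ground_act. Qed.

Lemma word_mx_act k w : word_mx to k w = word_act k (actperm to w).
Proof.
apply/row_matrixP=> i; rewrite !rowK /=; congr (wv k _).
by apply: eq_map => x; rewrite actpermE.
Qed.

Lemma alternation_perm k (s : 'S_k) (t : k.-tuple T) :
  (wv k t - (-1) ^+ s *: wv k (permute s t) <= OS_alternation T k)%MS.
Proof.
case: (prod_tpermP s) t => l -> /allP dl.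
elim: l dl => [|[x y] l IHl] dl t.
  rewrite big_nil odd_perm1 expr0 scale1r (_ : permute 1 t = t) ?subrr ?sub0mx //.
  by apply/eq_from_tnth => i; rewrite tnth_permute perm1.
rewrite big_cons; set r := \big[_/_]_(_ <- l) _.
have /= xy : dpair (x, y) by apply: dl; rewrite inE eqxx.
have dl' : {in l, forall p, dpair p} by move=> p lp; apply: dl; rewrite inE lp orbT.
have -> : wv k t - (-1) ^+ (tperm x y * r)%g *: wv k (permute (tperm x y * r) t) =
   (wv k t - (-1) ^+ r *: wv k (permute r t)) +
   (-1) ^+ r *: (wv k (permute r t) + wv k (permute (tperm x y * r) t)).
  rewrite odd_mul_tperm xy signr_addb expr1 mulN1r scaleNr opprK scalerDr.
  by rewrite addrA subrK.
apply: addmx_sub; first exact: IHl.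
apply: scalemx_sub; rewrite /OS_alternation.
apply: (sumsmx_sup (permute r t)) => //; apply: (sumsmx_sup x) => //.
apply: (sumsmx_sup y) => //; rewrite genmxE.
set t1 := permute (_ * _) _; set t2 := [tuple _ | _ < k]; suff -> : t1 = t2 by [].
by apply/eq_from_tnth => i; rewrite !(tnth_permute, tnth_mktuple) permM.
Qed.

Lemma antisym_complement k :
  (1%:M - antisym E k <= OS_letters M k + OS_alternation T k)%MS.
Proof.
apply/row_subP=> i; rewrite rowE -[i]enum_valK -word_vec_delta mulmxBr mulmx1 row_opE.
set t := enum_val i; case: ifP => Et; last first.
  rewrite subr0; apply: submx_trans (addsmxSl _ _); apply: (sumsmx_sup t); rewrite ?genmxE //.
  by rewrite -/(on_ground E t) Et.
apply: submx_trans (addsmxSr _ _).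
have -> : wv k t = (k`!%:R)^-1 *: \sum_(s : 'S_k) wv k t.
  rewrite sumr_const -scaler_nat scalerA card_Sn mulVf ?scale1r //.
  by rewrite pnatr_eq0 -lt0n fact_gt0.
rewrite -scalerBr -sumrB; apply/scalemx_sub/summx_sub => s _.
exact: alternation_perm.
Qed.

Lemma sub_eq0 m n p (A : 'M[algC]_(m, n)) (U : 'M[algC]_(p, n)) q (P : 'M[algC]_(n, q)) :
  (A <= U)%MS -> U *m P = 0 -> A *m P = 0.
Proof. by case/submxP=> D -> UP; rewrite -mulmxA UP mulmx0. Qed.

Lemma sums_mul0 (I : finType) (p : pred I) n (A : I -> 'M[algC]_n) (P : 'M[algC]_n) :
  (forall i, p i -> A i *m P = 0) -> (\sum_(i | p i) A i)%MS *m P = 0.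
Proof.
move=> AP; apply/eqP; rewrite -submx0 sumsmxMr; apply/sumsmx_subP=> i pi.
by rewrite AP // submx0.
Qed.

Lemma adds_mul0 n (A B P : 'M[algC]_n) :
  A *m P = 0 -> B *m P = 0 -> (A + B)%MS *m P = 0.
Proof.
by move=> AP BP; apply/eqP; rewrite -submx0 addsmxMr AP BP addsmx_sub submx_refl.
Qed.

Lemma gen_mul0 n m (v : 'rV[algC]_n) (P : 'M[algC]_(n, m)) :
  v *m P = 0 -> <<v>>%MS *m P = 0.
Proof. by move=> vP; apply: (sub_eq0 _ vP); rewrite genmxE. Qed.

Lemma antisym_kills k : (OS_letters M k + OS_alternation T k)%MS *m antisym E k = 0.
Proof.
apply: adds_mul0.
  apply: sums_mul0 => t Et; apply: gen_mul0; rewrite row_opE ifN //.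
apply: sums_mul0 => t _; apply: sums_mul0 => i _; apply: sums_mul0 => j ij.
apply: gen_mul0; rewrite (_ : [tuple _ | l < k] = permute (tperm i j) t); last first.
  by apply/eq_from_tnth => l; rewrite tnth_permute tnth_mktuple.
apply/rowP=> u; rewrite -[u]enum_valK mulmxDl mxE !antisymE on_ground_permute.
by rewrite delta_det_permute odd_tperm ij expr1 mulN1r mulrN subrr mxE.
Qed.

Lemma dependent_word_setP (s : seq T) :
  dependent_word M s -> exists2 A : {set T}, A \subset E & A \notin indep M /\ #|A| = size s.
Proof.
case/and3P=> us Es ds; exists [set x in s]; last by rewrite cardsE (card_uniqP us).
by apply/subsetP=> x; rewrite inE => /(allP Es).
Qed.

(** A boundary relation in degree [k] comes from a dependent word of at most [k.+1] letters. Without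
    such words only the exterior relations remain, and [antisym] projects along them. *)
Lemma OS_free k w : w \in W ->
    (forall A : {set T}, A \subset E -> (#|A| <= k.+1)%N -> A \in indep M) ->
  OS M k w = lam E k (actperm to w).
Proof.
move=> Ww free; rewrite cfunE Ww mulr1n.
have B0 : OS_boundary M k = 0.
  apply/eqP; rewrite -submx0; apply/sumsmx_subP=> t _; apply/sumsmx_subP=> l.
  case/dependent_word_setP=> A sAE [/negP iA cA]; case: iA; apply: free => //.
  by rewrite cA size_take size_tuple; case: ltnP => // /ltnW.
rewrite (@mxtrace_factmod _ _ _ _ _ _ (antisym E k)) //.
- by rewrite /= word_mx_act -antisym_traceE ?stable_ground.
- by apply: adds_mul0; rewrite ?antisym_kills // B0 mul0mx.
exact: submx_trans (antisym_complement k) (addsmxSl _ _).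
Qed.

(** In the top degree the boundary relations form the full image of the next exterior power. By the
    homotopy, boundary followed by cone, taken between antisymmetrizers, is a projection along this
    image. *)
Lemma OS_top k w : w \in W -> (0 < #|E|)%N ->
    (forall A : {set T}, A \subset E -> (A \in indep M) = (#|A| <= k.+1)%N) ->
  OS M k.+1 w = boundary_trace E (actperm to w) k.
Proof.
move=> Ww E0 unif; rewrite cfunE Ww mulr1n.
rewrite (@mxtrace_factmod _ _ _ _ _ _ (antisym E k.+1 *m (boundary E k *m (cone E k *m antisym E k.+1)))) //.
- by rewrite /= word_mx_act.
- apply: adds_mul0; first by rewrite mulmxA antisym_kills mul0mx.
  apply: sums_mul0 => t _; apply: sums_mul0 => l dep; apply: gen_mul0.
  have [A sAE [iA cA]] := dependent_word_setP dep.
  (* Sets of at most [k.+1] elements are independent, so a dependent word fills all [k.+2]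
     positions. *)
  have l_max : l = ord_max.
    move: iA; rewrite unif // cA size_take size_tuple -ltnNge.
    case: (ltnP l k.+2) => [lk kl|lk _]; first by rewrite ltnS leqNgt kl in lk.
    by apply/val_inj/eqP; rewrite eqn_leq lk -ltnS ltn_ord.
  move: dep; rewrite l_max /= take_oversize ?size_tuple // => /and3P[_ Et _].
  under eq_bigr => i _ do rewrite omitE.
  have -> : \sum_(i < k.+2) (-1) ^+ i *: wv k.+1 (omit i t) = wv k.+2 t *m boundary E k.+1.
    by rewrite row_opE (_ : on_ground E t = true).
  rewrite -cone_antisym (mulmxA (boundary E k)) (mulmxA (antisym E k.+1)) boundary_antisym.
  by rewrite -mulmxA (mulmxA (boundary E k.+1)) boundary_boundary mul0mx mulmx0.
have PU : (1%:M - antisym E k.+1 <= OS_relations M k.+1)%MS.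
  exact: submx_trans (antisym_complement _) (addsmxSl _ _).
have BU : (boundary E k.+1 <= OS_relations M k.+1)%MS.
  apply/row_subP=> i; rewrite rowE -[i]enum_valK -word_vec_delta; set t := enum_val i.
  have [Et|nEt] := boolP (on_ground E t); last by rewrite row_opE (negPf nEt) sub0mx.
  have [ut|nut] := boolP (uniq t).
    apply: submx_trans (addsmxSr _ _); apply: (sumsmx_sup t) => //.
    have t_dep : dependent_word M (take (@ord_max k.+2) t).
      rewrite /= take_oversize ?size_tuple // /dependent_word ut [all _ _]Et /= unif.
        by rewrite cardsE (card_uniqP ut) size_tuple ltnn.
      by apply/subsetP=> x; rewrite inE => /(allP Et).
    apply: (sumsmx_sup ord_max) => //; rewrite genmxE row_opE Et /=.
    by under [in X in (_ <= X)%MS]eq_bigr => j _ do rewrite omitE.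
  (* A word with a repeated letter is killed by antisymmetrization, so its boundary lies in the
     range of [1 - antisym], which consists of relations. *)
  have -> : wv k.+2 t *m boundary E k.+1 =
      wv k.+2 t *m boundary E k.+1 *m (1%:M - antisym E k.+1).
    rewrite mulmxBr mulmx1 -mulmxA -boundary_antisym (mulmxA _ (antisym E k.+2)).
    suff -> : wv k.+2 t *m antisym E k.+2 = 0 by rewrite mul0mx subr0.
    apply/rowP=> j; rewrite -[j]enum_valK antisymE delta_det_nuniq // mulr0.
    by rewrite [RHS]mxE.
  exact: mulmx_sub PU.
have PE : antisym E k.+1 =
    antisym E k.+1 *m (cone E k.+1 *m boundary E k.+1 + boundary E k *m cone E k).
  by rewrite homotopy ?antisym_on_ground.
move: PU PE; set P := antisym _ _; set B := boundary _ k; set C := cone _ k => PU PE.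
(* Splitting [P] by the homotopy leaves three terms whose last factors are [1 - P], a boundary and
   [1 - P]; the rows of each lie in the relations. *)
have -> : 1%:M - P *m (B *m (C *m P)) =
    (1%:M - P) + P *m cone E k.+1 *m boundary E k.+1 + P *m (B *m C) *m (1%:M - P).
  rewrite (mulmxBr _ 1%:M) mulmx1 -!mulmxA -addrA (addrA (P *m _)) -mulmxDr -PE.
  by rewrite addrA subrK.
apply: addmx_sub; last exact: (mulmx_sub _ PU).
by apply: addmx_sub; last exact: (mulmx_sub _ BU).
Qed.

Lemma OS_top_lam k w : w \in W -> (0 < #|E|)%N ->
    (forall A : {set T}, A \subset E -> (A \in indep M) = (#|A| <= k.+1)%N) ->
  OS M k.+1 w = \sum_(i < k.+1) (-1) ^+ (k - i) * lam E i (actperm to w).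
Proof.
move=> Ww E0 unif; rewrite OS_top // boundary_traceE ?stable_ground //.
by apply: eq_bigr => i _; rewrite antisym_traceE ?stable_ground.
Qed.

End OrlikSolomon.

(** * The recursion *)

(* The Frobenius characteristic of [lam2 E a b] is e_a e_b h_c with
   a + b + c = #|E| = m + d, and those of the two sums are
   e_j s_(m+1,1^(d-j-1)) and e_(d-j) s_(m+1,1^(j-1)). *)
Definition theta (T : finType) (E : {set T}) d j (s : {perm T}) : algC :=
  \sum_(k < d - j) (-1) ^+ (d - j - k).-1 * lam2 E j k s
  - \sum_(i < j) (-1) ^+ (j - i).-1 * lam2 E (d - j)%N i s.

Section Theta.
Variables (T : finType) (E : {set T}) (s : {perm T}).
Hypothesis sE : stable s E.

Lemma lam2_top a : (a < #|E|)%N ->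
  \sum_(k < #|E| - a) (-1) ^+ (#|E| - a - k).-1 * lam2 E a k s = lam2 E a (#|E| - a)%N s.
Proof.
move=> aE; under eq_bigr do rewrite /lam2 mulr_sumr.
rewrite exchange_big; apply: eq_bigr => A /and3P[sAE /eqP cA sA] /=.
have cEA : #|E :\: A| = (#|E| - a)%N by rewrite cardsD (setIidPr sAE) cA.
rewrite -cEA lam_top ?stableD // ?cEA ?subn_gt0 // mulr_sumr.
by apply: eq_bigr => k _; rewrite mulrCA.
Qed.

Lemma lam2_0l b : lam2 E 0 b s = lam E b s.
Proof.
rewrite /lam2 (big_pred1 set0) ?sgn_on0 ?mul1r ?setD0 // => A.
by rewrite cards_eq0 /=; case: eqP => [->|]; rewrite ?sub0set ?stable0 ?andbF.
Qed.

(** When d is the size of [E], both alternating sums collapse by [lam_top] to products of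
    complementary exterior powers, which cancel by symmetry. For j = 0 the second sum is empty and
    the sign of [E] is left. *)
Lemma theta_boolean j : (j.*2 < #|E|)%N ->
  theta E #|E| j s = (j == 0%N)%:R * sgn_on E s.
Proof.
move=> jE; have jE1 : (j < #|E|)%N by apply: leq_ltn_trans jE; rewrite -addnn leq_addr.
rewrite /theta lam2_top //; case: j => [|j] in jE jE1 *.
  by rewrite big_ord0 subr0 subn0 lam2_0l lam_card // mul1r.
have := @lam2_top (#|E| - j.+1)%N; rewrite subKn ?(ltnW jE1) // => -> //.
  by rewrite lam2_sym // subrr mul0r.
by rewrite ltn_subrL (leq_ltn_trans _ jE).
Qed.

Lemma sign_complement d j k : (j + k < d)%N ->
  - (-1) ^+ d * (-1) ^+ (k + j) = (-1) ^+ (d - j - k).-1 :> algC.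
Proof.
move=> jkd; have {1}-> : d = ((d - j - k).-1.+1 + (k + j))%N by lia.
by rewrite exprD exprS mulN1r !mulNr opprK -mulrA -expr2 sqrr_sign mulr1.
Qed.

(** This is theta in the shape produced by the recursion: [F] runs over the proper stable flats,
    [sgn_on F] comes from the boolean localization, and the last factor is degree j of the
    Orlik-Solomon algebra of the contraction, of rank [d - #|F|]. Sizes below d - j give the first
    sum of theta, size d - j gives the second. *)
Lemma theta_sum d j : (j.*2 < d)%N ->
  theta E d j s = - (-1) ^+ d *
    \sum_(F : {set T} | [&& F \subset E, (#|F| < d)%N & stable s F])
      (-1) ^+ (#|F| + j) * sgn_on F s *
        (if (j + #|F| < d)%N then lam (E :\: F) j s
         else if (j + #|F| == d)%N then
           \sum_(i < j) (-1) ^+ (j - i).-1 * lam (E :\: F) i s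
         else 0).
Proof.
move=> jd; have jd1 : (j < d)%N by apply: leq_ltn_trans jd; rewrite -addnn leq_addr.
have jd2 : (j < d - j)%N by rewrite ltn_subRL addnn.
pose X k := \sum_(F : {set T} | [&& F \subset E, #|F| == k & stable s F]) sgn_on F s *
        (if (j + k < d)%N then lam (E :\: F) j s
         else if (j + k == d)%N then
           \sum_(i < j) (-1) ^+ (j - i).-1 * lam (E :\: F) i s
         else 0).
transitivity (- (-1) ^+ d * \sum_(k < d) (-1) ^+ (k + j) * X k); last first.
  congr (_ * _); pose cd (F : {set T}) := insubd (Ordinal (leq_ltn_trans (leq0n j) jd1)) #|F|.
  have cdE (F : {set T}) k : (#|F| < d)%N -> (cd F == k) = (#|F| == k).
    by move=> Fd; rewrite -val_eqE /= val_insubd Fd.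
  rewrite [RHS](partition_big cd predT) //=.
  apply: eq_bigr => k _; rewrite mulr_sumr; apply: eq_big => F.
    case: (ltnP #|F| d) => Fd; rewrite ?andbF //=.
      by rewrite cdE //; case: (F \subset E); case: (stable s F); rewrite /= ?andbT ?andbF.
    by apply/and3P=> -[_ /eqP Fk _]; rewrite Fk leqNgt ltn_ord in Fd.
  by case/and3P=> _ /eqP-> _; rewrite mulrA.
have jdk : (d - j <= d)%N by rewrite leq_subr.
rewrite -(big_mkord xpredT (fun k => (-1) ^+ (k + j) * X k)) (@big_cat_nat _ _ _ (d - j)) //=.
rewrite mulrDr big_mkord; congr (_ + _).
  rewrite mulr_sumr; apply: eq_bigr => k _.
  have kd : (j + k < d)%N by rewrite -ltn_subRL.
  rewrite /X kd -/(lam2 E k j s) lam2_sym // mulrA; congr (_ * _).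
  by rewrite sign_complement.
have [j0|j0] := posnP j.
  by rewrite j0 subn0 big_geq // mulr0 big_ord0 oppr0.
rewrite big_ltn ?ltn_subrL ?j0 ?(leq_ltn_trans _ jd1) //.
(* For these sizes j exceeds the rank of the contraction. *)
have -> : \sum_((d - j).+1 <= k < d) (-1) ^+ (k + j) * X k = 0.
  rewrite big_nat_cond big1 // => k /andP[/andP[jk kd] _]; rewrite /X big1 ?mulr0 // => F _.
  by rewrite !ifF ?mulr0 //; apply/negbTE; lia.
rewrite addr0 subnK ?(ltnW jd1) // mulrA mulNr -expr2 sqrr_sign mulN1r; congr (- _).
rewrite /X subnKC ?(ltnW jd1) // ltnn eqxx.
under eq_bigr do rewrite /lam2 mulr_sumr.
rewrite exchange_big; apply: eq_bigr => F _ /=; rewrite mulr_sumr.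
by apply: eq_bigr => i _; rewrite mulrCA.
Qed.

End Theta.

Lemma sum_act_orbit (gT : finGroupType) (rT : finType) (ta : {action gT &-> rT})
    (G : {group gT}) (x : rT) (h : rT -> algC) :
  \sum_(y in G) h (ta x y) = #|'C_G[x | ta]|%:R * \sum_(z in orbit ta G x) h z.
Proof.
rewrite (partition_big (ta x) (mem (orbit ta G x))) /= => [|y Gy]; last exact: mem_orbit.
rewrite mulr_sumr; apply: eq_bigr => z /orbitP[a Ga <-].
rewrite (eq_bigr (fun _ => h (ta x a))) => [|y /andP[_ /eqP->] //].
rewrite sumr_const -[LHS]mulr_natl; congr (_%:R * _).
rewrite -(card_rcoset _ a) -amove_act ?subsetT //.
by apply: eq_card => y; rewrite !inE.
Qed.

(** The formula for an induced character averages over [W]. Regrouping this average along the orbit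
    of [F] replaces the sum over orbit representatives by a sum over all members of [S] stable under
    [w]; [psi] is an equivariant extension of the characters [phi F] of the stabilizers. *)
Lemma sum_Ind_orbits (gT : finGroupType) (T : finType) (to : {action gT &-> T})
    (W : {group gT}) (S : {set {set T}})
    (phi : forall F, 'CF('N_W(F | to))) (psi : {set T} -> gT -> algC) w :
    [acts W, on S | to^*] -> w \in W ->
    (forall F u y, y \in W -> psi (to^*%act F y) (u ^ y)%g = psi F u) ->
    (forall F u, F \in S -> u \in 'N_W(F | to) -> phi F u = psi F u) ->
  \sum_(F in orbit_transversal to^*%act W S) 'Ind[W] (phi F) w
    = \sum_(F in S | w \in 'N(F | to)) psi F w.
Proof.
move=> actS Ww psiJ phiE; have [_ sXS X1 Xex] := orbit_transversalP actS.
set X := orbit_transversal _ _ _ in sXS X1 Xex *.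
pose h F := if w \in 'N(F | to) then psi F w else 0.
have IndE F : F \in X -> 'Ind[W] (phi F) w = \sum_(F' in orbit to^*%act W F) h F'.
  move=> XF; have SF := subsetP sXS F XF.
  rewrite cfIndE ?subsetIl //.
  have -> : \sum_(y in W) phi F (w ^ y)%g = \sum_(y in W) h (to^*%act F y).
    rewrite (reindex_inj invg_inj) /=; apply: eq_big => y; rewrite groupV // => Wy.
    have Nw : (w \in 'N(to^*%act F y | to)) = ((w ^ y^-1)%g \in 'N(F | to)).
      rewrite -!astab1_set; apply/astab1P/astab1P; rewrite conjgE invgK -!actM => h1.
        by rewrite -[RHS](actK to^*%act y) -h1 -!actM -!mulgA.
      by rewrite -{2}h1 -!actM -!mulgA mulVg mulg1.
    rewrite /h Nw; case: ifP => Nwy; last by rewrite cfun0 // in_setI Nwy andbF.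
    rewrite phiE //; last by apply/setIP; split=> //; rewrite groupJ ?groupV.
    by rewrite -[in RHS](psiJ _ _ y^-1%g) ?groupV // actK.
  by rewrite (@sum_act_orbit _ _ (to^*)%act W F h) astab1_set mulrA mulVf ?mul1r // pnatr_eq0 -lt0n cardG_gt0.
rewrite (eq_bigr _ IndE) (exchange_big_dep [pred F | F \in S]) /=; last first.
  move=> F F' XF /orbitP[a Wa <-].
  by rewrite (acts_act actS) // (subsetP sXS).
rewrite [RHS]big_mkcondr; apply: eq_bigr => F' SF'.
have [a Wa XF] := Xex F' SF'.
rewrite (big_pred1 (to^*%act F' a)) // => F /=; apply/andP/eqP=> [[XF1 F'F]|->].
  apply/eqP; rewrite -X1 //; apply: orbit_trans F'F; exact: mem_orbit.
by split=> //; rewrite orbit_sym mem_orbit.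
Qed.

(** Phrased for an arbitrary ground set, so that the minors at flats are again instances;
    [d = #|ground M|] is the boolean case. *)
Definition is_uniform (T : finType) (M : matroid T) d :=
  (d <= #|ground M|)%N /\
  forall A : {set T}, A \subset ground M -> (A \in indep M) = (#|A| <= d)%N.

Lemma subset_of_card (T : finType) (A : {set T}) k :
  (k <= #|A|)%N -> exists2 B : {set T}, B \subset A & #|B| = k.
Proof.
move=> kA; exists [set x in take k (enum A)].
  by apply/subsetP=> x; rewrite inE => /mem_take; rewrite mem_enum.
by rewrite cardsE (card_uniqP _) ?take_uniq ?enum_uniq // size_takel // -cardE.
Qed.

Section UniformMatroid.
Variables (T : finType) (M : matroid T) (d : nat).
Hypothesis unifM : is_uniform M d.
Local Notation E := (ground M).
Implicit Types A F : {set T}.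

Lemma uniform_mrank A : A \subset E -> mrank M A = minn #|A| d.
Proof.
case: unifM => dE iM sAE; apply/eqP; rewrite eqn_leq; apply/andP; split.
  have [I [iI sIA <-]] := mrank_basis M A.
  by rewrite leq_min subset_leq_card // -iM // (subset_trans sIA).
have [B sBA cB] := @subset_of_card _ A _ (geq_minl #|A| d).
rewrite -cB mrank_max // iM ?cB ?geq_minr //; exact: subset_trans sAE.
Qed.

Lemma uniform_rk : rk M = d.
Proof. by rewrite /rk uniform_mrank //; apply/minn_idPr; case: unifM. Qed.

Lemma uniform_flats F : (F \in flats M) = (F \subset E) && ((F == E) || (#|F| < d)%N).
Proof.
rewrite inE; case sFE: (F \subset E) => //=; have [dE _] := unifM.
apply/forall_inP/orP => [h | [/eqP-> x | Fd x]]; last first.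
- move=> /setDP[Ex F'x]; rewrite !uniform_mrank // ?subUset ?sub1set ?Ex //.
  by rewrite cardsU1 F'x; lia.
- by rewrite setDv inE.
have [->|nFE] := eqVneq F E; [by left | right].
have [x Ex F'x] : exists2 x, x \in E & x \notin F.
  by apply/subsetPn; apply: contraNN nFE => sEF; rewrite eqEsubset sFE.
have := h x; rewrite inE F'x Ex => /(_ isT).
rewrite !uniform_mrank // ?subUset ?sub1set ?Ex // cardsU1 F'x; lia.
Qed.

Lemma uniform_localization F : F \subset E -> (#|F| <= d)%N ->
  is_uniform (localization M F) #|F|.
Proof.
move=> sFE Fd; have [_ iM] := unifM; rewrite /is_uniform /= /loc_ground (setIidPr sFE).
split=> // A sAF; rewrite inE sAF andbT iM ?(subset_trans sAF) //.
by have := subset_leq_card sAF; lia.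
Qed.

Lemma uniform_contraction F : F \subset E -> (#|F| <= d)%N ->
  is_uniform (contraction M F) (d - #|F|).
Proof.
move=> sFE Fd; have [dE _] := unifM; rewrite /is_uniform /= /con_ground cardsD (setIidPr sFE).
split=> [|A sAEF]; first by rewrite leq_sub2r.
have /subsetDP[sAE dAF] := sAEF; rewrite inE sAEF /=.
rewrite !uniform_mrank // ?subUset ?sAE // cardsU (disjoint_setI0 dAF) cards0 subn0.
by apply/eqP/idP; lia.
Qed.

End UniformMatroid.

Lemma coef_signM (R : nzRingType) (p : {poly R}) n i :
  ((-1) ^+ n * p)`_i = (-1) ^+ n * p`_i.
Proof.
rewrite -!(signr_odd _ n); case: (odd n); last by rewrite !expr0 !mul1r.
by rewrite !expr1 !mulN1r coefN.
Qed.

Lemma cfun_signM (gT : finGroupType) (G : {group gT}) (f : 'CF(G)) n x :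
  ((-1) ^+ n * f) x = (-1) ^+ n * f x.
Proof.
rewrite -!(signr_odd _ n); case: (odd n); last by rewrite !expr0 !mul1r.
by rewrite !expr1 !mulN1r cfunE.
Qed.

Lemma actpermJ (gT : finGroupType) (T : finType) (to : {action gT &-> T}) x y :
  actperm to (x ^ y)%g = (actperm to x ^ actperm to y)%g.
Proof. by rewrite morphJ ?inE. Qed.

Lemma astabs_stable (gT : finGroupType) (T : finType) (to : {action gT &-> T}) F w :
  (w \in 'N(F | to)) = stable (actperm to w) F.
Proof.
apply/astabsP/stableP=> h x; first by rewrite actpermE h.
by rewrite -actpermE h.
Qed.

Lemma setact_actperm (gT : finGroupType) (T : finType) (to : {action gT &-> T}) F w :
  to^*%act F w = actperm to w @: F.
Proof. by apply: eq_imset => x; rewrite actpermE. Qed.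

Section EquivariantUniform.
Variables (gT : finGroupType) (T : finType) (to : {action gT &-> T}).
Variables (W : {group gT}) (M : eqmatroid to W).
Local Notation E := (ground M).

Lemma imset_ground w : w \in W -> actperm to w @: E = E.
Proof.
move=> Ww; have /stableP st := stable_ground M Ww.
by apply/setP=> x; rewrite -[x](permKV (actperm to w)) mem_imset ?st //; apply: perm_inj.
Qed.

Lemma acts_uniform_flats d : is_uniform M d -> [acts W, on flats M | to^*].
Proof.
move=> unifM; apply: acts_intro => w F Ww.
rewrite !(uniform_flats unifM) card_setact setact_actperm.
have -> : (actperm to w @: F \subset E) = (F \subset E).
  by rewrite -[in LHS](imset_ground Ww) imset_permS.
suff -> : (actperm to w @: F == E) = (F == E) by [].
by rewrite -[in LHS](imset_ground Ww) (inj_eq (imset_inj (@perm_inj _ _))).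
Qed.

Lemma coef_recip_char_poly i u :
  (recip (rk M) (eq_char_poly M))`_i u =
    if (i <= rk M)%N then (-1) ^+ i * OS M i u else 0.
Proof.
rewrite coef_poly ltnS; case: ifP => [iM|_]; last by rewrite cfunE.
rewrite coef_sum (bigD1 (inord i)) //= big1 => [|k /negPf ki]; last first.
  rewrite coefZ coefXn; have := ltn_ord k; rewrite ltnS => kM.
  suff -> : (rk M - i == rk M - k)%N = false by rewrite mulr0.
  apply/eqP=> eq_ik; move/negP: ki; apply; apply/eqP/val_inj; rewrite /= inordK //; lia.
by rewrite addr0 coefZ coefXn inordK // eqxx mulr1 cfun_signM.
Qed.

(* If the ground set is independent, its top degree is a plain exterior power, but
   by [lam_top] the alternating sum still computes it. *)
Lemma OS_uniform d i u : is_uniform M d -> u \in W -> (i <= d)%N -> (0 < d)%N ->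
  OS M i u = if (i < d)%N then lam E i (actperm to u)
             else \sum_(k < i) (-1) ^+ (i - k).-1 * lam E k (actperm to u).
Proof.
move=> [dE iM] Wu id d0; case: ltnP => [lt_id|le_di].
  by apply: OS_free => // A sAE cA; rewrite iM //; lia.
have {id le_di} -> : i = d by apply/eqP; rewrite eqn_leq id le_di.
have E0 : (0 < #|E|)%N by apply: leq_trans dE.
case: (ltnP d #|E|) => [_ | le_Ed]; last first.
  have -> : d = #|E| by apply/eqP; rewrite eqn_leq dE le_Ed.
  rewrite -lam_top ?stable_ground //; apply: OS_free => // A sAE _.
  by rewrite iM //; apply: leq_trans (subset_leq_card sAE) _.
case: d d0 dE iM => // d _ _ iM; rewrite OS_top_lam //.
by apply: eq_bigr => k _; rewrite subSn -1?ltnS.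
Qed.

End EquivariantUniform.

(** * Solving the recursion *)

Section Recursion.
Variables (Q : eqmatroid_polynomial) (hQ : inverse_KL Q).

(** [Q] is indexed by the group and takes records that contain proofs, so the localization at the
    whole ground set is not convertible to [M]. Irrelevance of boolean proofs identifies them. *)
Lemma inverse_KL_congr (gT : finGroupType) (T : finType) (to : {action gT &-> T})
    (W W' : {group gT}) (M : eqmatroid to W) (M' : eqmatroid to W') j w :
  W' = W -> ground M' = ground M -> indep M' = indep M ->
  (Q M')`_j w = (Q M)`_j w.
Proof.
move=> eW; case: _ / (esym eW) M' => {eW W'} M'.
case: M' M => [[E' I' p'] q'] [[E I p] q] /= eE eI; move: p' q' p q.
rewrite eE eI => p' q' p q; rewrite (bool_irrelevance p' p) in q' *.
by rewrite (bool_irrelevance q' q).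
Qed.

(** Strong induction on the rank, with group and action generalized because localizations are acted
    on by stabilizers. Only boolean matroids of smaller rank occur there, and [theta_boolean]
    evaluates them. *)
Lemma inverse_KL_uniform d (gT : finGroupType) (T : finType) (to : {action gT &-> T})
    (W : {group gT}) (M : eqmatroid to W) j w :
    is_uniform M d -> (j.*2 < d)%N -> w \in W ->
  (Q M)`_j w = theta (ground M) d j (actperm to w).
Proof.
have [n] := ubnP d; elim: n d gT T to W M j w => // n IHn d gT T to W M j w dn unifM jd Ww.
have [dE iM] := unifM; pose E := ground M; pose s := actperm to w.
have d0 : (0 < d)%N by apply: leq_ltn_trans jd.
have rkM := uniform_rk unifM.
have [_ _ szQ /(congr1 (fun p : {poly 'CF(W)} => (p`_j : 'CF(W)) w))] := hQ M.
rewrite rkM in szQ *; have {}szQ := szQ d0; rewrite -addnn in szQ.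
have jd2 : (j + j < d)%N by rewrite addnn.
rewrite coef_signM cfun_signM coef_poly ltnS ltnW; last by lia.
(* The left side involves coefficient d - j of [Q M], which is beyond its degree since 2j < d. *)
rewrite nth_default; last by move: szQ; set z := size _; case: z => [|z] /=; lia.
rewrite cfunE mulr0 coef_sum sum_cfunE.
(* The contribution of one flat: the unknown itself at [E], and elsewhere the sign of the boolean
   localization times degree j for the contraction. *)
pose psi (F : {set T}) (u : gT) : algC :=
  if F == E then (-1) ^+ d * (Q M)`_j u else
  (-1) ^+ (#|F| + j) * sgn_on F (actperm to u) *
   (if (j + #|F| < d)%N then lam (E :\: F) j (actperm to u)
    else if (j + #|F| == d)%N then
      \sum_(i < j) (-1) ^+ (j - i).-1 * lam (E :\: F) i (actperm to u)
    else 0).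
under eq_bigr do rewrite coef_map_id0 ?raddf0 //.
rewrite (@sum_Ind_orbits _ _ _ _ _ _ psi) //; first 1 last.
- exact: acts_uniform_flats unifM.
- move=> F u y Wy; have sE : actperm to y @: E = E := imset_ground M Wy.
  have eqE : (actperm to y @: F == E) = (F == E).
    by rewrite -[in LHS]sE (inj_eq (imset_inj (@perm_inj _ _))).
  have lamE i : lam (E :\: actperm to y @: F) i (actperm to (u ^ y)%g)
      = lam (E :\: F) i (actperm to u).
    by rewrite -[in LHS]sE -imset_permD actpermJ lamJ.
  rewrite /psi setact_actperm eqE cfunJ // card_imset; last exact: perm_inj.
  by rewrite actpermJ sgn_onJ -actpermJ lamE; under eq_bigr do rewrite lamE.
- move=> F u FE Nu; rewrite /psi; have [eFE|nFE] := eqVneq F E.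
    have uni_con : is_uniform (contraction M F) 0.
      rewrite /is_uniform /= /con_ground eFE setDv; split=> // A; rewrite subset0 => /eqP->.
      by rewrite (indep0 (contraction M _)) cards0.
    have uni_loc : is_uniform (localization M F) d.
      rewrite /is_uniform /= /loc_ground eFE setIid; split=> // A sAE.
      by rewrite inE sAE andbT iM.
    have -> : recip (rk (contraction M F)) (eq_char_poly (eq_contraction M F)) = 1.
      apply/polyP=> i; apply/cfunP=> v.
      have [Nv|N'v] := boolP (v \in 'N_W(F | to)); last by rewrite !cfun0.
      rewrite (coef_recip_char_poly (eq_contraction M F)) /= (uniform_rk uni_con) coef1 leqn0.
      case: eqP => [->|_]; last by rewrite cfunE.
      rewrite expr0 mul1r OS_free ?lam0 ?cfun1E ?Nv // => A.
      by rewrite /= /con_ground eFE setDv subset0 => /eqP-> _; apply: (indep0 (contraction M _)).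
    rewrite mulr1 coef_signM cfun_signM (uniform_rk uni_loc); congr (_ * _).
    apply: inverse_KL_congr; last first.
    + apply/setP=> A; rewrite inE eFE; case iA: (A \in indep M) => //=.
      exact: (indep_ground iA).
    + by rewrite /= /loc_ground eFE setIid.
    apply/group_inj/setIidPl; apply/subsetP=> v Wv.
    by rewrite astabs_stable eFE stable_ground.
  have [sFE Fd] : F \subset E /\ (#|F| < d)%N.
    by move: FE; rewrite (uniform_flats unifM) (negPf nFE) => /andP[].
  have uni_loc := uniform_localization unifM sFE (ltnW Fd).
  have uni_con := uniform_contraction unifM sFE (ltnW Fd).
  have stF : stable (actperm to u) F by move: Nu; rewrite inE astabs_stable => /andP[].
  have locE : ground (localization M F) = F by apply/setIidPr.
  (* A boolean matroid has its sign character in degree 0 and nothing else: low degrees follow by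
     induction, the others from the degree bound. *)
  have QlE i : (Q (eq_localization M F))`_i u = (i == 0%N)%:R * sgn_on F (actperm to u).
    have [_ rk0 szl _] := hQ (eq_localization M F).
    rewrite /= (uniform_rk uni_loc) -?addnn in rk0 szl.
    have [F0|F0] := posnP #|F|.
      have -> : sgn_on F (actperm to u) = 1 by rewrite (cards0_eq F0) sgn_on0.
      rewrite (rk0 F0) mulr1 coef1.
      by case: eqP => _; [rewrite cfun1E Nu | rewrite cfunE].
    case: (ltnP i.*2 #|F|) => [iF | Fi].
      rewrite (IHn #|F|) //; last by apply: leq_trans Fd _; rewrite -ltnS.
      by rewrite [ground _]locE theta_boolean.
    rewrite -addnn in Fi; have i0 : (i == 0%N) = false by apply/negbTE; lia.
    rewrite i0 mul0r nth_default ?cfunE //; have := szl F0.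
    by set z := size _; case: z => [|z] /=; lia.
  rewrite (uniform_rk uni_loc) -mulrA coef_signM cfun_signM coefM sum_cfunE.
  rewrite big_ord_recl big1 ?addr0 => [|i _]; last by rewrite cfunE QlE lift0 /= mulr0n !mul0r.
  rewrite cfunE QlE mul1r subn0 (coef_recip_char_poly (eq_contraction M F)) /= (uniform_rk uni_con).
  rewrite exprD -!mulrA; congr (_ * _); rewrite mulrCA; congr (_ * _).
  case: (ltnP (d - #|F|) j) => [Fj|jF].
    by rewrite !ifF ?mulr0 //; apply/negbTE; lia.
  rewrite (@OS_uniform _ _ _ _ (eq_contraction M F) _ _ _ uni_con) //; last by rewrite subn_gt0.
  congr (_ * _); rewrite ltn_subRL [(j + _)%N]addnC; case: ifP => // jF2.
  by rewrite ifT //; apply/eqP; lia.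
(* Only the term at [E] contains the unknown coefficient; the remaining sum is matched with
   [theta_sum]. *)
rewrite (bigD1 E) /=; last first.
  by rewrite (uniform_flats unifM) subxx eqxx astabs_stable stable_ground.
move/esym/eqP; rewrite addr_eq0 {1}/psi eqxx => /eqP QE.
have nz : (-1) ^+ d != 0 :> algC by rewrite signr_eq0.
apply: (mulfI nz); rewrite QE theta_sum ?stable_ground //.
rewrite mulrA mulrN -expr2 sqrr_sign mulN1r; congr (- _).
apply: eq_big => F.
  rewrite (uniform_flats unifM) astabs_stable.
  have [->|] := eqVneq F E; first by rewrite ltnNge dE /= !andbF.
  by rewrite /= andbT -andbA.
by case/andP=> _ /negPf nFE; rewrite /psi nFE.
Qed.

End Recursion.

(** * Averages over Young subgroups *)

Lemma perm_of_fibers n (K : finType) (c c' : 'I_n -> K) :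
    (forall k, #|[set x | c x == k]| = #|[set x | c' x == k]|) ->
  exists s : 'S_n, forall x, c' (s x) = c x.
Proof.
move=> eq_c; have cnt (c0 : 'I_n -> K) k : count_mem k [tuple c0 i | i < n] = #|[set x | c0 x == k]|.
  by rewrite count_map cardsE -sum1_card -sum1_count big_enum_cond.
have : perm_eq [tuple c i | i < n] [tuple c' i | i < n].
  by apply/allP=> k _; rewrite /= -!/(count_mem k [tuple _ | i < n]) !cnt eq_c.
case/tuple_permP=> s eq_s; exists s => x.
have /(congr1 (fun t => tnth t x)) : [tuple c i | i < n] =
    [tuple tnth [tuple c' i | i < n] (s i) | i < n] by apply/val_inj.
by rewrite !tnth_mktuple.
Qed.

Section YoungAverage.
Variables (n : nat) (I : finType) (kappa : 'I_n -> I) (eps : pred I).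
Implicit Types (A B : {set 'I_n}) (s : 'S_n).
Local Notation K i := (kappa @^-1: [set i]).

Definition young_group := [set s : 'S_n | [forall x, kappa (s x) == kappa x]].
Local Notation G := young_group.

Lemma young_groupP s : reflect (forall x, kappa (s x) = kappa x) (s \in G).
Proof. by rewrite inE; apply: (iffP forallP) => h x; apply/eqP. Qed.

Lemma young_groupM s t : s \in G -> t \in G -> (s * t)%g \in G.
Proof.
by move=> /young_groupP sG /young_groupP tG; apply/young_groupP=> x; rewrite permM tG sG.
Qed.

Lemma young_groupV s : s \in G -> (s^-1)%g \in G.
Proof.
by move=> /young_groupP sG; apply/young_groupP=> x; rewrite -{2}[x](permKV s) sG.
Qed.

Lemma stable_block s i : s \in G -> stable s (K i).
Proof. by move=> /young_groupP sG; apply/stableP=> x; rewrite !inE sG. Qed.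

(** The linear character of the Young subgroup that is the sign on the blocks selected by [eps] and
    trivial on the others. *)
Definition young_sign s : algC := \prod_(i | eps i) sgn_on (K i) s.

Lemma young_signM s t : s \in G -> t \in G ->
  young_sign (s * t) = young_sign s * young_sign t.
Proof.
move=> sG tG; rewrite /young_sign -big_split /=; apply: eq_bigr => i _.
by rewrite sgn_onM ?stable_block.
Qed.

Definition young_stab A B := [set s in G | stable s A && stable s B].

Lemma in_young_stab A B s :
  (s \in young_stab A B) = [&& s \in G, stable s A & stable s B].
Proof. by rewrite in_set. Qed.

(** For disjoint sets, this is triviality of [pair_sign] on the stabilizer of the pair. On a sign
    block the signs of the parts in [A] and [B] occur twice and cancel, leaving that of the rest; on
    a trivial block only these parts carry signs. At most one point means no sign. *)
Definition good_pair A B := [forall i,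
  if eps i then (#|K i :\: (A :|: B)| <= 1)%N else (#|A :&: K i| <= 1)%N && (#|B :&: K i| <= 1)%N].

Definition pair_sign A B s := young_sign s * (sgn_on A s * sgn_on B s).

Lemma pair_signM A B s t : s \in young_stab A B -> t \in young_stab A B ->
  pair_sign A B (s * t) = pair_sign A B s * pair_sign A B t.
Proof.
rewrite !in_young_stab => /and3P[sG sA sB] /and3P[tG tA tB].
rewrite /pair_sign young_signM // !sgn_onM //.
by rewrite [RHS]mulrACA; congr (_ * _); rewrite mulrACA.
Qed.

Lemma stableM A s t : stable s A -> stable t A -> stable (s * t)%g A.
Proof. by move=> /stableP sA /stableP tA; apply/stableP=> x; rewrite permM tA sA. Qed.

Lemma pair_sign_good A B s : [disjoint A & B] -> good_pair A B ->
  s \in young_stab A B -> pair_sign A B s = 1.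
Proof.
move=> dAB /forallP good; rewrite in_young_stab => /and3P[sG sA sB].
have kG : forall x, kappa (s x) = kappa x by apply/young_groupP.
rewrite /pair_sign /young_sign (sgn_on_bigcup sA kG) (sgn_on_bigcup sB kG).
rewrite -big_split /= big_mkcond -big_split big1 //= => i _.
have sK := stable_block i sG; have := good i; case: (eps i) => [R1 | /andP[A1 B1]].
  have dR : [disjoint (A :&: K i) :|: (B :&: K i) & K i :\: (A :|: B)].
    rewrite disjoint_subset; apply/subsetP=> x; rewrite !inE.
    by case: (x \in A); case: (x \in B); case: (kappa x == i).
  have dI : [disjoint A :&: K i & B :&: K i].
    rewrite disjoint_subset; apply/subsetP=> x; rewrite !inE => /andP[Ax _].
    by rewrite (disjointFr dAB).
  have KE : (A :&: K i) :|: (B :&: K i) :|: (K i :\: (A :|: B)) = K i.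
    apply/setP=> x; rewrite !inE; case: (kappa x == i); rewrite ?andbT ?andbF //=.
    by rewrite orbN.
  have := sgn_onU dR; rewrite KE => -> //; rewrite ?stableU ?stableI ?stableD ?stableU //.
  rewrite sgn_onU ?stableI // (sgn_on_card1 _ R1) mulr1.
  by rewrite -expr2 exprMn !expr2 !sgn_on_sqr mul1r.
by rewrite !sgn_on_card1 // !mulr1.
Qed.

(** The transposition of two points of an overfull cell is negative for exactly one of the three
    sign factors. *)
Lemma pair_sign_bad A B : [disjoint A & B] -> ~~ good_pair A B ->
  exists2 t, t \in young_stab A B & pair_sign A B t = -1.
Proof.
move=> dAB; rewrite negb_forall => /existsP[i].
have two (X : {set 'I_n}) : ~~ (#|X| <= 1)%N -> exists x y, [/\ x \in X, y \in X & x != y].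
  by rewrite -ltnNge => /card_gt1P[x [y [Xx Xy xy]]]; exists x, y.
have tG x y : kappa x = kappa y -> tperm x y \in G.
  by move=> kxy; apply/young_groupP=> z; case: tpermP => [->|->|].
have signE x y j : x != y -> kappa x = j -> kappa y = j ->
    young_sign (tperm x y) = if eps j then -1 else 1.
  move=> xy kx ky; rewrite /young_sign big_mkcond (bigD1 j) //= big1 ?mulr1 => [|k kj].
    by case: ifP => // _; rewrite sgn_on_tperm // !inE ?kx ?ky.
  by case: ifP => // _; rewrite sgn_on_tperm_out // !inE ?kx ?ky eq_sym.
have sub_out x (X Y : {set 'I_n}) : [disjoint X & Y] -> x \in X -> x \notin Y.
  by move=> dXY Xx; rewrite (disjointFr dXY).
case: ifP => e; [| rewrite negb_and => /orP[]] => /two[x [y [+ + xy]]]; rewrite !inE.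
- case/andP=> /norP[A'x B'x] /eqP kx /andP[/norP[A'y B'y] /eqP ky]; exists (tperm x y).
    by rewrite in_young_stab tG ?kx ?ky // !stable_tperm ?(negPf A'x) ?(negPf A'y) ?(negPf B'x) ?(negPf B'y).
  by rewrite /pair_sign (signE _ _ i) // e !sgn_on_tperm_out // !mulr1.
- case/andP=> Ax /eqP kx /andP[Ay /eqP ky]; exists (tperm x y).
    by rewrite in_young_stab tG ?kx ?ky // !stable_tperm ?Ax ?Ay // !(disjointFr dAB).
  rewrite /pair_sign (signE _ _ i) // e (sgn_on_tperm xy) // sgn_on_tperm_out ?(disjointFr dAB) //.
  by rewrite mul1r mulr1.
case/andP=> Bx /eqP kx /andP[By /eqP ky]; exists (tperm x y).
  by rewrite in_young_stab tG ?kx ?ky // !stable_tperm ?Bx ?By // !(disjointFl dAB).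
rewrite /pair_sign (signE _ _ i) // e (@sgn_on_tperm _ B _ _ xy) // sgn_on_tperm_out ?(disjointFl dAB) //.
by rewrite !mul1r.
Qed.

Lemma sum_pair_sign A B : [disjoint A & B] ->
  \sum_(s in young_stab A B) pair_sign A B s = (good_pair A B)%:R * #|young_stab A B|%:R.
Proof.
move=> dAB; have [good|bad] := boolP (good_pair A B).
  rewrite mul1r (eq_bigr (fun _ => 1)) ?sumr_const // => s.
  exact: pair_sign_good.
rewrite mul0r; have [t tS sgn_t] := pair_sign_bad dAB bad.
set S := \sum_(s in _) _; suff SN : S = - S.
  by have /eqP: S *+ 2 = 0; [rewrite mulr2n {1}SN addNr | rewrite mulrn_eq0 => /eqP].
have tsE s : ((t * s)%g \in young_stab A B) = (s \in young_stab A B).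
  move: tS; rewrite !in_young_stab => /and3P[tG tA tB].
  have tV X : stable t X -> stable (t^-1)%g X by move=> tX; rewrite /stable groupV.
  apply/and3P/and3P=> [] [sG sA sB]; last first.
    by split; [exact: young_groupM|apply: stableM|apply: stableM].
  rewrite -(mulKg t s).
  by split; [rewrite young_groupM ?young_groupV|apply: stableM|apply: stableM] => //; apply: tV.
rewrite /S [LHS](reindex_inj (mulgI t)) /= -sumrN; apply: eq_big => s; first exact: tsE.
by rewrite tsE => sS; rewrite pair_signM // sgn_t mulN1r.
Qed.

Lemma stable_imset A s : stable s A = (s @: A == A).
Proof.
apply/stableP/eqP=> [sA|sA x]; last by rewrite -{1}sA mem_imset //; apply: perm_inj.
by apply/setP=> x; rewrite -[x](permKV s) mem_imset ?sA //; apply: perm_inj.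
Qed.

(** Bounding the sizes by [n.+1] makes the size functions a finite type, over which pairs can be
    partitioned and products of block polynomials expanded. *)
Definition block_sizes A B : {ffun I -> 'I_n.+1 * 'I_n.+1} :=
  [ffun i => (inord #|A :&: K i|, inord #|B :&: K i|)].

Lemma block_sizesE A B i : (((block_sizes A B) i).1 = #|A :&: K i| :> nat) *
  (((block_sizes A B) i).2 = #|B :&: K i| :> nat).
Proof.
have le_n (X : {set 'I_n}) : (#|X| < n.+1)%N by rewrite ltnS -[X in (_ <= X)%N](card_ord n) max_card.
by rewrite ffunE /= !inordK.
Qed.

Lemma imset_perm_block s A i : s \in G -> #|(s @: A) :&: K i| = #|A :&: K i|.
Proof.
move=> sG; rewrite -(card_imset (mem (A :&: K i)) (@perm_inj _ s)); apply: eq_card => x.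
rewrite -[x](permKV s) !(inE, mem_imset _ _ perm_inj).
by have /young_groupP-> := sG.
Qed.

Lemma disjoint_imset s A B : [disjoint s @: A & s @: B] = [disjoint A & B].
Proof.
rewrite !disjoint_subset; apply/subsetP/subsetP=> h x.
  by move=> Ax; have := h (s x); rewrite !inE !(mem_imset _ _ perm_inj); apply.
by rewrite -[x](permKV s) !inE !(mem_imset _ _ perm_inj) => /h; rewrite !inE.
Qed.

(* The pairs with given blockwise sizes form a single orbit. *)
Lemma card_young_orbit A B : [disjoint A & B] ->
  (\sum_(P : {set 'I_n} * {set 'I_n} |
      [disjoint P.1 & P.2] && (block_sizes P.1 P.2 == block_sizes A B))
    #|young_stab P.1 P.2|)%N = #|G|.
Proof.
move=> dAB.
rewrite -[RHS]sum1_card (partition_big (fun s => (s @: A, s @: B))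
   (fun P => [disjoint P.1 & P.2] && (block_sizes P.1 P.2 == block_sizes A B))) /=; last first.
  move=> s sG; rewrite disjoint_imset dAB; apply/eqP/ffunP=> i.
  by rewrite !ffunE !imset_perm_block.
apply: eq_bigr => -[A1 B1] /= /andP[dAB1 /eqP eq_sz].
have [s sE] : exists s : 'S_n, forall x, (kappa (s x), s x \in A1, s x \in B1) = (kappa x, x \in A, x \in B).
  apply: (@perm_of_fibers _ _ (fun x => (kappa x, x \in A, x \in B)) (fun x => (kappa x, x \in A1, x \in B1))).
  move=> [[i a] b].
  have eqA := block_sizesE A B i; have eqA1 := block_sizesE A1 B1 i.
  rewrite eq_sz in eqA1; have cA : #|A1 :&: K i| = #|A :&: K i| by rewrite -eqA -eqA1.
  have cB : #|B1 :&: K i| = #|B :&: K i| by rewrite -eqA -eqA1.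
  have cell (X Y : {set 'I_n}) : [disjoint X & Y] ->
      #|[set x | (kappa x, x \in X, x \in Y) == (i, a, b)]| =
      if a then if b then 0%N else #|X :&: K i| else if b then #|Y :&: K i|
      else (#|K i| - (#|X :&: K i| + #|Y :&: K i|))%N.
    move=> dXY; rewrite (_ : [set x | _] = [set x in K i | ((x \in X) == a) && ((x \in Y) == b)]); last first.
      by apply/setP=> x; rewrite !inE !xpair_eqE -andbA.
    case: a; case: b.
    - apply/eqP; rewrite cards_eq0; apply/eqP/setP=> x; rewrite !inE !eqb_id.
      by case Xx: (x \in X); rewrite ?andbF // (disjointFr dXY Xx) !andbF.
    - apply: eq_card => x; rewrite !inE eqb_id eqbF_neg.
      by case Xx: (x \in X); rewrite ?andbF // (disjointFr dXY Xx) andbT.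
    - apply: eq_card => x; rewrite !inE eqb_id eqbF_neg.
      by case Yx: (x \in Y); rewrite ?andbF // (disjointFl dXY Yx) /= ?andbT.
    have -> : (#|X :&: K i| + #|Y :&: K i|)%N = #|K i :&: (X :|: Y)|.
      rewrite setIUr cardsU ![K i :&: _]setIC (_ : _ :&: _ :&: _ = set0) ?cards0 ?subn0 //.
      by rewrite setIACA (disjoint_setI0 dXY) set0I.
    rewrite -cardsD; apply: eq_card => x; rewrite !inE !eqbF_neg.
    by rewrite negb_or; case: (kappa x == i); rewrite ?andbF ?andbT.
  by rewrite !cell // cA cB.
have sG : s \in G by apply/young_groupP=> x; case: (sE x).
have sA : s @: A = A1.
  by apply/setP=> x; rewrite -[x](permKV s) (mem_imset _ _ perm_inj); case: (sE (s^-1%g x)).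
have sB : s @: B = B1.
  by apply/setP=> x; rewrite -[x](permKV s) (mem_imset _ _ perm_inj); case: (sE (s^-1%g x)).
rewrite sum1_card -(card_imset (mem (young_stab A1 B1)) (mulgI s)); apply: eq_card => r.
rewrite -(mulKVg s r) mem_imset; last exact: mulgI.
move: (s^-1 * r)%g => t; rewrite in_young_stab unfold_in /= xpair_eqE.
have im (X : {set 'I_n}) : (s * t)%g @: X = t @: (s @: X).
  by rewrite -imset_comp; apply: eq_imset => x; rewrite /= permM.
rewrite !im sA sB !stable_imset; congr (_ && _).
apply/idP/idP=> tG; first exact: young_groupM.
by rewrite -(mulKg s t) young_groupM ?young_groupV.
Qed.

Lemma card_blocks A : #|A| = (\sum_i #|A :&: K i|)%N.
Proof.
rewrite -sum1_card (partition_big kappa predT) //=; apply: eq_bigr => i _.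
by rewrite -sum1_card; apply: eq_bigl => x; rewrite !inE.
Qed.

Definition block_cond i (u v : nat) :=
  (u + v <= #|K i|)%N && (if eps i then #|K i| <= u + v + 1 else (u <= 1) && (v <= 1))%N.

Lemma good_pairE A B : [disjoint A & B] ->
  good_pair A B = [forall i, block_cond i #|A :&: K i| #|B :&: K i|].
Proof.
move=> dAB; apply: eq_forallb => i; rewrite /block_cond.
have cU : #|K i :&: (A :|: B)| = (#|A :&: K i| + #|B :&: K i|)%N.
  rewrite setIUr cardsU ![K i :&: _]setIC setIACA (disjoint_setI0 dAB) set0I.
  by rewrite cards0 subn0.
have le := subset_leq_card (subsetIl (K i) (A :|: B)).
by rewrite cardsD; case: (eps i); rewrite cU in le *; rewrite le //=; lia.
Qed.

Lemma card_take_index (S : {set 'I_n}) q : (q <= #|S|)%N ->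
  #|[set x in S | (index x (enum S) < q)%N]| = q.
Proof.
move=> qS; rewrite (_ : [set x in S | _] = [set x in take q (enum S)]).
  by rewrite cardsE (card_uniqP _) ?take_uniq ?enum_uniq // size_takel // -cardE.
apply/setP=> x; rewrite !inE; case: (boolP (x \in S)) => Sx /=.
  by rewrite in_take ?mem_enum.
by apply/esym; apply: contraNF Sx => /mem_take; rewrite mem_enum.
Qed.

Lemma block_sizes_realizable (f : {ffun I -> 'I_n.+1 * 'I_n.+1}) :
    [forall i, block_cond i (f i).1 (f i).2] ->
  exists A B, [disjoint A & B] /\ block_sizes A B = f.
Proof.
move=> /forallP cf.
(* The sets are cut out of initial segments of the blocks: the first [(f i).1] points of block [i],
   then the next [(f i).2]. *)
pose X (h : I -> nat) := [set x | (index x (enum (K (kappa x))) < h (kappa x))%N].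
have cX h i : (h i <= #|K i|)%N -> #|X h :&: K i| = h i.
  move=> hK; rewrite -[RHS](card_take_index hK); apply: eq_card => x; rewrite !inE andbC.
  by case: eqP => //= ->.
pose A := X (fun i => (f i).1); pose C := X (fun i => (f i).1 + (f i).2)%N.
have sAC : A \subset C by apply/subsetP=> x; rewrite !inE => /leq_trans; apply; rewrite leq_addr.
have cA i : #|A :&: K i| = (f i).1.
  by apply: cX; have /andP[h _] := cf i; apply: leq_trans h; apply: leq_addr.
have cC i : #|C :&: K i| = ((f i).1 + (f i).2)%N by apply: cX; have /andP[] := cf i.
have cB i : #|(C :\: A) :&: K i| = (f i).2.
  have -> : (C :\: A) :&: K i = (C :&: K i) :\: (A :&: K i).
    by apply/setP=> x; rewrite !inE; case: (kappa x == i); rewrite ?andbF ?andbT.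
  by rewrite cardsD (setIidPr (setSI (K i) sAC)) cA cC addKn.
exists A, (C :\: A); split.
  by rewrite disjoint_sym disjoint_subset; apply/subsetP=> x; rewrite !inE => /andP[].
apply/ffunP=> i; rewrite ffunE cA cB; case: (f i) => u v /=.
by congr (_, _); apply/val_inj; rewrite /= inordK.
Qed.

Lemma lam2_pairs a b s : lam2 setT a b s =
  \sum_(P : {set 'I_n} * {set 'I_n} | [&& [disjoint P.1 & P.2], #|P.1| == a, #|P.2| == b,
      stable s P.1 & stable s P.2]) sgn_on P.1 s * sgn_on P.2 s.
Proof.
rewrite /lam2; under eq_bigr do rewrite mulr_sumr.
rewrite pair_big_dep /=; apply: eq_bigl => -[A B] /=.
rewrite subsetT setTD subsets_disjoint setCK disjoint_sym.
by case: [disjoint _ & _]; case: (#|A| == a); case: (#|B| == b); case: (stable s A).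
Qed.

(** Generating function of the sizes that a good pair may have in one block; the outer variable
    records the first set, the inner one the second. *)
Definition block_poly i : {poly {poly algC}} :=
  \poly_(u < n.+1) \poly_(v < n.+1) (block_cond i u v)%:R.

Lemma block_polyE i : block_poly i =
  \sum_(p : 'I_n.+1 * 'I_n.+1) (block_cond i p.1 p.2)%:R * ('X%:P ^+ p.2 * 'X^(p.1)).
Proof.
rewrite /block_poly poly_def; under eq_bigr do rewrite poly_def.
rewrite -(pair_bigA _ (fun u v : 'I_n.+1 => (block_cond i u v)%:R * ('X%:P ^+ v * 'X^u))) /=.
apply: eq_bigr => u _; rewrite -mul_polyC rmorph_sum mulr_suml.
apply: eq_bigr => v _; rewrite scaler_nat rmorphMn rmorphXn /= mulr_natl.
by rewrite mulrnAl.
Qed.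

Lemma coef_block_prod a b : (\prod_i block_poly i)`_a`_b =
  \sum_(f : {ffun I -> 'I_n.+1 * 'I_n.+1} |
     [&& [forall i, block_cond i (f i).1 (f i).2],
        (\sum_i (f i).1 == a)%N & (\sum_i (f i).2 == b)%N]) 1.
Proof.
under eq_bigr do rewrite block_polyE.
rewrite bigA_distr_bigA /= coef_sum coef_sum [RHS]big_mkcond; apply: eq_bigr => f _.
rewrite !big_split /= !prodrXr.
have -> : \prod_i (block_cond i (f i).1 (f i).2)%:R =
    [forall i, block_cond i (f i).1 (f i).2]%:R :> {poly {poly algC}}.
  case: (boolP [forall i, _]) => [/forallP cf|].
    by rewrite big1 // => i _; rewrite cf.
  by rewrite negb_forall => /existsP[i /negPf ci]; rewrite (bigD1 i) //= ci mul0r.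
case: [forall i, _] => /=; last by rewrite mul0r !coef0.
rewrite mul1r coefMXn -rmorphXn coefC.
case: (ltngtP a (\sum_i (f i).1)%N) => [lt|gt|->] /=; rewrite ?coef0 //.
  by rewrite subn_eq0 leqNgt gt coef0.
by rewrite subnn eqxx /= coefXn eq_sym; case: eqP.
Qed.

(** After exchanging the sums only good pairs survive, each weighted by the order of its stabilizer.
    An orbit of good pairs thus contributes the order of the group, and the product of block
    polynomials counts these orbits by their sizes. *)
Lemma young_average a b :
  \sum_(s in G) young_sign s * lam2 setT a b s = #|G|%:R * (\prod_i block_poly i)`_a`_b.
Proof.
pose D (P : {set 'I_n} * {set 'I_n}) := [&& [disjoint P.1 & P.2], #|P.1| == a & #|P.2| == b].
transitivity (\sum_(P | D P) (good_pair P.1 P.2)%:R * #|young_stab P.1 P.2|%:R : algC).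
  under eq_bigr do rewrite lam2_pairs mulr_sumr.
  rewrite (exchange_big_dep D) /=; last by move=> s P _ /and5P[*]; apply/and3P.
  apply: eq_bigr => P /and3P[dP a1 b1]; rewrite -sum_pair_sign //.
  apply: eq_bigl => s; by rewrite in_young_stab dP a1 b1.
rewrite (partition_big (fun P => block_sizes P.1 P.2) predT) //=.
rewrite coef_block_prod mulr_sumr [RHS]big_mkcond; apply: eq_bigr => f _.
have sumE A B : block_sizes A B = f ->
    (#|A| = \sum_i (f i).1)%N /\ (#|B| = \sum_i (f i).2)%N.
  by move=> <-; rewrite !(card_blocks _); split; apply: eq_bigr => i _; rewrite block_sizesE.
have condE A B : [disjoint A & B] -> block_sizes A B = f ->
    good_pair A B = [forall i, block_cond i (f i).1 (f i).2].
  by move=> dAB <-; rewrite good_pairE //; apply: eq_forallb => i; rewrite !block_sizesE.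
case: ifP => [/and3P[cf /eqP ca /eqP cb] | nf]; last first.
  rewrite big1 // => -[A B] /= /andP[/and3P[dAB /= /eqP cA /eqP cB] /eqP eqf].
  have [eA eB] := sumE _ _ eqf; rewrite (condE A B) //.
  by move: nf; rewrite -eA -eB cA cB !eqxx !andbT => ->; rewrite mul0r.
have [A [B [dAB bAB]]] := block_sizes_realizable cf.
rewrite mulr1 -(card_young_orbit dAB) natr_sum; apply: eq_big => -[A1 B1] /=.
  rewrite bAB /D /=; case: (block_sizes A1 B1 =P f) => [e1|_]; last by rewrite !andbF.
  by have [-> ->] := sumE _ _ e1; rewrite ca cb !eqxx !andbT.
by case/andP=> /and3P[d1 _ _] /eqP e1; rewrite (condE _ _ d1 e1) cf mul1r.
Qed.

End YoungAverage.

(** * Specht modules *)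

Lemma mxtrace_submod (gT : finGroupType) (G : {group gT}) n
    (rG : mx_representation algC G n) (U : 'M_n) (modU : mxmodule rG U)
    (P : 'M_n) x :
    (P <= U)%MS -> U *m P = U -> x \in G ->
  \tr (submod_repr modU x) = \tr (rG x *m P).
Proof.
move=> PU UP Gx; apply: (addIr (\tr (factmod_repr modU x))).
rewrite mxtrace_sub_fact_mod (@mxtrace_factmod _ _ _ _ _ _ (1%:M - P)) //.
- by rewrite mulmxBr mulmx1 mxtraceD raddfN /= addrC subrK.
- by rewrite mulmxBr mulmx1 UP subrr.
by rewrite opprB addrC subrK.
Qed.

(** In a rank factorization of [A] the product of the two factors in the other order vanishes, and
    it has the same trace. *)
Lemma mxtrace_square_zero n (A : 'M[algC]_n) : A *m A = 0 -> \tr A = 0.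
Proof.
move=> AA; move: (mulmx_base A) (row_base_free A) (col_base_full A).
move: (row_base A) (col_base A) => r c cr r_free c_full.
rewrite -cr mxtrace_mulC; suff -> : r *m c = 0 by rewrite mxtrace0.
apply: (row_free_inj r_free); apply: (row_full_inj c_full).
by rewrite /= mul0mx mulmx0 -mulmxA cr mulmxA cr.
Qed.

(** The sum of the conjugates of [y] acts as a scalar by Schur's lemma, and the trace identifies the
    scalar. *)
Lemma irr_sum_conj (gT : finGroupType) (G : {group gT}) (chi : 'CF(G)) x y :
    chi \in irr G -> x \in G -> y \in G ->
  chi 1%g * (\sum_(g in G) chi (x * (y ^ g^-1))%g) = #|G|%:R * (chi x * chi y).
Proof.
case/irr_reprP=> -[n rG] /= irrG ->{chi} Gx Gy.
pose Z := \sum_(g in G) rG (y ^ g^-1)%g.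
have Gyg g : g \in G -> (y ^ g^-1)%g \in G by move=> Gg; rewrite groupJ ?groupV.
have /is_scalar_mxP[c Zc] : is_scalar_mx Z.
  apply: mx_abs_irr_cent_scalar (groupC irrG) _ _; apply/centgmxP=> h Gh.
  rewrite /Z mulmx_suml mulmx_sumr (reindex_inj (mulgI h)) /=.
  apply: eq_big => g; first by rewrite groupMl.
  rewrite groupMl // => Gg; rewrite -!repr_mxM ?Gyg ?groupMl //; congr (rG _).
  by rewrite !conjgE !invgK invMg !mulgA mulgKV.
have tZ : \tr Z = #|G|%:R * cfRepr rG y.
  rewrite /Z raddf_sum /= (eq_bigr (fun _ => cfRepr rG y)) => [|g Gg].
    by rewrite sumr_const mulr_natl.
  by rewrite -(cfunJ (cfRepr rG) y (groupVr Gg)) cfunE Gyg // mulr1n.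
have -> : \sum_(g in G) cfRepr rG (x * (y ^ g^-1))%g = \tr (rG x *m Z).
  rewrite /Z mulmx_sumr raddf_sum /=; apply: eq_bigr => g Gg.
  by rewrite cfunE groupM ?Gyg // mulr1n repr_mxM ?Gyg.
rewrite cfRepr1 mulrCA -tZ Zc mxtrace_scalar mul_mx_scalar mxtraceZ cfunE Gx mulr1n.
by rewrite -[c *+ n]mulr_natl [RHS]mulrCA [c * _]mulrC.
Qed.

Section YoungSymmetrizer.
Variables (n : nat) (C R : {group 'S_n}).
Implicit Types (s t g h : 'S_n) (z : 'S_n -> algC).
Hypothesis CR1 : C :&: R = 1%g.
Hypothesis vonNeumann : forall g, (g \in (C * R)%g) \/
  exists x y, [/\ x != y, tperm x y \in C & (tperm x y ^ g)%g \in R].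

Definition symmetrized z :=
  (forall s g, s \in C -> z (s * g)%g = (-1) ^+ s * z g) /\
  (forall t g, t \in R -> z (g * t)%g = z g).

(** Off [C * R] a transposition gives -1 through [C] on the left and, conjugated by [g], gives 1
    through [R] on the right, so the value is its own opposite. Hence a symmetrized function is
    determined by its value at 1. *)
Lemma symmetrized_eq0 z : symmetrized z -> z 1%g = 0 -> forall g, z g = 0.
Proof.
move=> [zC zR] z1 g; case: (vonNeumann g) => [/mulsgP[s t Cs Rt ->]|[x [y [xy Cxy Rxy]]]].
  by rewrite zR // -[s]mulg1 zC // z1 mulr0.
have := zC _ g Cxy; rewrite odd_tperm xy expr1 mulN1r conjgC zR //.
move=> zgN; have /eqP : z g *+ 2 = 0 by rewrite mulr2n {1}zgN addNr.
by rewrite mulrn_eq0 => /eqP.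
Qed.

Definition young_coef g : algC := \sum_(s in C) (-1) ^+ s * (s^-1 * g \in R)%:R%g.

Lemma young_coef1 : young_coef 1%g = 1.
Proof.
rewrite /young_coef (bigD1 1%g) //= odd_perm1 expr0 mul1r mulg1 invg1 group1 big1 ?addr0 //.
move=> s /andP[Cs s1]; rewrite mulg1 groupV; case Rs: (s \in R); last by rewrite mulr0.
have : s \in C :&: R by rewrite inE Cs.
by rewrite CR1 inE (negPf s1).
Qed.

Lemma young_coef_symmetrized : symmetrized young_coef.
Proof.
split=> [s g Cs | t g Rt]; rewrite /young_coef.
  rewrite (reindex_inj (mulgI s)) mulr_sumr; apply: eq_big => r; first by rewrite groupMl.
  by move=> _; rewrite odd_permM signr_addb invMg -mulgA mulKg mulrA.
by apply: eq_bigr => s _; rewrite mulgA groupMr.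
Qed.

Lemma symmetrizedE z : symmetrized z -> forall g, z g = z 1%g * young_coef g.
Proof.
move=> [zC zR] g; apply/eqP; rewrite -subr_eq0; apply/eqP.
have [yC yR] := young_coef_symmetrized.
apply: (@symmetrized_eq0 (fun g => z g - z 1%g * young_coef g)).
  split=> [s h Cs | t h Rt]; last by rewrite zR ?yR.
  by rewrite zC ?yC // mulrBr mulrCA.
by rewrite young_coef1 mulr1 subrr.
Qed.

Lemma young_coef_sum (f : 'S_n -> algC) :
  \sum_g young_coef g * f g = \sum_(s in C) \sum_(t in R) (-1) ^+ s * f (s * t)%g.
Proof.
under eq_bigr do rewrite /young_coef mulr_suml.
rewrite exchange_big; apply: eq_bigr => s Cs /=.
rewrite (reindex_inj (mulgI s)) /= [RHS]big_mkcond; apply: eq_bigr => t _.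
by rewrite mulKg; case: ifP; rewrite ?mulr1 // mulr0 mul0r.
Qed.

(** The coefficient at 1 of the square of the Young symmetrizer, hence the scalar by which the
    symmetrizer is a quasi-idempotent. *)
Definition young_gamma : algC := \sum_g young_coef g * young_coef g^-1%g.
Local Notation c := young_coef.

Lemma young_coef_conv k : \sum_h c h * c (k * h^-1)%g = young_gamma * c k.
Proof.
have [yC yR] := young_coef_symmetrized.
rewrite (@symmetrizedE (fun k => \sum_h c h * c (k * h^-1)%g)).
  by congr (_ * _); apply: eq_bigr => h _; rewrite mul1g.
split=> [s g Cs | t g Rt].
  by rewrite mulr_sumr; apply: eq_bigr => h _; rewrite -mulgA (yC s) // mulrCA.
rewrite (reindex_inj (mulIg t)) /=; apply: eq_bigr => h _.
by rewrite (yR t) // invMg mulgA mulgK.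
Qed.

Lemma young_coef_conv2 h k : \sum_g c g * c (h * g^-1 * k^-1)%g = young_gamma * (c h * c k^-1%g).
Proof.
have [yC yR] := young_coef_symmetrized.
rewrite (@symmetrizedE (fun h => \sum_g c g * c (h * g^-1 * k^-1)%g)); last first.
  split=> [s g Cs | t g Rt].
    by rewrite mulr_sumr; apply: eq_bigr => r _; rewrite -!mulgA (yC s) // mulrCA.
  rewrite (reindex_inj (mulIg t)) /=; apply: eq_bigr => r _.
  by rewrite (yR t) // invMg mulgA mulgK.
have -> : \sum_g c g * c (1 * g^-1 * k^-1)%g = young_gamma * c k^-1%g.
  rewrite (@symmetrizedE (fun l => \sum_g c g * c (1 * g^-1 * l)%g)).
    by congr (_ * _); apply: eq_bigr => g _; rewrite mul1g mulg1.
  split=> [s l Cs | t l Rt]; last by apply: eq_bigr => g _; rewrite mulgA (yR t).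
  rewrite (reindex_inj (mulgI s)) /= mulr_sumr; apply: eq_bigr => g _.
  by rewrite (yC s) // !mul1g invMg -mulgA mulKg mulrA.
by rewrite -mulrA [c _ * c h]mulrC.
Qed.

Local Notation G := [set: 'S_n]%G.

(** Nonzero averages over [R] and [C] do not at once give a nonzero value on their product. If that
    value vanished, uniqueness of symmetrized functions, applied in [h] and then in [g], would
    annihilate the sums twisted by all [g] and [h]. Taking [h = g^-1] and summing over [g],
    [irr_sum_conj] returns the product of the two averages, a contradiction. *)
Lemma young_coef_irr (chi : 'CF(G)) : chi \in irr G ->
    \sum_(t in R) chi t != 0 -> \sum_(s in C) (-1) ^+ s * chi s != 0 ->
  \sum_g c g * chi g != 0.
Proof.
move=> irrchi X0 Y0; rewrite young_coef_sum.
set F := \sum_(s in C) _; apply/eqP=> F0.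
pose Z g h := \sum_(s in C) \sum_(t in R) (-1) ^+ s * chi (s * g * t * h)%g.
have Z1 h : Z 1%g h^-1%g = 0.
  rewrite (@symmetrizedE (fun h => Z 1%g h^-1%g)).
    suff -> : Z 1%g (1^-1)%g = F by rewrite F0 mul0r.
    by rewrite /Z /F; apply: eq_bigr => s _; apply: eq_bigr => t _; rewrite invg1 !mulg1.
  split=> [s g Cs | t g Rt]; rewrite /Z.
    rewrite (reindex_inj (mulgI s)) mulr_sumr; apply: eq_big => r; first by rewrite groupMl.
    move=> _; rewrite mulr_sumr; apply: eq_bigr => t _.
    rewrite odd_permM signr_addb -mulrA; congr (_ * (_ * _)).
    rewrite -(cfunJ chi _ (in_setT s)); congr (chi _).
    by rewrite conjgE invMg !mulgA mulVg mul1g mulgKV.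
  apply: eq_bigr => s _; rewrite (reindex_inj (mulIg t)) /=; apply: eq_big => r; first by rewrite groupMr.
  by move=> _; rewrite invMg !mulgA mulgK.
have Zgh g h : Z g h^-1%g = 0.
  rewrite (@symmetrizedE (fun g => Z g h^-1%g)) ?Z1 ?mul0r //.
  split=> [s l Cs | t l Rt]; rewrite /Z.
    rewrite (reindex_inj (mulIg s^-1%g)) mulr_sumr; apply: eq_big => r; first by rewrite groupMr ?groupV.
    move=> _; rewrite mulr_sumr; apply: eq_bigr => t _.
    by rewrite odd_permM odd_permV addbC signr_addb -mulrA !mulgA mulgKV.
  apply: eq_bigr => s _; rewrite (reindex_inj (mulgI t^-1%g)) /=; apply: eq_big => r; first by rewrite groupMl ?groupV.
  by move=> _; rewrite !mulgA -(mulgA _ t) mulgV mulg1.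
have: chi 1%g * (\sum_g Z g g^-1%g) =
    #|G|%:R * ((\sum_(s in C) (-1) ^+ s * chi s) * (\sum_(t in R) chi t)).
  rewrite exchange_big mulr_sumr mulr_suml mulr_sumr; apply: eq_bigr => s Cs /=.
  rewrite exchange_big mulr_sumr mulr_sumr mulr_sumr; apply: eq_bigr => t Rt /=.
  rewrite -mulr_sumr mulrCA.
  have -> : \sum_g chi (s * g * t * g^-1)%g = \sum_(g in G) chi (s * (t ^ g^-1))%g.
    by apply: eq_big => g; rewrite ?inE // => _; rewrite conjgE invgK !mulgA.
  rewrite irr_sum_conj ?inE //; rewrite mulrCA; congr (_ * _).
  by rewrite mulrA.
rewrite big1 ?mulr0 => [/esym/eqP|g _]; last exact: Zgh.
by rewrite !mulf_eq0 (negPf X0) (negPf Y0) (negPf (neq0CG _)).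
Qed.

Section Specht.
Variable y : 'rV[algC]_#|G|.
Local Notation aG := (regular_repr algC G).
Hypothesis yE : forall i, y 0 i = c (enum_val i).

(** Left multiplication by [y], which commutes with the right regular action; divided by
    [young_gamma] it projects onto the ideal generated by [y]. *)
Definition left_mul : 'M_#|G| := \matrix_i (y *m aG (enum_val i)).
Local Notation modU := (cyclic_mx_module aG y).

Lemma row_regular (v : 'rV[algC]_#|G|) g i :
  (v *m aG g) 0 i = v 0 (gring_index G (enum_val i * g^-1)%g).
Proof.
rewrite mxE (bigD1 (gring_index G (enum_val i * g^-1)%g)) //= big1 ?addr0.
  by rewrite mxE gring_indexK ?inE // mulgKV gring_valK mxE !eqxx mulr1.
move=> j /eqP ji; rewrite !mxE eqxx /=; case: eqP => [ij|]; last by rewrite mulr0.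
by case: ji; rewrite ij gring_indexK ?inE // mulgK gring_valK.
Qed.

Lemma sum_enum_val (f : 'S_n -> algC) : \sum_(i < #|G|) f (enum_val i) = \sum_g f g.
Proof.
rewrite (reindex_onto (@enum_val _ (mem G)) (gring_index G)) /=; last first.
  by move=> g _; rewrite gring_indexK ?inE.
by apply: eq_bigl => i; rewrite gring_valK eqxx.
Qed.

Lemma left_mulE i j : left_mul i j = c (enum_val j * (enum_val i)^-1)%g.
Proof. by rewrite mxE row_regular yE gring_indexK ?inE. Qed.

Lemma left_mul_comm g : aG g *m left_mul = left_mul *m aG g.
Proof.
apply/row_matrixP=> i; rewrite row_mul rowK -rowE !rowK gring_indexK ?inE //.
by rewrite row_mul rowK -mulmxA -repr_mxM ?inE.
Qed.

Lemma y_left_mul : y *m left_mul = young_gamma *: y.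
Proof.
apply/rowP=> i; rewrite !mxE yE -young_coef_conv -sum_enum_val.
by apply: eq_bigr => j _; rewrite yE left_mulE.
Qed.

Lemma left_mul_sqr : left_mul *m left_mul = young_gamma *: left_mul.
Proof.
apply/row_matrixP=> i; rewrite row_mul rowK -mulmxA left_mul_comm mulmxA y_left_mul.
by rewrite -scalemxAl linearZ /= rowK.
Qed.

Lemma tr_left_mul g : \tr (aG g *m left_mul) = \sum_h c (h * g^-1 * h^-1)%g.
Proof.
rewrite left_mul_comm -sum_enum_val; apply: eq_bigr => i _.
have -> : (left_mul *m aG g) i i = (row i (left_mul *m aG g)) 0 i by rewrite [RHS]mxE.
rewrite row_mul row_regular rowK row_regular gring_indexK ?inE // yE gring_indexK ?inE //.
Qed.

(** Otherwise [left_mul] would square to zero and have trace 0, while all its diagonal entries are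
    [young_coef 1 = 1]. *)
Lemma young_gamma_neq0 : young_gamma != 0.
Proof.
apply/eqP=> g0; have := left_mul_sqr; rewrite g0 scale0r => /mxtrace_square_zero.
have := tr_left_mul 1; rewrite repr_mx1 mul1mx => ->.
under eq_bigr do rewrite invg1 mulg1 mulgV young_coef1.
rewrite sumr_const => /eqP; rewrite pnatr_eq0 => /eqP n0.
by have /card_gt0P : exists g, g \in 'S_n; [exists 1%g | rewrite n0].
Qed.

Definition ideal_char := cfRepr (submod_repr modU).

Lemma ideal_charE g : ideal_char g = young_gamma^-1 * \sum_h c (h * g^-1 * h^-1)%g.
Proof.
rewrite cfunE inE mulr1n (@mxtrace_submod _ _ _ _ _ _ (young_gamma^-1 *: left_mul)) ?inE //.
- by rewrite -scalemxAr mxtraceZ tr_left_mul.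
- apply: scalemx_sub; apply/row_subP=> i; rewrite rowK.
  by apply: (mxmodule_trans modU); rewrite ?inE ?cyclic_mx_id.
apply/row_matrixP=> i; rewrite row_mul.
have /cyclic_mxP[A /envelop_mxP[a ->] ->] : (row i (cyclic_mx aG y) <= cyclic_mx aG y)%MS.
  exact: row_sub.
rewrite -scalemxAr mulmx_sumr mulmx_suml scaler_sumr; apply: eq_bigr => g' _.
rewrite -!scalemxAr -scalemxAl -mulmxA left_mul_comm mulmxA y_left_mul.
by rewrite -scalemxAl !scalerA mulrAC mulVf ?mul1r // young_gamma_neq0.
Qed.

Lemma sum_ideal_char (f : 'S_n -> algC) : (forall g h, f (g ^ h)%g = f g) ->
  \sum_g ideal_char g * f g = young_gamma^-1 * (#|G|%:R * \sum_g c g * f g^-1%g).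
Proof.
move=> fJ; under eq_bigr do rewrite ideal_charE -mulrA mulr_suml.
rewrite -mulr_sumr exchange_big /=; congr (_ * _).
rewrite (eq_bigr (fun _ => \sum_g c g * f g^-1%g)).
  by rewrite sumr_const -[LHS]mulr_natl; congr (_%:R * _); apply: eq_card => g; rewrite inE.
move=> h _; rewrite (reindex_inj (conjg_inj h)) (reindex_inj invg_inj) /=.
apply: eq_bigr => g _; rewrite fJ; congr (c _ * _).
by rewrite conjVg conjgE !invgK !mulgA mulgV mul1g mulgK.
Qed.

(** The double sum of coefficients equals the square of [young_gamma] and cancels the two
    normalizations. Being a character, [ideal_char] is therefore irreducible. *)
Lemma ideal_char_norm : '[ideal_char] = 1.
Proof.
have chi_char : ideal_char \is a character by apply: cfRepr_char.
rewrite cfdotE; under eq_bigr do rewrite -char_inv //.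
rewrite (eq_bigl predT) => [|g]; last by rewrite inE.
rewrite (sum_ideal_char (f := fun g => ideal_char g^-1%g)) => [|g h]; last first.
  by rewrite -conjVg cfunJ // inE.
under eq_bigr do rewrite invgK ideal_charE mulrCA mulr_sumr.
rewrite -mulr_sumr exchange_big /=.
under eq_bigr do rewrite young_coef_conv2.
rewrite -mulr_sumr -/young_gamma.
have g0 := young_gamma_neq0; have n0 := neq0CG G.
by rewrite mulrCA mulKf // [X in _ * X]mulrA mulVf // mul1r mulVf.
Qed.

Lemma ideal_char_irr (chi : 'CF(G)) : chi \in irr G ->
    \sum_(t in R) chi t != 0 -> \sum_(s in C) (-1) ^+ s * chi s != 0 ->
  ideal_char = chi.
Proof.
move=> irrchi X0 Y0.
have irrI : ideal_char \in irr G by rewrite irrEchar cfRepr_char ideal_char_norm eqxx.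
have /irrP[i ichi] := irrchi; have /irrP[k kchi] := irrI.
suff : '[ideal_char, chi] != 0.
  by rewrite kchi ichi cfdot_irr; case: (k =P i) => [->|]; rewrite ?eqxx.
rewrite cfdotE (eq_bigr (fun g => ideal_char g * chi g^-1%g)) => [|g _]; last first.
  by rewrite char_inv // irrWchar.
rewrite (eq_bigl predT) => [|g]; last by rewrite inE.
rewrite (sum_ideal_char (f := fun g => chi g^-1%g)) => [|g h]; last first.
  by rewrite -conjVg cfunJ // inE.
under eq_bigr do rewrite invgK.
by rewrite !mulf_neq0 ?invr_eq0 ?neq0CG ?young_gamma_neq0 ?young_coef_irr.
Qed.

(* A virtual character of norm 1 is irreducible up to a sign, which is fixed by
   the multiplicity of the trivial character of R. *)
Lemma ideal_char_vchar (f : 'CF(G)) : f \in 'Z[irr G] -> '[f] = 1 ->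
    0 < \sum_(t in R) f t -> \sum_(s in C) (-1) ^+ s * f s != 0 ->
  ideal_char = f.
Proof.
move=> Zf f1 X0 Y0; have [b [i fE]] := vchar_norm1P Zf f1.
have chiX : \sum_(t in R) f t = (-1) ^+ b * \sum_(t in R) 'chi_i t.
  by rewrite mulr_sumr; apply: eq_bigr => t _; rewrite fE cfunE.
have chiY : \sum_(s in C) (-1) ^+ s * f s = (-1) ^+ b * \sum_(s in C) (-1) ^+ s * 'chi_i s.
  by rewrite mulr_sumr; apply: eq_bigr => t _; rewrite fE cfunE mulrCA.
have X1 : 0 <= \sum_(t in R) 'chi_i t.
  have := Cnat_cfdot_char (cfRes_char R (irr_char i)) (cfun1_char R).
  move/natr_ge0; rewrite cfdotE pmulr_rge0 ?invr_gt0 ?gt0CG //.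
  congr (0 <= _); apply: eq_bigr => t Rt.
  by rewrite cfResE ?subsetT // cfun1E Rt conjC1 mulr1.
have b0 : b = false.
  apply/negbTE/negP=> bT; move: X0; rewrite chiX bT expr1 mulN1r oppr_gt0.
  by rewrite le_gtF.
rewrite b0 expr0 scale1r in fE; rewrite fE; apply: ideal_char_irr; rewrite ?mem_irr -?fE //.
by rewrite gt_eqF.
Qed.

End Specht.
End YoungSymmetrizer.

(** * Row and column groups of a tableau *)

Section Tableau.
Variables (n : nat) (la : seq nat).
Hypothesis sum_la : sumn la = n.
Local Notation rw := (reshape_index la).
Local Notation cl := (reshape_offset la).

Lemma lt_sum_la (i : 'I_n) : (i < sumn la)%N.
Proof. by rewrite sum_la. Qed.

Lemma cell_inj (i j : 'I_n) : rw i = rw j -> cl i = cl j -> i = j.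
Proof. by move=> er ec; apply/val_inj; rewrite /= -(reshape_indexK la i) er ec reshape_indexK. Qed.

Lemma cell_exists r c : (c < nth 0 la r)%N -> exists i : 'I_n, rw i = r /\ cl i = c.
Proof.
move=> lt_c; have lt_n : (flatten_index la r c < n)%N by rewrite -sum_la flatten_indexP.
by exists (Ordinal lt_n); rewrite /= flatten_indexKl ?flatten_indexKr.
Qed.

Definition row_of (i : 'I_n) : 'I_(size la) := Ordinal (reshape_indexP (lt_sum_la i)).

Lemma card_row_cells (P : pred nat) r :
  #|[set i : 'I_n | (rw i == r) && P (cl i)]| = count P (iota 0 (nth 0 la r)).
Proof.
have -> : count P (iota 0 (nth 0 la r)) = #|[set c : 'I_(nth 0 la r) | P c]|.
  rewrite cardsE -sum1_card -sum1_count (_ : iota 0 _ = index_iota 0 (nth 0 la r)).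
    by rewrite big_mkord.
  by rewrite /index_iota subn0.
pose f (i : 'I_n) : 'I_(n.+1) := inord (cl i).
have cl_n (i : 'I_n) : (cl i < n.+1)%N by rewrite ltnS (leq_trans (leq_subr _ _)) // ltnW.
have inj_f : {in [set i : 'I_n | (rw i == r) && P (cl i)] &, injective f}.
  move=> i j /[!inE] /andP[/eqP ri _] /andP[/eqP rj _] /(congr1 val); rewrite /= !inordK //.
  by move=> cij; apply: cell_inj; rewrite ?ri ?rj.
have la_n : (nth 0 la r <= n)%N.
  case: (posnP (nth 0 la r)) => [->//|lr]; rewrite -sum_la.
  have := @flatten_indexP la r (nth 0 la r).-1; case: (nth 0 la r) lr => // l _ /(_ (leqnn _)).
  by apply: leq_trans; rewrite ltnS leq_addl.
have inj_g : injective (fun c : 'I_(nth 0 la r) => widen_ord (leqW la_n) c).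
  by move=> a b /(congr1 val) /= ab; apply/val_inj.
rewrite -(card_in_imset inj_f) -(card_imset _ inj_g); apply: eq_card => c.
apply/imsetP/imsetP=> [[i] | [c'] ]; rewrite inE.
  case/andP=> /eqP ri Pi ->; have lt_c : (cl i < nth 0 la r)%N by rewrite -ri reshape_offsetP ?lt_sum_la.
  by exists (Ordinal lt_c); rewrite ?inE //; apply/val_inj; rewrite /= inordK.
move=> Pc ->; have [i [ri ci]] := cell_exists (ltn_ord c').
exists i; first by rewrite inE ri ci eqxx.
by apply/val_inj; rewrite /= inordK // ci.
Qed.

Lemma card_row r : #|[set i : 'I_n | rw i == r]| = nth 0 la r.
Proof.
have := card_row_cells xpredT r; rewrite count_predT size_iota => <-.
by apply: eq_card => i; rewrite !inE andbT.
Qed.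

Lemma count_lt_iota k l : count (fun c => c < k)%N (iota 0 l) = minn l k.
Proof.
elim: l => [|l IHl]; first by rewrite min0n.
by rewrite -addn1 iotaD count_cat IHl /= add0n addn0; lia.
Qed.

Lemma card_row_lt r k : #|[set i : 'I_n | (rw i == r) && (cl i < k)%N]| = minn (nth 0 la r) k.
Proof. by rewrite (card_row_cells (fun c => c < k)%N) count_lt_iota. Qed.

Lemma card_col c :
  #|[set i : 'I_n | cl i == c]| = (\sum_(r < size la) (c < nth 0 la r))%N.
Proof.
rewrite -sum1_card (partition_big row_of predT) //=; apply: eq_bigr => r _.
rewrite -[RHS]/(nat_of_bool _) (_ : (c < nth 0 la r)%N = count (pred1 c) (iota 0 (nth 0 la r)) :> nat).
  rewrite -(card_row_cells (pred1 c)) -sum1_card; apply: eq_bigl => i.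
  by rewrite !inE -val_eqE /= andbC.
by rewrite count_uniq_mem ?iota_uniq // mem_iota.
Qed.

Lemma row_groupP (s : 'S_n) : reflect (forall i : 'I_n, rw (s i) = rw i) (s \in row_group n la).
Proof. by rewrite inE; apply: (iffP forallP) => h i; apply/eqP. Qed.

Lemma col_groupP (s : 'S_n) : reflect (forall i : 'I_n, cl (s i) = cl i) (s \in col_group n la).
Proof. by rewrite inE; apply: (iffP forallP) => h i; apply/eqP. Qed.

Lemma row_group_set : group_set (row_group n la).
Proof.
apply/group_setP; split=> [|s t /row_groupP sR /row_groupP tR].
  by apply/row_groupP=> i; rewrite perm1.
by apply/row_groupP=> i; rewrite permM tR sR.
Qed.

Lemma col_group_set : group_set (col_group n la).
Proof.
apply/group_setP; split=> [|s t /col_groupP sR /col_groupP tR].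
  by apply/col_groupP=> i; rewrite perm1.
by apply/col_groupP=> i; rewrite permM tR sR.
Qed.

Canonical row_group_group := Group row_group_set.
Canonical col_group_group := Group col_group_set.

Lemma col_row_trivial : col_group n la :&: row_group n la = 1%g.
Proof.
apply/setP=> s; rewrite in_setI [RHS]inE; apply/andP/eqP=> [[/col_groupP sC /row_groupP sR]|->].
  by apply/permP=> i; rewrite perm1; apply: cell_inj.
by rewrite !group1.
Qed.

(** If [g] never sends two points of one column to the same row, the column factor moves each [x]
    inside its column to row [rw (g x)]. That this cell belongs to the shape is obtained by
    counting. *)
Lemma vonNeumann_dichotomy (g : 'S_n) : (g \in (col_group n la * row_group n la)%g) \/
  exists x y, [/\ x != y, tperm x y \in col_group n la & (tperm x y ^ g)%g \in row_group n la].
Proof.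
have [/existsP[x /existsP[y /and3P[xy /eqP cxy /eqP rxy]]] | none] :=
  boolP [exists x : 'I_n, exists y : 'I_n, [&& x != y, cl x == cl y & rw (g x) == rw (g y)]].
  right; exists x, y; split=> //.
    by apply/col_groupP=> i; case: tpermP => [->|->|].
  by rewrite tpermJ; apply/row_groupP=> i; case: tpermP => [->|->|].
left; have sep (x y : 'I_n) : cl x = cl y -> rw (g x) = rw (g y) -> x = y.
  move=> cxy rxy; apply/eqP; apply: contraNT none => xy.
  by apply/existsP; exists x; apply/existsP; exists y; rewrite xy cxy rxy !eqxx.
(* These are the points of the first k columns that land in row r. Separation allows one per column
   and the row has [nth 0 la r] cells; the sum over r attains the resulting bound, so each term
   does. *)
pose a k (r : 'I_(size la)) := #|[set x : 'I_n | (rw (g x) == r) && (cl x < k)%N]|.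
have a_le k r : (a k r <= minn (nth 0 la r) k)%N.
  rewrite leq_min; apply/andP; split.
    rewrite -card_row -(card_preimset [set i : 'I_n | rw i == r] (@perm_inj _ g)).
    by apply/subset_leq_card/subsetP=> x; rewrite !inE => /andP[].
  have [k0|k0] := posnP k.
    by rewrite k0 /a eq_card0 // => x; rewrite !inE ltn0 andbF.
  pose f (x : 'I_n) : 'I_k := insubd (Ordinal k0) (cl x).
  rewrite /a -(@card_in_imset _ _ f) => [|x y].
    by rewrite -[X in (_ <= X)%N]card_ord max_card.
  rewrite !inE => /andP[/eqP rx cx] /andP[/eqP ry cy] /(congr1 val).
  by rewrite !val_insubd cx cy => cxy; apply: sep; rewrite ?rx ?ry.
have sum_a k : (\sum_r a k r = \sum_(r < size la) minn (nth 0 la r) k)%N.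
  transitivity #|[set x : 'I_n | (cl x < k)%N]|.
    rewrite -sum1_card (partition_big (fun x => row_of (g x)) predT) //=.
    apply: eq_bigr => r _; rewrite /a -sum1_card; apply: eq_bigl => x.
    by rewrite !inE andbC -val_eqE.
  rewrite -sum1_card (partition_big row_of predT) //=.
  apply: eq_bigr => r _; rewrite -card_row_lt -sum1_card; apply: eq_bigl => x.
  by rewrite !inE andbC -val_eqE.
have a_eq k r : a k r = minn (nth 0 la r) k.
  have := @leqif_sum _ xpredT (fun r => a k r == minn (nth 0 la r) k) (a k)
    (fun r : 'I_(size la) => minn (nth 0 la r) k) (fun r _ => leqif_eq (a_le k r)).
  case=> _; rewrite sum_a eqxx => /esym/forallP/(_ r) /=.
  by move/eqP.
(* With k the length of row r, equality says that all points landing in row r come from the first k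
   columns. *)
have lt_cl (x : 'I_n) : (cl x < nth 0 la (rw (g x)))%N.
  set r := row_of (g x); have /eqP := a_eq (nth 0 la r) r.
  rewrite minnn -{2}card_row -(card_preimset [set i : 'I_n | rw i == r] (@perm_inj _ g)).
  rewrite /a => /eqP eq_card; have sub : [set x | (rw (g x) == r) && (cl x < nth 0 la r)%N]
      \subset g @^-1: [set i : 'I_n | rw i == r].
    by apply/subsetP=> z; rewrite !inE => /andP[].
  have /eqP/setP/(_ x) : [set x | (rw (g x) == r) && (cl x < nth 0 la r)%N]
      == g @^-1: [set i : 'I_n | rw i == r] by rewrite eqEcard sub eq_card leqnn.
  by rewrite !inE eqxx /= => ->.
have ex_f (x : 'I_n) : exists i : 'I_n, (rw i == rw (g x)) && (cl i == cl x).
  by have [i [ri ci]] := cell_exists (lt_cl x); exists i; rewrite ri ci !eqxx.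
pose s0 (x : 'I_n) := xchoose (ex_f x).
have s0P x : rw (s0 x) = rw (g x) /\ cl (s0 x) = cl x.
  by have /andP[/eqP ? /eqP ?] := xchooseP (ex_f x).
have inj_s : injective s0.
  move=> x y xy; have [rx cx] := s0P x; have [ry cy] := s0P y.
  by apply: sep; rewrite -?cx -?cy -?rx -?ry xy.
apply/mulsgP; exists (perm inj_s) ((perm inj_s)^-1 * g)%g; last by rewrite mulKVg.
  by apply/col_groupP=> x; rewrite permE; case: (s0P x).
apply/row_groupP=> x; rewrite permM -[in RHS](permKV (perm inj_s) x) permE.
by have [-> _] := s0P ((perm inj_s)^-1%g x).
Qed.

Lemma young_symmetrizerE i : young_symmetrizer n la 0 i =
  young_coef [group of col_group n la] [group of row_group n la] (enum_val i).
Proof.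
rewrite /young_symmetrizer mulmx_suml linear_sum summxE /young_coef.
apply: eq_bigr => s Cs; rewrite -scalemxAl linearZ mxE /=; congr (_ * _).
rewrite mulmx_sumr linear_sum summxE.
under eq_bigr => t _ do rewrite -repr_mxM ?inE //.
have E t : (gring_row (regular_repr algC [set: 'S_n]%G (s * t)%g)) 0 i = (enum_val i == (s * t)%g)%:R.
  rewrite !mxE eqxx /= gring_indexK ?group1 // mul1g.
  by rewrite -(can_eq gring_valK) gring_indexK ?inE.
under eq_bigr => t _ do rewrite E.
case: (boolP (s^-1 * enum_val i \in row_group n la)%g) => [Rt|nR].
  rewrite (bigD1 _ Rt) /= mulKVg eqxx big1 ?addr0 // => t /andP[_ tn].
  by case: eqP => // eqi; rewrite eqi mulKg eqxx in tn.
rewrite big1 // => t Rt; case: eqP => // eqi.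
by rewrite eqi mulKg Rt in nR.
Qed.

Lemma specht_eq_vchar (f : 'CF([set: 'S_n])) : f \in 'Z[irr [set: 'S_n]] -> '[f] = 1 ->
    0 < \sum_(t in row_group n la) f t ->
    \sum_(s in col_group n la) (-1) ^+ s * f s != 0 ->
  specht n la = f.
Proof.
move=> Zf f1 X0 Y0.
exact: (ideal_char_vchar col_row_trivial vonNeumann_dichotomy young_symmetrizerE Zf f1 X0 Y0).
Qed.

End Tableau.

(** * Coefficient extraction *)

(* For b > 0, the coefficient of x^a y^(b-1) in f(x, y) / (1 + y), where x is
   the outer variable and y the inner one. *)
Definition alt_coef a b (f : {poly {poly algC}}) : algC :=
  \sum_(k < b) (-1) ^+ (b - k).-1 * f`_a`_k.

Local Notation x := ('X : {poly {poly algC}}).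
Local Notation y := ('X%:P : {poly {poly algC}}).

Section AltCoef.
Implicit Types f g h : {poly {poly algC}}.

Lemma alt_coefS a b f : alt_coef a b.+1 f = f`_a`_b - alt_coef a b f.
Proof.
rewrite /alt_coef big_ord_recr /= subSnn expr0 mul1r addrC; congr (_ + _).
rewrite -sumrN; apply: eq_bigr => k _; rewrite subSn ?(ltnW (ltn_ord k)) //=.
by rewrite -mulNr; congr (_ * _); have := ltn_ord k; rewrite -subn_gt0; case: (b - k)%N => // c _; rewrite exprS mulN1r.
Qed.

Lemma alt_coefD a b f g : alt_coef a b (f + g) = alt_coef a b f + alt_coef a b g.
Proof. by rewrite /alt_coef -big_split; apply: eq_bigr => k _; rewrite !coefD mulrDr. Qed.

Lemma alt_coef_eq0 a b f : f`_a = 0 -> alt_coef a b f = 0.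
Proof. by move=> f0; rewrite /alt_coef big1 // => k _; rewrite f0 coef0 mulr0. Qed.

Lemma alt_coef1y a b f : alt_coef a b.+1 ((1 + y) * f) = f`_a`_b.
Proof.
have E k : ((1 + y) * f)`_a`_k = f`_a`_k + (if k is k'.+1 then f`_a`_k' else 0).
  by rewrite mulrDl mul1r coefD coefCM coefD coefXM; case: k.
elim: b => [|b IHb]; first by rewrite alt_coefS E [alt_coef a 0 _]big_ord0 subr0 addr0.
by rewrite alt_coefS IHb E addrK.
Qed.

(** The complete homogeneous symmetric polynomial of degree N in x and y. *)
Definition hsym N : {poly {poly algC}} := \poly_(u < N.+1) 'X^(N - u).

Lemma coef_hsym N u v : (hsym N)`_u`_v = (u + v == N)%N%:R.
Proof.
rewrite coef_poly; case: ltnP => uN; first by rewrite coefXn; congr ((_ : bool)%:R); lia.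
by rewrite coef0; case: eqP => //; lia.
Qed.

Lemma coef_hsymM a b u v : (hsym a * hsym b)`_u`_v =
  if (u + v == a + b)%N then (\sum_(s < u.+1) ((s <= a) && (u - s <= b)))%N%:R else 0.
Proof.
rewrite coefM coef_sum; transitivity
  (\sum_(s < u.+1) ((u + v == a + b)%N && ((s <= a)%N && (u - s <= b)%N))%:R : algC).
  apply: eq_bigr => s _; have su := ltn_ord s; rewrite ltnS in su.
  rewrite !coef_poly !ltnS; case: (leqP s a) => sa; last by rewrite mul0r coef0 andbF.
  case: (leqP (u - s) b) => ub; last by rewrite mulr0 coef0 !andbF.
  by rewrite -exprD coefXn andbT; congr ((_ : bool)%:R); lia.
case: eqP => _; last by rewrite big1.
by rewrite natr_sum.
Qed.

Lemma sum_hsym_support a b u :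
  (\sum_(s < u.+1) ((s <= a) && (u - s <= b)) = (minn a u).+1 - (u - b))%N.
Proof.
rewrite -(big_mkord xpredT (fun s => ((s <= a) && (u - s <= b))%N : nat)).
rewrite -[RHS]muln1 -sum_nat_const_nat.
rewrite [RHS](big_nat_widen _ _ u.+1) ?ltnS ?geq_minr // [RHS](big_nat_widenl _ 0) // [RHS]big_mkcond.
by apply: eq_big_nat => s su; case: ifP; lia.
Qed.

Definition order_ge t f := forall u v, (u + v < t)%N -> f`_u`_v = 0.

Lemma order_hsym N : order_ge N (hsym N).
Proof. by move=> u v uvN; rewrite coef_hsym; case: eqP => //; lia. Qed.

Lemma order_ge_coefM t f g a b : order_ge t f -> (a + b <= t)%N ->
  (f * g)`_a`_b = if (a + b == t)%N then f`_a`_b * g`_0`_0 else 0.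
Proof.
move=> ft abt; rewrite coefM coef_sum.
have z u v : (u <= a)%N -> (v <= b)%N -> (u + v < a + b)%N -> f`_u`_v = 0.
  by move=> ua vb uv; apply: ft; lia.
rewrite big_ord_recr /= big1 ?add0r => [|u _]; last first.
  have ua := ltn_ord u; rewrite coefM big1 // => v _.
  by have vb := ltn_ord v; rewrite z ?mul0r //; lia.
rewrite subnn coefM big_ord_recr /= big1 ?add0r ?subnn => [|v _]; last first.
  by have vb := ltn_ord v; rewrite z ?mul0r //; lia.
by case: eqP => // abt2; rewrite ft ?mul0r //; lia.
Qed.

Lemma order_geM t t' f g : order_ge t f -> order_ge t' g -> order_ge (t + t') (f * g).
Proof.
move=> ft gt u v uv; rewrite coefM coef_sum big1 // => s _.
have su := ltn_ord s; rewrite coefM big1 // => r _; have rv := ltn_ord r.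
case: (ltnP (s + r) t) => sr; first by rewrite ft // mul0r.
by rewrite gt ?mulr0 //; lia.
Qed.

(** The block polynomial of a sign block of N points: the two disjoint sets cover all of it (h_N) or
    all but one point (h_(N-1)). *)
Definition bsym N : {poly {poly algC}} := hsym N + (if N is N'.+1 then hsym N' else 0).

(** Makes the division by 1 + y explicit, up to a power of x too high to affect the coefficients
    extracted later. *)
Lemma bsymS N : bsym N.+1 = x ^+ N.+1 + (1 + y) * hsym N.
Proof.
apply/polyP=> u; apply/polyP=> v.
have -> : (x ^+ N.+1 + (1 + y) * hsym N)`_u`_v = ((u == N.+1) && (v == 0%N))%:R +
    ((hsym N)`_u`_v + (if v is v'.+1 then (hsym N)`_u`_v' else 0)).
  rewrite !coefD coefXn mulrDl mul1r !coefD coefCM coefXM; congr (_ + _); last by case: v.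
  by case: (u == _); rewrite ?coef1 ?coef0.
rewrite /bsym !coefD; case: v => [|v]; rewrite !coef_hsym ?andbT ?andbF ?addn0.
  by rewrite addr0.
by rewrite add0r addnS eqSS addrC.
Qed.

Lemma coef_bsymM a b u v : (a + b <= u + v)%N ->
  (bsym a * bsym b)`_u`_v = (hsym a * hsym b)`_u`_v.
Proof.
move=> ab; rewrite /bsym mulrDl !mulrDr !coefD; case: a b ab => [|a] [|b] ab;
  rewrite ?(mulr0, mul0r, coef0, addr0) // !coef_hsymM.
- by rewrite [X in _ + X]ifF ?addr0 //; lia.
- by rewrite [X in _ + X]ifF ?addr0 //; lia.
by rewrite [X in _ + X + _]ifF ?[X in _ + (X + _)]ifF ?[X in _ + (_ + X)]ifF ?addr0 //; lia.
Qed.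

Definition symmetric_poly f := forall u v, f`_u`_v = f`_v`_u.

Lemma symmetric_polyE f : symmetric_poly f <-> swapXY f = f.
Proof.
split=> [fS | f_swap u v]; last by rewrite -[in LHS]f_swap coef_swapXY.
by apply/polyP=> u; apply/polyP=> v; rewrite coef_swapXY fS.
Qed.

Lemma symmetric_polyM f g : symmetric_poly f -> symmetric_poly g -> symmetric_poly (f * g).
Proof.
by move=> /symmetric_polyE fS /symmetric_polyE gS; apply/symmetric_polyE; rewrite rmorphM /= fS gS.
Qed.

Lemma symmetric_polyX f n : symmetric_poly f -> symmetric_poly (f ^+ n).
Proof.
by move=> /symmetric_polyE fS; apply/symmetric_polyE; rewrite rmorphXn /= fS.
Qed.

Lemma symmetric_bsym N : symmetric_poly (bsym N).
Proof.
by move=> u v; rewrite /bsym !coefD; case: N => [|N]; rewrite ?coef0 !coef_hsym addnC.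
Qed.

(** Dividing by 1 + y leaves (1 + x) G; of its four coefficients two cancel by symmetry. *)
Lemma alt_coef_symmetric G j q : symmetric_poly G ->
  alt_coef j.+1 q.+1 ((1 + y) * ((1 + x) * G)) - alt_coef q.+1 j.+1 ((1 + y) * ((1 + x) * G))
    = G`_j.+1`_q - G`_q.+1`_j.
Proof.
move=> GS; rewrite !alt_coef1y !mulrDl !mul1r !coefD !coefXM /=.
by rewrite (GS j q) opprD addrACA subrr addr0.
Qed.

Lemma alt_coef0 q (F : {poly {poly algC}}) (h : {poly algC}) : (0 < q)%N -> F`_0 = (1 + 'X) * h ->
  alt_coef 0 q F - alt_coef q 0 F = h`_q.-1.
Proof.
case: q => // q _ F0; rewrite [alt_coef _ 0 _]big_ord0 subr0 /=.
transitivity (alt_coef 0 q.+1 ((1 + y) * h%:P)); last by rewrite alt_coef1y coefC.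
rewrite /alt_coef; apply: eq_bigr => k _.
by rewrite F0 -(rmorph1 polyC) -rmorphD -rmorphM coefC.
Qed.

Lemma coef_1DX n k : ((1 + 'X : {poly algC}) ^+ n)`_k = 'C(n, k)%:R.
Proof.
rewrite addrC exprD1n coef_sum.
under eq_bigr do rewrite coefMn coefXn.
case: (leqP k n) => kn; last first.
  rewrite bin_small // big1 // => i _; have ilt := ltn_ord i.
  by rewrite (_ : (k == i)%N = false) ?mul0rn //; apply/eqP; lia.
rewrite (bigD1 (inord k)) //= inordK ?ltnS // eqxx big1 ?addr0 // => i /negPf ik.
rewrite (_ : (k == i)%N = false) ?mul0rn //; apply: contraFF ik => /eqP ki.
by apply/eqP/val_inj; rewrite /= inordK.
Qed.

(** The row pairing in t-degree j + 1: each of the j + 2 rows of length at least 2 gives (1 + y)(1 +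
    x), each of the r rows of length 1 gives 1 + x + y. *)
Lemma alt_coef_rows j r (q := (j.+1 + r)%N) :
  let F := ((1 + y) * (1 + x)) ^+ j.+2 * (1 + x + y) ^+ r in
  alt_coef j.+1 q.+1 F - alt_coef q.+1 j.+1 F = 1.
Proof.
set G := ((1 + y) * (1 + x)) ^+ j.+1 * (1 + x + y) ^+ r.
have GS : symmetric_poly G.
  apply: symmetric_polyM; apply: symmetric_polyX; apply/symmetric_polyE.
    by rewrite rmorphM !rmorphD rmorph1 /= swapXY_X swapXY_Y mulrC.
  by rewrite !rmorphD rmorph1 /= swapXY_X swapXY_Y addrAC.
have -> : ((1 + y) * (1 + x)) ^+ j.+2 * (1 + x + y) ^+ r = (1 + y) * ((1 + x) * G).
  by rewrite exprS -!mulrA.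
rewrite /= alt_coef_symmetric // (GS j.+1).
(* After the exchange of indices, [P] is the factor of [G] that is monic of degree q in the outer
   variable: coefficient q.+1 vanishes and coefficient q is (1 + y)^(j+1). *)
pose P : {poly {poly algC}} := ('X - (- 1)%:P) ^+ j.+1 * ('X - (- (1 + 'X))%:P) ^+ r.
have mP : P \is monic by rewrite monicMl ?monic_exp ?monicXsubC.
have sP : size P = q.+1.
  rewrite /P size_monicM ?monic_exp ?monicXsubC //; last first.
    by rewrite -size_poly_eq0 size_exp_XsubC.
  by rewrite !size_exp_XsubC addnS /= /q !addSn.
have -> : G = ((1 + 'X) ^+ j.+1)%:P * P.
  rewrite /G /P exprMn !rmorphN !opprK rmorphXn !rmorphD !rmorph1 -mulrA; congr (_ * (_ * _)).
    by rewrite addrC.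
  by rewrite [in RHS]addrCA addrA.
rewrite !coefCM [P`_q.+1]nth_default ?sP // mulr0 coef0 subr0.
have -> : P`_q = 1 by have /monicP := mP; rewrite lead_coefE sP.
by rewrite mulr1 coef_1DX binn.
Qed.

(** The column pairing in t-degree j + 1: the first two columns have heights q + 1 and j + 2, and
    the k others have height 1, hence block polynomial 1 + x + y. *)
Lemma alt_coef_cols j q k : (j.+1 <= q)%N ->
  let F := bsym q.+1 * bsym j.+2 * (1 + x + y) ^+ k in
  alt_coef j.+1 q.+1 F - alt_coef q.+1 j.+1 F = 1.
Proof.
move=> jq /=; set Z := (1 + x + y) ^+ k.
have Z0 : Z`_0`_0 = 1.
  have -> : Z`_0 = (1 + 'X) ^+ k.
    by rewrite -horner_coef0 horner_exp !hornerE.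
  by rewrite coef_1DX bin0.
(* By [bsymS] the factor 1 + y comes out up to a multiple of x^(q+j+3), out of reach of the
   extracted coefficients. *)
have FE : bsym q.+1 * bsym j.+2 * Z =
    (1 + y) * ((1 + y) * (hsym q * hsym j.+1 * Z) + x ^+ j.+2 * hsym q * Z + x ^+ q.+1 * hsym j.+1 * Z)
    + x ^+ (q.+1 + j.+2) * Z.
  by rewrite !bsymS exprD; ring.
have coefXnM2 n f a b : (x ^+ n * f)`_a`_b = if (a < n)%N then 0 else f`_(a - n)`_b.
  by rewrite coefXnM; case: ifP => //; rewrite coef0.
rewrite FE !alt_coefD !alt_coef1y !coefD.
rewrite ![alt_coef _ _ (x ^+ _ * _)]alt_coef_eq0 ?addr0; last 2 first.
- by rewrite coefXnM ifT //; lia.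
- by rewrite coefXnM ifT //; lia.
rewrite -!(mulrA (x ^+ _)) !coefXnM2.
have oH : order_ge (q + j.+1) (hsym q * hsym j.+1) by apply/order_geM; apply: order_hsym.
rewrite (ifT _ _ (_ : (j.+1 < j.+2)%N)) ?(ifT _ _ (_ : (j.+1 < q.+1)%N)) //.
rewrite ltnn subnn !ifF; last by lia.
(* The product of the two [hsym] is homogeneous of degree q + j + 1, so in this total degree the
   other factors contribute only their constant terms. *)
have main u v : (u + v = q + j.+1)%N ->
    ((1 + y) * (hsym q * hsym j.+1 * Z))`_u`_v =
    (\sum_(s < u.+1) ((s <= q) && (u - s <= j.+1)))%N%:R.
  move=> uv; rewrite mulrCA (order_ge_coefM _ oH) ?uv // eqxx coef_hsymM uv eqxx.
  by rewrite mulrDl mul1r coefD coefCM coefD coefXM Z0 /= addr0 mulr1.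
rewrite !main; try lia.
rewrite (order_ge_coefM _ (@order_hsym q)); last by lia.
rewrite ifF; last by lia.
rewrite (order_ge_coefM _ (@order_hsym j.+1)); last by lia.
rewrite ifF; last by lia.
rewrite !addr0 !sum_hsym_support (minn_idPr jq) (minn_idPl (leqnSn q)).
have -> : (j.+2 - (j.+1 - j.+1) = (q.+1 - (q.+1 - j.+1)).+1)%N by lia.
by rewrite -addn1 natrD addrAC subrr add0r.
Qed.

(** The extracted total degree j + 1 + q is at least a + b. There the two [bsym] multiply like the
    homogeneous h_a h_b, so nothing is left unless a + b equals this degree. *)
Lemma alt_coef_blocks j q a b : (j.+1 <= q)%N -> (a + b <= j.+1 + q)%N ->
  let F := (1 + y) * ((1 + x) * (bsym a * bsym b)) in
  alt_coef j.+1 q.+1 F - alt_coef q.+1 j.+1 F =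
    if (a + b == j.+1 + q)%N then
      ((minn a j.+1).+1 - (j.+1 - b))%N%:R - ((minn a q.+1).+1 - (q.+1 - b))%N%:R else 0.
Proof.
move=> jq ab /=; rewrite alt_coef_symmetric; last by apply: symmetric_polyM; apply: symmetric_bsym.
have qj : (q.+1 + j = j.+1 + q)%N by lia.
rewrite !coef_bsymM ?qj // !coef_hsymM !sum_hsym_support qj [_ == (a + b)%N]eq_sym.
by case: ifP; rewrite ?subr0.
Qed.

Lemma alt_coef_blocks1 j q k : (j.+1 <= q)%N -> (k <= q)%N ->
  let F := (1 + y) * ((1 + x) * (bsym j.+1 * bsym k)) in
  alt_coef j.+1 q.+1 F - alt_coef q.+1 j.+1 F = (k == q)%:R.
Proof.
move=> jq kq F; rewrite alt_coef_blocks ?leq_add2l // eqn_add2l; case: eqP => // ->.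
rewrite minnn (minn_idPl _) ?ltnS ?(ltnW jq) //.
have -> : (j.+2 - (j.+1 - q) = (j.+2 - (q.+1 - q)).+1)%N by lia.
by rewrite -addn1 natrD addrAC subrr add0r.
Qed.

Lemma alt_coef_blocks2 j q i : (j.+1 <= q)%N -> (i <= j)%N ->
  let F := (1 + y) * ((1 + x) * (bsym q.+1 * bsym i)) in
  alt_coef j.+1 q.+1 F - alt_coef q.+1 j.+1 F = 0.
Proof.
move=> jq ij F; rewrite alt_coef_blocks; last by lia.
  case: eqP => // qi; rewrite minnn (minn_idPr _) ?ltnS ?(ltnW jq) //.
  by apply/eqP; rewrite subr_eq0 eqr_nat; apply/eqP; lia.
by [].
Qed.

End AltCoef.

(** * Pairings of theta *)

(** A nonempty trivial block meets each of the two disjoint sets in at most one point; a single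
    point cannot serve both, so xy is missing for N = 1. *)
Definition row_poly N : {poly {poly algC}} :=
  if (N == 1)%N then 1 + x + y else (1 + y) * (1 + x).

Lemma coef_row_poly N u v : (row_poly N)`_u`_v =
  [&& (u <= 1)%N, (v <= 1)%N & ((u + v <= 1) || (N != 1))%N]%:R.
Proof.
rewrite /row_poly; case: ifP => _.
  rewrite !coefD !coefX !coefC ?coef1.
  by case: u => [|[|u]]; case: v => [|[|v]];
    rewrite /= ?coef0 ?coef1 ?coefX ?coefC ?addr0 ?add0r.
rewrite mulrDl mul1r mulrDr mulr1 !coefD coefCM !coefX !coefC ?coef1.
by case: u => [|[|u]]; case: v => [|[|v]];
  rewrite /= ?mulr1n ?mulr0n ?mulr1 ?mulr0 ?coef0 ?coef1 ?coefX ?coefC ?addr0 ?add0r.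
Qed.

Section Blocks.
Variables (n : nat) (I : finType) (kappa : 'I_n -> I) (eps : pred I).
Local Notation K i := (kappa @^-1: [set i]).

Lemma coef_block_poly i u v : (block_poly kappa eps i)`_u`_v = (block_cond kappa eps i u v)%:R.
Proof.
have leK : (#|K i| <= n)%N by rewrite -[X in (_ <= X)%N](card_ord n) max_card.
rewrite coef_poly; case: ltnP => un; last first.
  by rewrite coef0 /block_cond (_ : (u + v <= #|K i|)%N = false) //; lia.
rewrite coef_poly; case: ltnP => vn //.
by rewrite /block_cond (_ : (u + v <= #|K i|)%N = false) //; lia.
Qed.

Lemma block_poly_row i : ~~ eps i -> (0 < #|K i|)%N -> block_poly kappa eps i = row_poly #|K i|.
Proof.
move=> /negPf e0 K0; apply/polyP=> u; apply/polyP=> v.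
rewrite coef_block_poly coef_row_poly /block_cond e0; congr ((_ : bool)%:R); lia.
Qed.

Lemma block_poly_col i : eps i -> block_poly kappa eps i = bsym #|K i|.
Proof.
move=> e1; apply/polyP=> u; apply/polyP=> v.
rewrite coef_block_poly /block_cond e1 /bsym !coefD coef_hsym.
case: #|K i| => [|N]; first by rewrite !coef0 addr0; congr ((_ : bool)%:R); lia.
rewrite coef_hsym -natrD; congr (_%:R).
by case: (eqVneq (u + v) N.+1)%N => h1; case: (eqVneq (u + v) N)%N => h2; lia.
Qed.

Lemma sum_young_theta d j (F := \prod_i block_poly kappa eps i) :
  \sum_(s in young_group kappa) young_sign kappa eps s * theta setT d j s =
  #|young_group kappa|%:R * (alt_coef j (d - j) F - alt_coef (d - j) j F).
Proof.
under eq_bigr do rewrite mulrBr !mulr_sumr.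
rewrite sumrB mulrBr; congr (_ - _); rewrite exchange_big /alt_coef mulr_sumr;
  apply: eq_bigr => k _; rewrite mulrCA -young_average mulr_sumr;
  by apply: eq_bigr => s _; rewrite mulrCA.
Qed.

End Blocks.

Section Norm.
Variable n : nat.
Implicit Types A B : {set 'I_n}.

Definition pair_block A B (z : 'I_n) : 'I_3 :=
  if z \in A then inord 0 else if z \in B then inord 1 else inord 2.

Lemma pair_blockP A B z : [disjoint A & B] -> [/\ (pair_block A B z == inord 0) = (z \in A),
  (pair_block A B z == inord 1) = (z \in B) &
  (pair_block A B z == inord 2) = (z \notin A :|: B)].
Proof.
move=> dAB; rewrite /pair_block inE -!val_eqE; case Az: (z \in A).
  by rewrite (disjointFr dAB Az) /= !inordK.
by case: (z \in B); rewrite /= !inordK.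
Qed.

(** The stabilizer of the pair is the Young subgroup with blocks [A], [B] and the rest, and the
    weight is its character with sign type on the first two blocks. *)
Lemma sum_pair_theta A B d j (F := row_poly (n - #|A| - #|B|)%N * (bsym #|A| * bsym #|B|)) :
    [disjoint A & B] -> (#|A| + #|B| < n)%N ->
  \sum_(s : 'S_n | stable s A && stable s B) sgn_on A s * sgn_on B s * theta setT d j s =
  #|[set s : 'S_n | stable s A && stable s B]|%:R *
    (alt_coef j (d - j) F - alt_coef (d - j) j F).
Proof.
move=> dAB ABn; pose kappa := pair_block A B; pose eps := [pred i : 'I_3 | (i < 2)%N].
have G_E : young_group kappa = [set s : 'S_n | stable s A && stable s B].
  apply/setP=> s; rewrite [RHS]inE; apply/young_groupP/andP => [ks | [/stableP sA /stableP sB] z].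
    split; apply/stableP=> z; have [a b _] := pair_blockP z dAB; have [a' b' _] := pair_blockP (s z) dAB.
      by rewrite -a -a' [pair_block A B _]ks.
    by rewrite -b -b' [pair_block A B _]ks.
  by rewrite /kappa /pair_block sA sB.
have KA : kappa @^-1: [set inord 0] = A.
  by apply/setP=> z; rewrite !inE; have [-> _ _] := pair_blockP z dAB.
have KB : kappa @^-1: [set inord 1] = B.
  by apply/setP=> z; rewrite !inE; have [_ -> _] := pair_blockP z dAB.
have KC : kappa @^-1: [set inord 2] = ~: (A :|: B).
  by apply/setP=> z; rewrite [LHS]inE inE [RHS]inE; have [_ _ ->] := pair_blockP z dAB.
have big3 (R : comPzRingType) (f : 'I_3 -> R) : \prod_i f i = f (inord 0) * f (inord 1) * f (inord 2).
  rewrite !big_ord_recl big_ord0 mulr1 mulrA; congr (f _ * f _ * f _);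
    by apply/val_inj; rewrite /= ?inordK.
have sgnE s : young_sign kappa eps s = sgn_on A s * sgn_on B s.
  by rewrite /young_sign big_mkcond big3 /= !inordK //= mulr1 KA KB.
have cC : #|~: (A :|: B)| = (n - #|A| - #|B|)%N.
  rewrite cardsCs setCK card_ord cardsU (disjoint_setI0 dAB) cards0; lia.
have FE : \prod_i block_poly kappa eps i = F.
  rewrite big3 (@block_poly_col n _ kappa eps (inord 0)) ?(@block_poly_col n _ kappa eps (inord 1))
    ?(@block_poly_row n _ kappa eps (inord 2)) /= ?inordK // ?KA ?KB ?KC ?cC //; last by lia.
  by rewrite mulrC.
have := sum_young_theta kappa eps d j; rewrite FE G_E => <-.
by apply: eq_big => s; rewrite ?inE // => _; rewrite sgnE.
Qed.

(** Frobenius reciprocity: all pairs of sizes a and b contribute the same Young average, and orbit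
    counting adds up the orders of their stabilizers to n!. *)
Lemma sum_lam2_theta a b d j (F := row_poly (n - a - b)%N * (bsym a * bsym b)) : (a + b < n)%N ->
  \sum_(s : 'S_n) lam2 setT a b s * theta setT d j s =
  (n`!)%:R * (alt_coef j (d - j) F - alt_coef (d - j) j F).
Proof.
move=> abn; under eq_bigr do rewrite lam2_pairs mulr_suml.
pose D (P : {set 'I_n} * {set 'I_n}) := [&& [disjoint P.1 & P.2], #|P.1| == a & #|P.2| == b].
rewrite (exchange_big_dep D) /=; last by move=> s P _ /and5P[*]; apply/and3P.
transitivity (\sum_(P | D P) #|[set s : 'S_n | stable s P.1 && stable s P.2]|%:R *
    (alt_coef j (d - j) F - alt_coef (d - j) j F)).
  apply: eq_bigr => -[A B] /and3P[/= dAB /eqP cA /eqP cB].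
  have := @sum_pair_theta A B d j dAB; rewrite cA cB => <- //.
  by apply: eq_bigl => s; rewrite dAB !eqxx.
rewrite -mulr_suml -natr_sum; congr (_%:R * _).
have [A _ cA] : exists2 A : {set 'I_n}, A \subset setT & #|A| = a.
  by apply: subset_of_card; rewrite cardsT card_ord; lia.
have [B sBA cB] : exists2 B : {set 'I_n}, B \subset ~: A & #|B| = b.
  by apply: subset_of_card; rewrite cardsCs setCK card_ord cA; lia.
have dAB : [disjoint A & B] by rewrite disjoint_sym disjoints_subset.
(* With one colour the Young subgroup is the whole symmetric group, so the pairs of sizes a and b
   form one orbit. *)
have := @card_young_orbit n _ (fun _ : 'I_n => tt) A B dAB.
have -> : young_group (fun _ : 'I_n => tt) = setT.
  by apply/setP=> s; rewrite [RHS]inE; apply/young_groupP.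
rewrite cardsT card_Sn => <-; apply: eq_big => -[A1 B1] /=; last first.
  move=> _; apply: eq_card => s; rewrite inE in_young_stab; apply/esym/andb_idl => _.
  exact/young_groupP.
rewrite /D; congr (_ && _).
have KT i : (fun _ : 'I_n => tt) @^-1: [set i] = setT by apply/setP=> z; case: i; rewrite !inE.
apply/andP/eqP=> [[/eqP a1 /eqP b1]|/ffunP/(_ tt)].
  by apply/ffunP=> i; rewrite !ffunE !KT !setIT a1 b1 cA cB.
rewrite !ffunE !KT !setIT cA cB => -[/(congr1 val) + /(congr1 val)].
have le_n (X : {set 'I_n}) : (#|X| < n.+1)%N by rewrite ltnS -[X in (_ <= X)%N](card_ord n) max_card.
by rewrite /= !inordK ?le_n // -1?cA -1?cB ?le_n // => -> ->.
Qed.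

End Norm.

Lemma theta_conj (T : finType) (E : {set T}) d j s : (theta E d j s)^* = theta E d j s.
Proof.
have sgnC A : (sgn_on A s)^* = sgn_on A s by rewrite /sgn_on rmorph_sign.
have lamC X k : (lam X k s)^* = lam X k s.
  by rewrite /lam rmorph_sum; apply: eq_bigr => A _; apply: sgnC.
have lam2C a b : (lam2 E a b s)^* = lam2 E a b s.
  by rewrite /lam2 rmorph_sum; apply: eq_bigr => A _; rewrite rmorphM /= sgnC lamC.
rewrite /theta rmorphB !rmorph_sum; congr (_ - _);
  by apply: eq_bigr => k _; rewrite rmorphM /= lam2C rmorph_sign.
Qed.

Lemma row_poly_coef0 N : (row_poly N)`_0 = 1 + 'X.
Proof.
apply/polyP=> v; rewrite coef_row_poly coefD coef1 coefX /=.
by case: v => [|[|v]]; rewrite ?addr0 ?add0r.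
Qed.

Lemma bsym_coef0 N v : (bsym N)`_0`_v = ((v == N) || (v.+1 == N))%:R.
Proof.
rewrite /bsym !coefD coef_hsym add0n; case: N => [|N].
  by rewrite !coef0 addr0 orbF.
rewrite coef_hsym add0n eqSS -natrD; congr (_%:R).
by case: eqP => [->|]; case: eqP => //; lia.
Qed.

(** As k < d - j, the third block has at least m + 1 points, so for m > 0 it supplies the factor (1
    + y)(1 + x) wanted by [alt_coef_blocks1]. For j = 0 only the part free of x matters. *)
Lemma alt_coef_pair m d j k : (j.*2 < d)%N -> (0 < m)%N || (j == 0)%N -> (k < d - j)%N ->
  let F := row_poly (m + d - j - k)%N * (bsym j * bsym k) in
  alt_coef j (d - j) F - alt_coef (d - j) j F = (k == (d - j).-1)%:R.
Proof.
move=> jd mj kq; case: j => [|j] in jd mj kq *.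
  rewrite !subn0 => F.
  have d0 : (0 < d)%N by lia.
  rewrite (@alt_coef0 _ _ ((bsym k)`_0)) //.
    by rewrite bsym_coef0; congr ((_ : bool)%:R); lia.
  rewrite /F !coef0M row_poly_coef0 (_ : (bsym 0)`_0 = 1) ?mul1r //.
  by apply/polyP=> v; rewrite bsym_coef0 coef1 orbF.
rewrite -addnn in jd; have [q qE] : exists q, (d - j.+1 = q.+1)%N by exists (d - j.+2)%N; lia.
rewrite qE /row_poly ifF; last by lia.
by rewrite -mulrA; apply: alt_coef_blocks1; lia.
Qed.

Lemma alt_coef_pair2 m d j i : (j.*2 < d)%N -> (0 < m)%N -> (i < j)%N ->
  let F := row_poly (m + d - (d - j) - i)%N * (bsym (d - j) * bsym i) in
  alt_coef j (d - j) F - alt_coef (d - j) j F = 0.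
Proof.
case: j => // j jd m0 ij; rewrite -addnn in jd.
have [q qE] : exists q, (d - j.+1 = q.+1)%N by exists (d - j.+2)%N; lia.
rewrite /row_poly ifF; last by lia.
by rewrite qE -mulrA; apply: alt_coef_blocks2; lia.
Qed.

(** Only one factor is expanded into [lam2] terms. Among their pairings with theta only that of e_j
    e_(d-j-1) h_(m+1) is nonzero; it is 1, and so is its coefficient in theta. *)
Lemma theta_norm m d j (f : 'CF([set: 'S_(m + d)])) : (j.*2 < d)%N ->
    (0 < m)%N || (j == 0)%N -> (forall s, f s = theta setT d j s) -> '[f] = 1.
Proof.
move=> jd mj fE; have jd2 : (j + j < d)%N by rewrite addnn.
rewrite cfdotE cardsT card_Sn.
under eq_bigr do rewrite fE theta_conj.
rewrite (eq_bigl predT) => [|s]; last by rewrite inE.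
suff -> : \sum_(s : 'S_(m + d)) theta setT d j s * theta setT d j s = (m + d)`!%:R.
  by rewrite mulVf // pnatr_eq0 -lt0n fact_gt0.
under eq_bigr => s _ do rewrite {1}/theta mulrBl !mulr_suml.
rewrite sumrB exchange_big [X in _ - X]exchange_big /=.
rewrite (eq_bigr (fun k : 'I_(d - j) => (m + d)`!%:R * (k == (d - j).-1 :> nat)%:R)); last first.
  move=> k _; under eq_bigr do rewrite -mulrA; rewrite -mulr_sumr sum_lam2_theta.
    rewrite alt_coef_pair //; case: eqP => [->|_]; last by rewrite !mulr0.
    by rewrite (_ : (d - j - (d - j).-1).-1 = 0%N) ?expr0 ?mul1r //; lia.
  by have := ltn_ord k; lia.
rewrite [X in _ - X]big1 => [|i _]; last first.
  under eq_bigr do rewrite -mulrA; rewrite -mulr_sumr sum_lam2_theta.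
    have ij := ltn_ord i; rewrite alt_coef_pair2 ?mulr0 //.
    by case/orP: mj => // /eqP j0; move: ij; rewrite {2}j0.
  by have := ltn_ord i; lia.
rewrite subr0 -mulr_sumr; have q0 : ((d - j).-1 < d - j)%N by lia.
rewrite (bigD1 (Ordinal q0)) //= eqxx big1 ?addr0 ?mulr1 // => k /negPf kq.
by rewrite -val_eqE /= in kq; rewrite kq.
Qed.

Lemma alt_coef_hook_rows m d j : (j.*2 < d)%N -> (0 < m)%N || (j == 0)%N ->
  let F := \prod_(l <- m.+1 :: nseq j 2%N ++ nseq (d - j.*2 - 1) 1%N) row_poly l in
  alt_coef j (d - j) F - alt_coef (d - j) j F = 1.
Proof.
case: j => [|j] jd mj.
  rewrite /= !subn0 (@alt_coef0 _ _ ((1 + 'X) ^+ d.-1)) //; first by rewrite coef_1DX binn.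
  rewrite coef0_prod (eq_bigr (fun _ => 1 + 'X)) => [|l _]; last exact: row_poly_coef0.
  rewrite big_const_seq count_predT iter_mulr_1 /= size_nseq -exprS; congr (_ ^+ _); lia.
rewrite orbF in mj; rewrite -addnn in jd.
have -> : (d - j.+1 = (j.+1 + (d - j.+1.*2 - 1)).+1)%N by rewrite -addnn; lia.
have rm : row_poly m.+1 = (1 + y) * (1 + x) by rewrite /row_poly ifF //; lia.
have [r1 r2] : row_poly 1 = 1 + x + y /\ row_poly 2 = (1 + y) * (1 + x) by [].
rewrite big_cons big_cat !big_nseq !iter_mulr_1 rm r1 r2.
by rewrite mulrA -exprS; apply: alt_coef_rows.
Qed.

(** Length of column c, for c at most m: the first row, the rows of length 2 and the rows of length
    1 are counted if they reach it. *)
Definition hook_height d j c := (1 + j * (c < 2) + (d - j.*2 - 1) * (c < 1))%N.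

Lemma alt_coef_hook_cols m d j : (j.*2 < d)%N -> (0 < m)%N || (j == 0)%N ->
  let F := \prod_(c < m.+1) bsym (hook_height d j c) in
  alt_coef j (d - j) F - alt_coef (d - j) j F = 1.
Proof.
have bsym1 : bsym 1 = 1 + x + y.
  rewrite bsymS expr1 (_ : hsym 0 = 1) ?mulr1; first by rewrite addrCA addrA.
  apply/polyP=> u; apply/polyP=> v; rewrite coef_hsym coef1.
  by case: u => [|u]; rewrite ?coef1 ?coef0.
have hS j' c : (1 < c)%N || (j' == 0)%N && (0 < c)%N -> hook_height d j' c = 1%N.
  by rewrite /hook_height; case/orP=> [|/andP[/eqP->]] hc; lia.
case: j => [|j] jd mj.
  rewrite big_ord_recl !subn0 (_ : hook_height d 0 ord0 = d); last by rewrite /hook_height /=; lia.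
  have -> : \prod_(c < m) bsym (hook_height d 0 (lift ord0 c)) = (1 + x + y) ^+ m.
    rewrite (eq_bigr (fun _ => bsym 1)) => [|c _]; last by rewrite hS // lift0 eqxx orbT.
    by rewrite prodr_const card_ord bsym1.
  move=> F; rewrite (@alt_coef0 _ _ ('X^(d.-1) * (1 + 'X) ^+ m)) //.
    by rewrite coefXnM ltnn subnn coef_1DX bin0.
  rewrite /F coef0M (_ : ((1 + x + y) ^+ m)`_0 = (1 + 'X) ^+ m); last first.
    by rewrite -horner_coef0 horner_exp !hornerE.
  rewrite mulrA; congr (_ * _).
  apply/polyP=> v; rewrite bsym_coef0 mulrDl mul1r coefD coefXM !coefXn.
  by case: v => [|v] /=; rewrite -?natrD ?addr0; congr (_%:R); lia.
rewrite orbF in mj; case: m mj => // m _; rewrite -addnn in jd.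
have [q qE] : exists q, (d - j.+1 = q.+1)%N by exists (d - j.+2)%N; lia.
rewrite !big_ord_recl mulrA qE.
have -> : hook_height d j.+1 ord0 = q.+1 by rewrite /hook_height -addnn /=; lia.
have -> : hook_height d j.+1 (lift ord0 ord0) = j.+2 by rewrite /hook_height /=; lia.
have -> : \prod_(c < m) bsym (hook_height d j.+1 (lift ord0 (lift ord0 c))) = (1 + x + y) ^+ m.
  rewrite (eq_bigr (fun _ => bsym 1)) => [|c _]; last by rewrite hS // !lift0.
  by rewrite prodr_const card_ord bsym1.
by apply: alt_coef_cols; lia.
Qed.

(** * Row and column pairings for the shape of the theorem *)

Section Hook.
Variables (m d j : nat).
Hypotheses (jd : (j.*2 < d)%N) (mj : (0 < m)%N || (j == 0)%N).
Local Notation la := (m.+1 :: nseq j 2%N ++ nseq (d - j.*2 - 1) 1%N).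
Local Notation n := (m + d)%N.

Lemma hook_sum : sumn la = n.
Proof. by rewrite /= sumn_cat !sumn_nseq; lia. Qed.

Lemma hook_partition : is_partition n la.
Proof.
apply/and3P; split; last by rewrite hook_sum.
  have path_nseq k a b : (b <= a)%N -> path geq a (nseq k b).
    by elim: k a => //= k IHk a ba; rewrite ba IHk.
  rewrite /= cat_path; apply/andP; split.
    by case/orP: mj => [m0|/eqP-> //]; apply: path_nseq.
  apply: path_nseq; elim: (j) (m) => [|k IHk] m' //=.
by rewrite /= all_cat !all_nseq !orbT.
Qed.

Lemma sum_row_theta :
  \sum_(t in row_group n la) theta setT d j t = #|row_group n la|%:R.
Proof.
pose kappa := row_of hook_sum; pose eps : pred 'I_(size la) := fun=> false.
have KE r : kappa @^-1: [set r] = [set z : 'I_n | reshape_index la z == r].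
  by apply/setP=> z; rewrite !inE -val_eqE.
have cK r : #|kappa @^-1: [set r]| = nth 0%N la r by rewrite KE card_row // hook_sum.
have GE : young_group kappa = row_group n la.
  apply/setP=> s; apply/young_groupP/row_groupP=> h z.
    by have /(congr1 val) := h z.
  exact/val_inj/h.
have FE : \prod_r block_poly kappa eps r = \prod_(l <- la) row_poly l.
  rewrite (big_nth 0%N) big_mkord; apply: eq_bigr => r _.
  rewrite block_poly_row ?cK //.
  have /allP : all (leq 1) la by rewrite /= all_cat !all_nseq !orbT.
  by apply; apply: mem_nth.
transitivity (\sum_(t in young_group kappa) young_sign kappa eps t * theta setT d j t).
  by rewrite GE; apply: eq_bigr => t _; rewrite /young_sign big_pred0 // mul1r.
rewrite sum_young_theta FE GE -[RHS]mulr1; congr (_ * _).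
exact: alt_coef_hook_rows.
Qed.

Lemma sum_col_theta :
  \sum_(s in col_group n la) (-1) ^+ s * theta setT d j s = #|col_group n la|%:R.
Proof.
have cl_lt (z : 'I_n) : (reshape_offset la z < m.+1)%N.
  apply: leq_trans (reshape_offsetP _) _; first by rewrite hook_sum.
  have /allP : all (leq^~ m.+1) la.
    rewrite /= leqnn all_cat !all_nseq /= orbT andbT.
    by case/orP: mj => [m0|->]; rewrite // ltnS m0 orbT.
  have := reshape_indexP (lt_sum_la hook_sum z) => lt_r.
  by move/(_ _ (mem_nth 0%N lt_r)).
pose kappa (z : 'I_n) : 'I_m.+1 := Ordinal (cl_lt z); pose eps : pred 'I_m.+1 := fun=> true.
have KE c : kappa @^-1: [set c] = [set z : 'I_n | reshape_offset la z == c].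
  by apply/setP=> z; rewrite !inE -val_eqE.
have cK c : #|kappa @^-1: [set c]| = hook_height d j c.
  rewrite KE (card_col hook_sum) -(big_mkord xpredT (fun r => nat_of_bool (c < nth 0 la r))%N).
  rewrite -(big_nth 0%N xpredT (fun l => nat_of_bool (c < l)%N)) big_cons big_cat /= !big_nseq.
  by rewrite !iter_addn_0 addnA mulnC [((c < 1) * _)%N]mulnC /hook_height ltn_ord.
have GE : young_group kappa = col_group n la.
  apply/setP=> s; apply/young_groupP/col_groupP=> h z.
    by have /(congr1 val) := h z.
  exact/val_inj/h.
have FE : \prod_c block_poly kappa eps c = \prod_(c < m.+1) bsym (hook_height d j c).
  by apply: eq_bigr => c _; rewrite block_poly_col ?cK.
have sgnE s : s \in col_group n la -> young_sign kappa eps s = (-1) ^+ s.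
  rewrite -GE => /young_groupP sG; rewrite -sgn_onT (sgn_on_bigcup (stableT s) sG).
  by apply: eq_bigr => c _; rewrite setTI.
transitivity (\sum_(s in young_group kappa) young_sign kappa eps s * theta setT d j s).
  by rewrite GE; apply: eq_bigr => s Cs; rewrite sgnE.
rewrite sum_young_theta FE GE -[RHS]mulr1; congr (_ * _).
exact: alt_coef_hook_cols.
Qed.

End Hook.

Theorem theorem3p2 (Q : eqmatroid_polynomial) (hQ : inverse_KL Q)
    (m d : nat) (hd : (1 <= d)%N) :
  Q _ _ _ _ (eq_uniform m d) =
    \sum_(0 <= j < (d.-1)./2.+1)
      V (m + d) (m.+1 :: nseq j 2%N ++ nseq (d - j.*2 - 1) 1%N) *: 'X^j.
Proof.
have unif : is_uniform (eq_uniform m d) d.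
  rewrite /is_uniform /= cardsT card_ord leq_addl; split=> // A _.
  by rewrite inE.
have [/polyOverP QZ _ szQ _] := hQ _ _ _ _ (eq_uniform m d).
rewrite (uniform_rk unif) in szQ; have {}szQ := szQ hd.
apply/polyP=> j; rewrite coef_sum big_mkord.
have -> : \sum_(i < (d.-1)./2.+1)
    (V (m + d) (m.+1 :: nseq i 2%N ++ nseq (d - i.*2 - 1) 1%N) *: 'X^i)`_j =
    if (j.*2 < d)%N then V (m + d) (m.+1 :: nseq j 2%N ++ nseq (d - j.*2 - 1) 1%N) else 0.
  have jd : (j.*2 < d)%N = (j < (d.-1)./2.+1)%N.
    by rewrite ltnS geq_half_double; case: (d) hd.
  rewrite jd; case: ltnP => jq.
    rewrite (bigD1 (Ordinal jq)) //= big1 => [|i /negPf ij].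
      by rewrite addr0 coefZ coefXn eqxx mulr1.
    by rewrite coefZ coefXn eq_sym [_ == _]ij mulr0.
  rewrite big1 // => i _; rewrite coefZ coefXn gtn_eqF ?mulr0 //.
  exact: leq_trans (ltn_ord i) jq.
(* Beyond the summation range the coefficient of [Q] vanishes by the degree bound. *)
case: ltnP => jd; last first.
  rewrite nth_default //; move: szQ; set z := size _; rewrite -!addnn in jd *.
  by case: z => [|z] /=; lia.
have QE s : (Q _ _ _ _ (eq_uniform m d))`_j s = theta setT d j s.
  rewrite (inverse_KL_uniform hQ unif jd) ?inE //; congr (theta _ _ _ _).
  by apply/permP=> i; rewrite actpermE.
(* For m = 0 and j > 0 the list begins with 1, 2 and is not a partition. *)
have [mj | /norP[m0 j0]] := boolP ((0 < m)%N || (j == 0%N)).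
  rewrite /V hook_partition //; apply/esym; apply: specht_eq_vchar => //.
  - exact: hook_sum.
  - exact: QZ.
  - exact: theta_norm jd mj QE.
  - under eq_bigr do rewrite QE.
    by rewrite sum_row_theta // ltr0n (cardG_gt0 (row_group_group _ _)).
  under eq_bigr do rewrite QE.
  by rewrite sum_col_theta // (neq0CG (col_group_group _ _)).
have -> : V (m + d) (m.+1 :: nseq j 2%N ++ nseq (d - j.*2 - 1) 1%N) = 0.
  rewrite /V; move: m0 j0; rewrite -eqn0Ngt => /eqP->; case: (j) => // i _.
apply/cfunP=> s; rewrite QE cfunE; move: m0; rewrite -eqn0Ngt => /eqP m0.
have dE : d = #|[set: 'I_(m + d)]| by rewrite cardsT card_ord m0.
(* With m = 0 the matroid is boolean, and theta vanishes in positive t-degree. *)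
have := @theta_boolean _ setT s (stableT s) j; rewrite -dE => ->//.
by rewrite (negPf j0) mul0r.
Qed.
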